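(* As formal power series in $q$, \[ \sum_{n\ge0}\big(N(0,8;n)-N(4,8;n)\big)q^{n}=2+2q^2g(q^2;q^{16})-\frac{\overline{J}_{2,4}J_{6,16}}{J_4}+q\,\frac{\overline{J}_{2,4}J_{2,16}}{J_4}, \] \[ \sum_{n\ge0}\big(N(1,8;n)-N(3,8;n)\big)q^{n}=-1-q^2g(q^2;q^{16})+q^5g(q^6;q^{16})+\frac{\overline{J}_{2,4}J_{6,16}}{J_4}. \]
   Context: Throughout, $q$ is a complex number with $0<|q|<1$. Write $(x)_n=(x;q)_n=\prod_{i=0}^{n-1}(1-q^ix)$ and $(x)_\infty=(x;q)_\infty=\prod_{i\ge0}(1-q^ix)$. Let $j(x;q)=(x)_\infty(q/x)_\infty(q)_\infty=\sum_{n\in\mathbb Z}(-1)^nq^{\binom n2}x^n$. For integers $a$ and $m\ge1$: $J_{a,m}=j(q^a;q^m)$, $\overline{J}_{a,m}=j(-q^a;q^m)$, and $J_m=J_{m,3m}=\prod_{i\ge1}(1-q^{mi})$. The universal mock theta function is $g(x;q)=x^{-1}\big(-1+\sum_{n\ge0}\frac{q^{n^2}}{(x)_{n+1}(q/x)_n}\big)$. Ranks: define integers $N(m,n)$ ($m\in\mathbb Z$, $n\ge0$) by $\sum_{n\ge0}\sum_{m\in\mathbb Z}N(m,n)z^mq^n=\sum_{n\ge0}\frac{q^{n^2}}{(zq)_n(z^{-1}q)_n}$; for $n\ge1$, $N(m,n)$ is the number of partitions of $n$ with rank (largest part minus number of parts) equal to $m$, and $N(m,0)=\delta_{m,0}$.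 For $M\ge1$ and an integer $a$, $N(a,M;n)=\sum_{m\equiv a \pmod M}N(m,n)$. *)

(* Defs.v *)
From HB Require Import structures.
From mathcomp Require Import all_boot all_order all_algebra.
Set Implicit Arguments. Unset Strict Implicit. Unset Printing Implicit Defensive.
Import Order.TTheory GRing.Theory Num.Theory.
Local Open Scope ring_scope.

Definition series := nat -> int.

Definition sconst (c : int) : series := fun n => if n == 0%N then c else 0.
Definition szero : series := sconst 0.
Definition sone : series := sconst 1.
Definition smon (c : int) (e : nat) : series := fun n => if n == e then c else 0.
Definition sadd (f g : series) : series := fun n => f n + g n.
Definition sopp (f : series) : series := fun n => - f n.
Definition ssub (f g : series) : series := fun n => f n - g n.
Definition smul (f g : series) : series :=
  fun n => \sum_(i < n.+1) f i * g (n - i)%N.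
Definition sshift (e : nat) (f : series) : series :=
  fun n => if (e <= n)%N then f (n - e)%N else 0.
Definition ssum (s : seq series) : series := foldr sadd szero s.
Definition sprod (s : seq series) : series := foldr smul sone s.
Definition spow (f : series) (k : nat) : series := iter k (smul f) sone.
(* inverse of a series with constant term 1:  1/f = sum_k (1 - f)^k
   (the k-th term has order >= k, so the n-th coefficient only needs k <= n) *)
Definition sinv (f : series) : series :=
  fun n => ssum [seq spow (ssub sone f) k | k <- iota 0 n.+1] n.
Definition sdiv (f g : series) : series := smul f (sinv g).

Definition sgn (b : bool) : int := (-1) ^+ b.

Definition qpoch (b : bool) (e m k : nat) : series :=
  sprod [seq ssub sone (smon (sgn b) (e + m * i)) | i <- iota 0 k].

(* (s q^e ; q^m)_oo  (for m >= 1, factors i > n do not affect coefficient n) *)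
Definition qpoch_inf (b : bool) (e m : nat) : series :=
  fun n => qpoch b e m n.+1 n.

(* j(s q^e ; q^m) = (x)_oo (q^m/x)_oo (q^m)_oo, x = s q^e, 0 <= e <= m
   (note 1/s = s since s = +-1) *)
Definition jth (b : bool) (e m : nat) : series :=
  smul (smul (qpoch_inf b e m) (qpoch_inf b (m - e) m)) (qpoch_inf false m m).

Definition J (a m : nat) : series := jth false a m.
Definition Jbar (a m : nat) : series := jth true a m.
Definition Jm (m : nat) : series := J m (3 * m).

(* Universal mock theta function with x = q^a, base q^m:
     g(q^a;q^m) = q^{-a} * Gser a m, where
     Gser a m = -1 + sum_{n>=0} q^{m n^2} / ((q^a;q^m)_{n+1} (q^{m-a};q^m)_n).
   The n-th summand has order >= m n^2, so coefficient k only needs n <= k. *)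
Definition Gser (a m : nat) : series :=
  fun k => ssum [seq sshift (m * n * n)
                   (sinv (smul (qpoch false a m n.+1) (qpoch false (m - a) m n)))
                 | n <- iota 0 k.+1] k - (k == 0%N)%:R.

(* q^b g(q^a;q^m) = q^{b-a} Gser a m, as a power series
   (used only where this is a genuine power series). *)
Definition qg (b a m : nat) : series :=
  fun k => if (b <= k + a)%N then Gser a m (k + a - b)%N else 0.

(* Partitions and ranks.
   A partition of (at most) weight n is encoded by its multiplicity function
   mu : 'I_n -> 'I_n.+1, mu i = number of parts equal to i+1. *)
Definition ptn (n : nat) := {ffun 'I_n -> 'I_n.+1}.
Definition pweight n (mu : ptn n) : nat := (\sum_(i < n) i.+1 * mu i)%N.
Definition pnparts n (mu : ptn n) : nat := (\sum_(i < n) mu i)%N.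
Definition plargest n (mu : ptn n) : nat := (\max_(i < n | (mu i != 0%N :> nat)) i.+1)%N.
(* rank = largest part - number of parts (the empty partition has rank 0) *)
Definition prank n (mu : ptn n) : int := (plargest mu)%:Z - (pnparts mu)%:Z.

(* N(m,n): number of partitions of n with rank m (N(m,0) = delta_{m,0}) *)
Definition Nrank (m : int) (n : nat) : nat :=
  #|[set mu : ptn n | (pweight mu == n) && (prank mu == m)]|.

Definition NM (a : int) (M : nat) (n : nat) : nat :=
  #|[set mu : ptn n | (pweight mu == n) && ((M%:Z %| prank mu - a)%Z)]|.

(* Main.v *)
(** Put [q = t^2] and work in the field of Laurent series in [t], viewed only as
    a complete non-archimedean field, so that all [q]-series are honest limits.
    With [G(x;Q) = 1 + x g(x;Q) = sum_n Q^(n^2) / ((x)_(n+1) (Q/x)_n)], the rank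
    generating function at [z] is [(1 - z) G(z;q)] (Rogers-Fine).  Lagrange
    interpolation gives finite partial fractions which pass to the limit by
    Tannery's theorem: one denominator factor, together with the q-Vandermonde
    sum, gives the Appell form of [G]; three theta factors give the expansion of
    [1/(theta theta theta)] as a sum of three Appell sums.  Comparing the two yields
    [G(x;Q) = 1 - G(-Q/x^2;Q^4) + (G(-Q x^2;Q^4) - 1)/x + theta quotient].  Applying
    this at a primitive eighth root of unity [x = z], and then at [x = +-i q] in
    base [q^4], reaches [g(q^2;q^16)] and [g(q^6;q^16)]; the theta quotients combine
    through the identities relating [J_{6,16}], [q J_{2,16}] and [phi] obtained by
    squaring [J_{6,16} + i q J_{2,16}].  Finally the values at the four primitive
    eighth roots and at [+-i] separate the residue classes modulo 8. *)

Require Import Defs.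
From HB Require Import structures.
From mathcomp Require Import all_boot all_order all_algebra all_field.
From mathcomp Require Import boolp ring lra zify generic_quotient.
Set Implicit Arguments. Unset Strict Implicit. Unset Printing Implicit Defensive.
Import Order.TTheory GRing.Theory Num.Theory.
Local Open Scope ring_scope.

(** The exponents n(n-1)/2 and n(3n+1)/2 and the square root of -Q used below are the reason why
    every base Q comes with a square root s, the outermost being t. The three theta factors sit at
    the nodes 1, u, -u with u^2 = -Q. As (-u) u = Q, the sum at node 1 carries exactly the weight of
    the Appell form of G; the sums at u and -u share the denominator 1 - (x u Q^n)^2, and their
    halves with n even and n odd are Appell sums in base Q^4. Each dissection multiplies the
    exponent of the base by 4, so two are needed to reach q^16. After the first, the squares of the
    arguments are -q^2, free of roots of unity, and so the second gives pure powers of q as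
    arguments. Three products then compete: [phi 2] from the first theta quotient, [phi 8] from the
    second, [phi 4] in the claim; [phi_sum] trades [phi 8] for the other two, and [phi 2] cancels.
    For partitions, Rogers-Fine regrades the rank generating function by largest part: once this
    part is fixed, the multiplicities are independent and the number of parts is additive in
    them. *)

(* [small n x] stands for "[x] has valuation at least [n]". Only [small_bounded]
   says that valuations are bounded below; there is no valuation function. *)
Record vfield := VField {
  vcarrier :> fieldType;
  small : nat -> vcarrier -> Prop;
  small0 : forall n, small n 0;
  smallB : forall n x y, small n x -> small n y -> small n (x - y);
  smallM : forall m n x y, small m x -> small n y -> small (m + n) (x * y);
  small_le : forall m n x, (m <= n)%N -> small n x -> small m x;
  small1 : small 0 1;
  small_sep : forall x, (forall n, small n x) -> x = 0;
  small_geom : forall x, small 1 x -> small 0 (1 - x)^-1;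
  small_bounded : forall x, exists k, forall n y, small (n + k) y -> small n (x * y);
  small_complete : forall u : nat -> vcarrier,
    (forall n, small n (u n.+1 - u n)) -> exists l, forall n, small n (u n - l) }.

(** * Limits in a complete non-archimedean field *)

Definition lim (K : vfield) (u : nat -> K) (l : K) :=
  forall n, exists N, forall m, (N <= m)%N -> small n (u m - l).

Section Limits.
Variable K : vfield.
Implicit Types (x y l : K) (u w : nat -> K) (m n N : nat).

Lemma smallN n x : small n x -> small n (- x).
Proof. by move=> hx; rewrite -sub0r; apply: smallB => //; apply: small0. Qed.

Lemma smallNE n x : small n (- x) <-> small n x.
Proof. by split=> /smallN //; rewrite opprK. Qed.

Lemma smallD n x y : small n x -> small n y -> small n (x + y).
Proof. by move=> hx hy; rewrite -[y]opprK; apply: smallB => //; apply: smallN. Qed.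

Lemma smallMl n x y : small 0 x -> small n y -> small n (x * y).
Proof. by move=> hx hy; rewrite -[n]add0n; apply: smallM. Qed.

Lemma smallMr n x y : small n x -> small 0 y -> small n (x * y).
Proof. by move=> hx hy; rewrite mulrC; apply: smallMl. Qed.

Lemma small_weak n x : small n x -> small 0 x.
Proof. exact: small_le. Qed.

Lemma smallX n x k : small n x -> small (n * k) (x ^+ k).
Proof.
move=> hx; elim: k => [|k IH]; first by rewrite muln0 expr0; apply: small1.
by rewrite exprS mulnS; apply: smallM.
Qed.

Lemma smallX0 x k : small 0 x -> small 0 (x ^+ k).
Proof. by move=> hx; have := smallX k hx; rewrite mul0n. Qed.

Lemma smallX1 x k : small 1 x -> small k (x ^+ k).
Proof. by move=> hx; have := smallX k hx; rewrite mul1n. Qed.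

Lemma small_sum (I : Type) (r : seq I) (P : pred I) (F : I -> K) n :
  (forall i, P i -> small n (F i)) -> small n (\sum_(i <- r | P i) F i).
Proof.
by move=> h; elim/big_ind: _ => //; [apply: small0 | move=> x y; apply: smallD].
Qed.

Lemma small_prod0 (I : Type) (r : seq I) (P : pred I) (F : I -> K) :
  (forall i, P i -> small 0 (F i)) -> small 0 (\prod_(i <- r | P i) F i).
Proof.
by move=> h; elim/big_ind: _ => //; [apply: small1 | move=> x y; apply: smallMl].
Qed.

(** If [x] were 1, then 1 = x^n would be small to every order, hence 0 by [small_sep]. *)
Lemma small1_neq1 x : small 1 x -> 1 - x != 0.
Proof.
move=> hx; apply/negP => /eqP /subr0_eq h; move: hx; rewrite -h => h1.
suff: (1 : K) = 0 by move/eqP; rewrite oner_eq0.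
by apply: small_sep => n; rewrite -(expr1n _ n); apply: smallX1.
Qed.

Lemma small_1B x : small 0 x -> small 0 (1 - x).
Proof. by move=> hx; apply: smallB => //; apply: small1. Qed.

Lemma lim_cst l : lim (fun=> l) l.
Proof. by move=> n; exists 0 => m _; rewrite subrr; apply: small0. Qed.

Lemma lim_uniq u l l' : lim u l -> lim u l' -> l = l'.
Proof.
move=> h h'; apply/eqP; rewrite -subr_eq0; apply/eqP; apply: small_sep => n.
have [N hN] := h n; have [N' hN'] := h' n.
have -> : l - l' = (u (N + N')%N - l') - (u (N + N')%N - l) by ring.
by apply: smallB; [apply: hN'; rewrite leq_addl | apply: hN; rewrite leq_addr].
Qed.

Lemma lim_near u w l : (exists N, forall m, (N <= m)%N -> u m = w m) ->
  lim u l -> lim w l.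
Proof.
move=> [N h] hu n; have [N' hN'] := hu n; exists (N + N')%N => m hm.
by rewrite -h; [apply: hN' |]; lia.
Qed.

Lemma lim_ext u w l : u =1 w -> lim u l -> lim w l.
Proof. by move=> h; apply: lim_near; exists 0. Qed.

Lemma lim_sub u l (f : nat -> nat) : (forall m, (m <= f m)%N) ->
  lim u l -> lim (fun m => u (f m)) l.
Proof.
by move=> hf hu n; have [N hN] := hu n; exists N => m hm; apply: hN; apply: leq_trans (hf m).
Qed.

Lemma limD u w l l' : lim u l -> lim w l' -> lim (fun m => u m + w m) (l + l').
Proof.
move=> h h' n; have [N hN] := h n; have [N' hN'] := h' n; exists (N + N')%N => m hm.
have -> : u m + w m - (l + l') = (u m - l) + (w m - l') by ring.
by apply: smallD; [apply: hN | apply: hN']; lia.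
Qed.

Lemma limN u l : lim u l -> lim (fun m => - u m) (- l).
Proof.
move=> h n; have [N hN] := h n; exists N => m hm.
by rewrite -opprD; apply: smallN; apply: hN.
Qed.

Lemma limB u w l l' : lim u l -> lim w l' -> lim (fun m => u m - w m) (l - l').
Proof. by move=> h /limN; apply: limD. Qed.

Lemma limM u w l l' : lim u l -> lim w l' -> lim (fun m => u m * w m) (l * l').
Proof.
move=> h h' n; have [k hk] := small_bounded l; have [k' hk'] := small_bounded l'.
have [N hN] := h (n + k')%N; have [N' hN'] := h' (n + k)%N; exists (N + N')%N => m hm.
have -> : u m * w m - l * l' = (u m - l) * (w m - l') + (l * (w m - l') + l' * (u m - l)).
  by ring.
have h1 := hN m ltac:(lia); have h2 := hN' m ltac:(lia).
apply: smallD; last by apply: smallD; [apply: hk | apply: hk'].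
have := smallM h1 h2; apply: small_le; lia.
Qed.

Lemma limZ u l x : lim u l -> lim (fun m => x * u m) (x * l).
Proof. by move=> h; apply: limM => //; apply: lim_cst. Qed.

(** With [d = (l - u m) / l] one has [u m = l (1 - d)], and the error is [l^-1 d / (1 - d)]; once
    [d] is small, [small_geom] bounds the denominator. The margin [k] is paid twice because [l^-1],
    of unknown size, multiplies twice. *)
Lemma limV u l : l != 0 -> lim u l -> lim (fun m => (u m)^-1) l^-1.
Proof.
move=> l0 h n; have [k hk] := small_bounded l^-1.
have [N hN] := h (n + k + k + 1)%N; exists N => m hm.
set d := l^-1 * (l - u m).
have hd1 : small (n + k + 1) d.
  by apply: hk; rewrite -opprB; apply: smallN; apply: small_le (hN m hm); lia.
have hd : small 1 d by apply: small_le hd1; lia.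
have u0 : u m = l * (1 - d) by rewrite /d; field.
have d0 := small1_neq1 hd.
have -> : (u m)^-1 - l^-1 = l^-1 * ((1 - d)^-1 * d) by rewrite u0; field; rewrite l0 d0.
apply: hk; apply: smallMl; first exact: small_geom.
by apply: small_le hd1; lia.
Qed.

Lemma lim_sum (I : Type) (r : seq I) (P : pred I) (F : nat -> I -> K) (L : I -> K) :
  (forall i, P i -> lim (F^~ i) (L i)) ->
  lim (fun m => \sum_(i <- r | P i) F m i) (\sum_(i <- r | P i) L i).
Proof.
move=> h; elim: r => [|i r IH].
  by rewrite big_nil; apply: lim_ext (lim_cst 0) => m; rewrite big_nil.
have e m : \sum_(j <- i :: r | P j) F m j =
  (if P i then F m i else 0) + \sum_(j <- r | P j) F m j.
  by rewrite big_cons; case: ifP; rewrite ?add0r.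
apply: (lim_ext (fun m => esym (e m))).
have -> : \sum_(j <- i :: r | P j) L j = (if P i then L i else 0) + \sum_(j <- r | P j) L j.
  by rewrite big_cons; case: ifP; rewrite ?add0r.
apply: limD => //; case: ifP => [/h //|_]; exact: lim_cst.
Qed.

Lemma lim_prod (I : Type) (r : seq I) (P : pred I) (F : nat -> I -> K) (L : I -> K) :
  (forall i, P i -> lim (F^~ i) (L i)) ->
  lim (fun m => \prod_(i <- r | P i) F m i) (\prod_(i <- r | P i) L i).
Proof.
move=> h; elim: r => [|i r IH].
  by rewrite big_nil; apply: lim_ext (lim_cst 1) => m; rewrite big_nil.
have e m : \prod_(j <- i :: r | P j) F m j =
  (if P i then F m i else 1) * \prod_(j <- r | P j) F m j.
  by rewrite big_cons; case: ifP; rewrite ?mul1r.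
apply: (lim_ext (fun m => esym (e m))).
have -> : \prod_(j <- i :: r | P j) L j = (if P i then L i else 1) * \prod_(j <- r | P j) L j.
  by rewrite big_cons; case: ifP; rewrite ?mul1r.
apply: limM => //; case: ifP => [/h //|_]; exact: lim_cst.
Qed.

Lemma lim_small n u l : lim u l ->
  (exists N, forall m, (N <= m)%N -> small n (u m)) -> small n l.
Proof.
move=> h [N hN]; have [N' hN'] := h n.
have -> : l = u (N + N')%N - (u (N + N')%N - l) by ring.
by apply: smallB; [apply: hN | apply: hN']; lia.
Qed.

Lemma lim_small0 u : (forall n, exists N, forall m, (N <= m)%N -> small n (u m)) -> lim u 0.
Proof. by move=> h n; have [N hN] := h n; exists N => m hm; rewrite subr0; apply: hN. Qed.

Lemma lim_small1 u : (forall m, small m (u m)) -> lim u 0.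
Proof. by move=> h; apply: lim_small0 => n; exists n => m hm; apply: small_le (h m). Qed.

(** Ultrametric inequality: any number of steps together is no larger than the largest one. *)
Lemma small_tail u n N : (forall m, (N <= m)%N -> small n (u m.+1 - u m)) ->
  forall m, (N <= m)%N -> small n (u m - u N).
Proof.
move=> h m hm; rewrite -(subnK hm); elim: (m - N)%N => [|k IH].
  by rewrite add0n subrr; apply: small0.
have -> : u (k.+1 + N)%N - u N = (u (k + N).+1 - u (k + N)%N) + (u (k + N)%N - u N).
  by rewrite addSn; ring.
by apply: smallD => //; apply: h; lia.
Qed.

Lemma cauchy_lim u : (forall n, exists N, forall m, (N <= m)%N -> small n (u m.+1 - u m)) ->
  exists l, lim u l.
Proof.
move=> h; have [f hf] := choice h.
(* The completeness axiom wants the [n]-th step already of order [n]; the partial sums [g] of the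
   thresholds [f] pick a monotone subsequence with this rate. *)
pose g := fix g n := match n with 0 => f 0 | n.+1 => (g n + f n.+1)%N end.
have fg n : (f n <= g n)%N by case: n => //= n; rewrite leq_addl.
have gS n : (g n <= g n.+1)%N by rewrite /= leq_addr.
have [|l hl] := @small_complete K (fun n => u (g n)).
  move=> n; apply: (@small_tail u n (g n)) => // m hm.
  by apply: hf; apply: leq_trans hm.
exists l => n; exists (g n) => m hm.
have -> : u m - l = (u m - u (g n)) + (u (g n) - l) by ring.
apply: smallD => //; apply: small_tail => // k hk; apply: hf; exact: leq_trans hk.
Qed.

End Limits.

(** A total operator: a sequence without limit gets the default 0, so the value has a meaning only
    after convergence is shown, by [LimE] or [Lim_cauchy]. *)
Definition Lim (K : vfield) (u : nat -> K) : K :=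
  if pselect (exists l, lim u l) is left h then sval (cid h) else 0.

Section Lim.
Variable K : vfield.
Implicit Types (x y l : K) (u w : nat -> K) (m n N : nat).

Lemma LimE u l : lim u l -> Lim u = l.
Proof.
move=> h; rewrite /Lim; case: pselect => [h'|[]]; last by exists l.
exact: lim_uniq (svalP (cid h')) h.
Qed.

Lemma Lim_cauchy u :
  (forall n, exists N, forall m, (N <= m)%N -> small n (u m.+1 - u m)) -> lim u (Lim u).
Proof. by move=> /cauchy_lim [l hl]; rewrite (LimE hl). Qed.

Lemma Lim_series u : (forall n, exists N, forall m, (N <= m)%N -> small n (u m)) ->
  lim (fun N => \sum_(i < N) u i) (Lim (fun N => \sum_(i < N) u i)).
Proof.
move=> h; apply: Lim_cauchy => n; have [N hN] := h n; exists N => m hm.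
by rewrite big_ord_recr /= addrAC subrr add0r; apply: hN.
Qed.

Lemma eq_Lim u w : u =1 w -> Lim u = Lim w.
Proof. by move=> h; congr Lim; apply: funext. Qed.

End Lim.

(** * Bilateral series *)

Definition zrange (N : nat) : seq int := map Posz (iota 0 N.+1) ++ map Negz (iota 0 N).

Lemma mem_zrange N z : (z \in zrange N) = (absz z <= N)%N.
Proof.
rewrite mem_cat; case: z => k.
  rewrite mem_map; last by move=> ? ? [].
  rewrite mem_iota /= add0n ltnS; case: (k <= N)%N => //=.
  by apply/negP => /mapP [? _].
rewrite orbC mem_map; last by move=> ? ? [].
rewrite mem_iota /= add0n; case: (k < N)%N => //=.
by apply/negP => /mapP [? _].
Qed.

Definition bs (V : comNzRingType) (f : int -> V) (N : nat) : V := \sum_(z <- zrange N) f z.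

Section Bs.
Variable V : comNzRingType.
Implicit Types (f : int -> V).

Lemma bs0 f : bs f 0 = f 0.
Proof. by rewrite /bs /zrange /= big_seq1. Qed.

Lemma bsE f N : bs f N = \sum_(i < N.+1) f (Posz i) + \sum_(i < N) f (Negz i).
Proof.
have iotaE n : iota 0 n = index_iota 0 n by rewrite /index_iota subn0.
by rewrite /bs big_cat !big_map !iotaE !big_mkord.
Qed.

Lemma bsS f N : bs f N.+1 = bs f N + (f N.+1%:Z + f (- N.+1%:Z)).
Proof.
rewrite !bsE big_ord_recr [X in _ + X = _]big_ord_recr /= NegzE.
by rewrite addrACA.
Qed.

Lemma bs_opp f N : bs (fun z => f (- z)) N = bs f N.
Proof.
elim: N => [|N IH]; first by rewrite !bs0 oppr0.
by rewrite !bsS IH opprK [f _ + f _]addrC.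
Qed.

Lemma bs_shift f N : bs (fun z => f (z + 1)) N = bs f N + (f (N%:Z + 1) - f (- N%:Z)).
Proof.
elim: N => [|N IH]; first by rewrite !bs0 oppr0 add0r; ring.
rewrite !bsS IH.
have -> : - N.+1%:Z + 1 = - N%:Z by lia.
have -> : N%:Z + 1 = N.+1%:Z by lia.
ring.
Qed.

(** The odd numbers 2z + 1 with |z| <= N run from -(2N - 1) to 2N + 1, so the lower endpoint -(2N +
    1) of the symmetric range is left over. *)
Lemma bs_even_odd f N : bs f N.*2.+1 =
  bs (fun z => f (z *+ 2)) N + bs (fun z => f (z *+ 2 + 1)) N + f (- N.*2.+1%:Z).
Proof.
elim: N => [|N IH]; first by rewrite bsS !bs0 mul0rn add0r addrA.
rewrite doubleS 2!bsS IH !bsS.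
have -> : N.+1%:Z *+ 2 = N.*2.+2 by lia.
have -> : (- N.+1%:Z) *+ 2 = - N.*2.+2%:Z by lia.
have -> : N.*2.+2%:Z + 1 = N.*2.+3 by lia.
have -> : - N.*2.+2%:Z + 1 = - N.*2.+1%:Z by lia.
ring.
Qed.

End Bs.

Section Bilateral.
Variable K : vfield.
Implicit Types (x y l : K) (f g : int -> K) (m n N : nat).

(** In an ultrametric field terms tending to 0 already make a bilateral series converge; this takes
    the place of absolute convergence. *)
Definition vanish f := forall n, exists N, forall z : int, (N <= absz z)%N -> small n (f z).

Definition bsum f := Lim (bs f).

Lemma vanish_lim f : vanish f -> lim (bs f) (bsum f).
Proof.
move=> h; apply: Lim_cauchy => n; have [N hN] := h n; exists N => m hm.
rewrite bsS addrAC subrr add0r; apply: smallD; apply: hN; lia.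
Qed.

Lemma bsumE f l : lim (bs f) l -> bsum f = l.
Proof. exact: LimE. Qed.

Lemma eq_bsum f g : f =1 g -> bsum f = bsum g.
Proof. by move=> h; congr bsum; apply: funext. Qed.

Lemma eq_vanish f g : f =1 g -> vanish f -> vanish g.
Proof. by move=> /funext ->. Qed.

Lemma vanishZ x f : vanish f -> vanish (fun z => x * f z).
Proof.
move=> h n; have [k hk] := small_bounded x; have [N hN] := h (n + k)%N.
by exists N => z hz; apply: hk; apply: hN.
Qed.

Lemma vanishD f g : vanish f -> vanish g -> vanish (fun z => f z + g z).
Proof.
move=> h h' n; have [N hN] := h n; have [N' hN'] := h' n; exists (N + N')%N => z hz.
by apply: smallD; [apply: hN | apply: hN']; lia.
Qed.

Lemma vanishMr f g : vanish f -> (exists N, forall z, (N <= absz z)%N -> small 0 (g z)) ->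
  vanish (fun z => f z * g z).
Proof.
move=> h [N' hN'] n; have [N hN] := h n; exists (N + N')%N => z hz.
by apply: smallMr; [apply: hN | apply: hN']; lia.
Qed.

Lemma vanish_comp f (e : int -> int) :
  (exists k, forall z, (absz z <= absz (e z) + k)%N) -> vanish f -> vanish (fun z => f (e z)).
Proof.
move=> [k hk] h n; have [N hN] := h n; exists (N + k)%N => z hz; apply: hN.
have := hk z; lia.
Qed.

Lemma bsumZ x f : vanish f -> bsum (fun z => x * f z) = x * bsum f.
Proof.
move=> h; apply: bsumE; apply: lim_ext (limZ x (vanish_lim h)) => m.
by rewrite /bs mulr_sumr.
Qed.

Lemma bsumD f g : vanish f -> vanish g -> bsum (fun z => f z + g z) = bsum f + bsum g.
Proof.
move=> h h'; apply: bsumE; apply: lim_ext (limD (vanish_lim h) (vanish_lim h')) => m.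
by rewrite /bs big_split.
Qed.

Lemma bsum_opp f : bsum (fun z => f (- z)) = bsum f.
Proof. by congr Lim; apply: funext => N; rewrite bs_opp. Qed.

Lemma bsum_shift1 f : vanish f -> bsum (fun z => f (z + 1)) = bsum f.
Proof.
move=> h; apply: bsumE; apply: lim_ext (fun m => esym (bs_shift f m)) _.
rewrite -[bsum f]addr0; apply: limD; first exact: vanish_lim.
apply: lim_small0 => n; have [N hN] := h n; exists N => m hm.
by apply: smallB; apply: hN; lia.
Qed.

Lemma bsum_shift f (k : int) : vanish f -> bsum (fun z => f (z + k)) = bsum f.
Proof.
have pos (n : nat) g : vanish g -> bsum (fun z => g (z + n%:Z)) = bsum g.
  elim: n g => [|n IH] g h; first by apply: eq_bsum => z; rewrite addr0.
  rewrite -[RHS]IH // -[RHS]bsum_shift1; last by apply: vanish_comp h; exists n => z; lia.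
  by apply: eq_bsum => z; congr g; lia.
case: k => n h; first exact: pos.
rewrite -[LHS](pos n.+1); last by apply: vanish_comp h; exists n.+1 => z; lia.
by apply: eq_bsum => z; congr f; lia.
Qed.

Lemma bsum_even_odd f : vanish f ->
  bsum f = bsum (fun z => f (z *+ 2)) + bsum (fun z => f (z *+ 2 + 1)).
Proof.
move=> h.
have h0 : vanish (fun z => f (z *+ 2)) by apply: vanish_comp h; exists 0 => z; lia.
have h1 : vanish (fun z => f (z *+ 2 + 1)) by apply: vanish_comp h; exists 1 => z; lia.
have hs : lim (fun m => bs f m.*2.+1) (bsum f).
  by apply: (@lim_sub K (bs f) _ (fun m => m.*2.+1)) (vanish_lim h) => m; lia.
apply: lim_uniq hs _.
apply: lim_ext (fun m => esym (bs_even_odd f m)) _.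
rewrite -[_ + _]addr0; apply: limD; first by apply: limD; apply: vanish_lim.
by apply: lim_small0 => n; have [N hN] := h n; exists N => m hm; apply: hN; lia.
Qed.

Lemma bs_tail f n N : (forall z, (N <= absz z)%N -> small n (f z)) ->
  forall m, (N <= m)%N -> small n (bs f m - bs f N).
Proof.
move=> h; apply: small_tail => m hm.
by rewrite bsS addrAC subrr add0r; apply: smallD; apply: h; lia.
Qed.

Lemma bsum_tail f n N : vanish f -> (forall z, (N <= absz z)%N -> small n (f z)) ->
  forall m, (N <= m)%N -> small n (bsum f - bs f m).
Proof.
move=> hv h m hm; apply: (lim_small (limB (vanish_lim hv) (lim_cst (bs f m)))).
by exists m => k hk; apply: bs_tail => // z hz; apply: h; lia.
Qed.

Lemma small_bs f n N : (forall z, small n (f z)) -> small n (bs f N).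
Proof. by move=> h; apply: small_sum. Qed.

Lemma small_bsum f n : vanish f -> (forall z, small n (f z)) -> small n (bsum f).
Proof. by move=> hv h; apply: (lim_small (vanish_lim hv)); exists 0 => m _; apply: small_bs. Qed.

(** Dominated convergence: beyond an index [I] independent of [N] every term is small, and the
    finitely many others converge one by one. The bound is asked only for |z| <= N, since the finite
    identities below have terms that mean nothing outside this range. *)
Lemma tannery (F : nat -> int -> K) f :
  (forall z, lim (F^~ z) (f z)) ->
  (forall n, exists I, forall N z, (I <= absz z)%N -> (absz z <= N)%N -> small n (F N z)) ->
  lim (fun N => bs (F N) N) (bsum f).
Proof.
move=> hl hu.
have hv : vanish f.
  move=> n; have [I hI] := hu n; exists I => z hz; apply: (lim_small (hl z)).
  by exists (absz z) => m hm; apply: hI.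
move=> n; have [I hI] := hu n; have [I' hI'] := hv n.
have hs : lim (fun N => bs (F N) (I + I')%N) (bs f (I + I')%N) by apply: lim_sum.
have [N hN] := hs n; exists (N + (I + I'))%N => m hm.
set J := (I + I')%N in hs hN *.
have -> : bs (F m) m - bsum f =
  (bs (F m) m - bs (F m) J) + (bs (F m) J - bs f J) - (bsum f - bs f J) by ring.
apply: smallB; last by apply: bsum_tail (leqnn J) => // z hz; apply: hI'; lia.
apply: smallD; last by apply: hN; lia.
suff key k : (J <= k)%N -> (k <= m)%N -> small n (bs (F m) k - bs (F m) J) by apply: key; lia.
elim: k => [|k IH] hJ hk.
  have -> : J = 0 by lia.
  by rewrite subrr; apply: small0.
case: (ltngtP J k.+1) hJ => // [hJ _|-> _]; last by rewrite subrr; apply: small0.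
rewrite bsS [_ + _ - _]addrAC; apply: smallD; first by apply: IH; lia.
by apply: smallD; apply: hI; lia.
Qed.

(** The square partial sums of the double family converge to either iterated sum, and finite sums
    can be exchanged. *)
Lemma bsum_exchange (F : int -> int -> K) :
  (forall n, exists N, forall a b, (N <= absz a)%N \/ (N <= absz b)%N -> small n (F a b)) ->
  bsum (fun a => bsum (F a)) = bsum (fun b => bsum (F^~ b)).
Proof.
have main (G : int -> int -> K) :
  (forall n, exists N, forall a b, (N <= absz a)%N \/ (N <= absz b)%N -> small n (G a b)) ->
  lim (fun N => bs (fun a => bs (G a) N) N) (bsum (fun a => bsum (G a))).
  move=> h.
  have hv a : vanish (G a) by move=> n; have [N hN] := h n; exists N => z hz; apply: hN; right.
  apply: tannery => [a|n]; first exact: vanish_lim.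
  have [N hN] := h n; exists N => M a ha _; apply: small_bs => z.
  by apply: hN; left.
move=> h; apply: lim_uniq (main _ h) _.
apply: lim_ext (main (fun b a => F a b) _) => [N|n]; first by rewrite /bs exchange_big.
by have [N hN] := h n; exists N => a b [] hh; apply: hN; [right|left].
Qed.

End Bilateral.

(** * q-products *)

Definition poch (R : comNzRingType) (Q x : R) (n : nat) : R := \prod_(i < n) (1 - x * Q ^+ i).

Section Poch.
Variable R : comNzRingType.
Implicit Types Q x : R.

Lemma poch0 Q x : poch Q x 0 = 1. Proof. exact: big_ord0. Qed.

Lemma pochS Q x n : poch Q x n.+1 = poch Q x n * (1 - x * Q ^+ n).
Proof. by rewrite /poch big_ord_recr. Qed.

Lemma pochSl Q x n : poch Q x n.+1 = (1 - x) * poch Q (x * Q) n.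
Proof.
rewrite /poch big_ord_recl expr0 mulr1; congr (_ * _); apply: eq_bigr => i _.
by rewrite /bump /= exprS mulrA.
Qed.

Lemma pochD Q x m n : poch Q x (m + n) = poch Q x m * poch Q (x * Q ^+ m) n.
Proof.
elim: n => [|n IH]; first by rewrite addn0 poch0 mulr1.
by rewrite addnS !pochS IH -!mulrA exprD.
Qed.

Lemma poch_sqr Q x n : poch Q x n * poch Q (- x) n = poch (Q ^+ 2) (x ^+ 2) n.
Proof.
rewrite /poch -big_split; apply: eq_bigr => i _ /=.
by rewrite -exprM mulnC exprM; ring.
Qed.

Lemma poch_double Q x n : poch Q x n.*2 = poch (Q ^+ 2) x n * poch (Q ^+ 2) (x * Q) n.
Proof.
elim: n => [|n IH]; first by rewrite !poch0 mulr1.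
rewrite doubleS !pochS IH -!exprM -!mulrA -!exprS -mul2n; ring.
Qed.

Lemma poch_triple Q x n : poch Q x (n * 3) =
  poch (Q ^+ 3) x n * poch (Q ^+ 3) (x * Q) n * poch (Q ^+ 3) (x * Q ^+ 2) n.
Proof.
elim: n => [|n IH]; first by rewrite !poch0 !mulr1.
have -> : (n.+1 * 3 = (n * 3).+3)%N by lia.
rewrite !pochS IH [Q ^+ (n * 3).+2]exprS [Q ^+ (n * 3).+1]exprS (mulnC n 3) (exprM Q 3 n); ring.
Qed.

End Poch.

Definition pinf (K : vfield) (Q x : K) := Lim (poch Q x).
(** The factor (Q)_oo is left out: j(x;Q) is [theta Q x * pinf Q Q]. *)
Definition theta (K : vfield) (Q x : K) := pinf Q x * pinf Q (Q / x).
(** The size of [x] lies strictly between those of Q and 1/Q, and x is not 1. This keeps all factors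
    1 - x Q^n, n an integer, away from 0, and with them [theta Q x]. *)
Definition regular (K : vfield) (Q x : K) :=
  [/\ x != 0, x != 1, small 1 (x * Q) & small 1 (Q / x)].

Section Pinf.
Variable K : vfield.
Implicit Types (Q x y : K).

Lemma poch_small Q x n : small 0 x -> small 0 Q -> small 0 (poch Q x n).
Proof. by move=> hx hQ; apply: small_prod0 => i _; apply: small_1B; apply: smallMl => //; apply: smallX0. Qed.

Lemma poch_neq0 Q x n : small 1 x -> small 0 Q -> poch Q x n != 0.
Proof.
move=> hx hQ; apply/prodf_neq0 => i _; apply: small1_neq1.
by apply: smallMr => //; apply: smallX0.
Qed.

Lemma pochV_small Q x n : small 1 x -> small 0 Q -> small 0 (poch Q x n)^-1.
Proof.
move=> hx hQ; rewrite /poch -prodfV; apply: small_prod0 => i _; apply: small_geom.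
by apply: smallMr => //; apply: smallX0.
Qed.

Lemma lim_shift (u : nat -> K) l : lim (fun n => u n.+1) l -> lim u l.
Proof.
by move=> h n; have [N hN] := h n; exists N.+1 => [[|m]] // hm; apply: hN.
Qed.

Lemma lim_poch0 Q x : small 0 x -> small 1 Q -> lim (poch Q x) (pinf Q x).
Proof.
move=> hx hQ; apply: Lim_cauchy => n; exists n => m hm.
have -> : poch Q x m.+1 - poch Q x m = - (poch Q x m * x * Q ^+ m) by rewrite pochS; ring.
apply/smallNE/smallMl; last by apply: small_le (smallX1 m hQ).
by apply: smallMl => //; apply: poch_small => //; apply: small_le hQ.
Qed.

Lemma lim_pochS Q x : small 0 (x * Q) -> small 1 Q -> lim (poch Q x) ((1 - x) * pinf Q (x * Q)).
Proof.
move=> hx hQ; apply: lim_shift; apply: (lim_ext (fun n => esym (pochSl Q x n))).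
by apply: limZ; apply: lim_poch0.
Qed.

Lemma pinfS Q x : small 0 (x * Q) -> small 1 Q -> pinf Q x = (1 - x) * pinf Q (x * Q).
Proof. by move=> hx hQ; apply: LimE; apply: lim_pochS. Qed.

Lemma lim_poch Q x : small 0 (x * Q) -> small 1 Q -> lim (poch Q x) (pinf Q x).
Proof. by move=> hx hQ; rewrite pinfS //; apply: lim_pochS. Qed.

Lemma pinf_small1 Q x : small 1 x -> small 1 Q -> small 1 (1 - pinf Q x).
Proof.
move=> hx hQ; have hl := lim_poch0 (small_weak hx) hQ.
apply: (lim_small (limB (lim_cst 1) hl)); exists 0 => m _.
elim: m => [|m IH]; first by rewrite poch0 subrr; apply: small0.
have -> : 1 - poch Q x m.+1 = (1 - poch Q x m) + poch Q x m * (x * Q ^+ m) by rewrite pochS; ring.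
apply: smallD => //; apply: smallMl.
  by apply: poch_small; [apply: small_weak hx | apply: small_weak hQ].
by apply: smallMr => //; apply: smallX0; apply: small_weak hQ.
Qed.

Lemma pinf_neq0 Q x : small 1 x -> small 1 Q -> pinf Q x != 0.
Proof. by move=> hx hQ; have := small1_neq1 (pinf_small1 hx hQ); rewrite opprB addrCA subrr addr0. Qed.

Lemma pinf_neq0S Q x : small 1 (x * Q) -> x != 1 -> small 1 Q -> pinf Q x != 0.
Proof.
move=> hx x1 hQ; rewrite pinfS //; last exact: small_weak hx.
by rewrite mulf_neq0 ?pinf_neq0 // subr_eq0 eq_sym.
Qed.

Lemma theta_neq0 Q x : regular Q x -> small 1 Q -> theta Q x != 0.
Proof. by case=> x0 x1 h h' hQ; apply: mulf_neq0; [exact: pinf_neq0S|exact: pinf_neq0]. Qed.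

Lemma theta_inv Q x : Q != 0 -> theta Q (Q / x) = theta Q x.
Proof. by move=> Q0; rewrite /theta invf_div mulrCA mulfV // mulr1 mulrC. Qed.

Lemma pinf_sqr Q x : small 0 x -> small 1 Q ->
  pinf Q x * pinf Q (- x) = pinf (Q ^+ 2) (x ^+ 2).
Proof.
move=> hx hQ; apply/esym/LimE; apply: (lim_ext (poch_sqr Q x)).
by apply: limM; apply: lim_poch0 => //; apply: smallN.
Qed.

Lemma small_expS Q n : small 1 Q -> small 1 (Q ^+ n.+1).
Proof. by move=> hQ; apply: small_le (smallX1 n.+1 hQ). Qed.

Lemma pinf_double Q x : small 0 x -> small 1 Q ->
  pinf Q x = pinf (Q ^+ 2) x * pinf (Q ^+ 2) (x * Q).
Proof.
move=> hx hQ.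
have h1 : lim (fun n => poch Q x n.*2) (pinf Q x).
  by apply: (@lim_sub K (poch Q x) _ (fun n => n.*2)) (lim_poch0 hx hQ) => m; lia.
apply: lim_uniq h1 _; apply: (lim_ext (fun n => esym (poch_double Q x n))).
by apply: limM; apply: lim_poch0 => //;
   [exact: small_expS|apply: smallMl => //; exact: small_weak hQ|exact: small_expS].
Qed.

Lemma pinf_triple Q x : small 0 x -> small 1 Q ->
  pinf Q x = pinf (Q ^+ 3) x * pinf (Q ^+ 3) (x * Q) * pinf (Q ^+ 3) (x * Q ^+ 2).
Proof.
move=> hx hQ.
have h1 : lim (fun n => poch Q x (n * 3)) (pinf Q x).
  by apply: (@lim_sub K (poch Q x) _ (fun n => (n * 3)%N)) (lim_poch0 hx hQ) => m; lia.
apply: lim_uniq h1 _; apply: (lim_ext (fun n => esym (poch_triple Q x n))).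
have hQ0 := small_weak hQ; have hQ3 := small_expS 2 hQ.
by do 2?apply: limM; apply: lim_poch0 => //; apply: smallMl => //; apply: smallX0.
Qed.

Lemma theta_sqr Q x : small 0 x -> small 1 (Q / x) -> small 1 Q ->
  theta Q x * theta Q (- x) = theta (Q ^+ 2) (x ^+ 2).
Proof.
move=> hx hx' hQ; rewrite /theta mulrACA pinf_sqr //; congr (_ * _).
by rewrite invrN mulrN pinf_sqr ?expr_div_n //; apply: small_weak hx'.
Qed.

End Pinf.

(** * Lagrange interpolation *)

Section Lagrange.
Variable F : fieldType.

(** After clearing denominators both sides are polynomials in [x] of degree below the number of
    nodes, and they agree at all the points [1 / c k]. *)
Lemma lagrange_partial_fractions (T : finType) (c : T -> F) (L : nat) (x : F) :
  injective c -> (forall k, c k != 0) -> (forall k, 1 - x * c k != 0) -> (L < #|T|)%N ->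
  x ^+ L / \prod_k (1 - x * c k) =
  \sum_k (c k)^-1 ^+ L / \prod_(l | l != k) (1 - c l / c k) / (1 - x * c k).
Proof.
move=> ci c0 hx hL.
pose a k := (c k)^-1 ^+ L / \prod_(l | l != k) (1 - c l / c k).
pose p : {poly F} := \sum_k (a k)%:P * \prod_(l | l != k) (1 - (c l)%:P * 'X) - 'X^L.
have nz k : \prod_(l | l != k) (1 - c l / c k) != 0.
  apply/prodf_neq0 => l lk; rewrite subr_eq0; apply/eqP => /esym h.
  case/negP: lk; apply/eqP/ci.
  by apply: (mulIf (invr_neq0 (c0 k))); rewrite h mulfV.
have p0 : p = 0.
  apply/eqP; apply: contraT => pn0.
  have hu : uniq [seq (c k)^-1 | k : T] by rewrite map_inj_uniq ?enum_uniq // => k l /invr_inj /ci.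
  suff hp : (size p <= #|T|)%N.
    have hr : all (root p) [seq (c k)^-1 | k : T]; last first.
      by have := max_poly_roots pn0 hr hu; rewrite size_map -cardE ltnNge hp.
    apply/allP => _ /mapP [k _ ->]; rewrite /root /p hornerD hornerN hornerXn horner_sum (bigD1 k) //=.
    rewrite [X in _ + X - _]big1 ?addr0; last first.
      move=> j jk; rewrite hornerM hornerC horner_prod (bigD1 k) 1?eq_sym //=.
      by rewrite !(hornerD, hornerN, hornerM, hornerX, hornerC) mulfV // subrr mul0r mulr0.
    rewrite hornerM hornerC horner_prod.
    rewrite [X in a k * X](eq_bigr (fun l => 1 - c l / c k)); last by move=> l _; rewrite !hornerE.
    by rewrite /a -mulrA mulVf // mulr1 subrr.
  rewrite /p (leq_trans (size_polyD _ _)) // geq_max size_polyN size_polyXn hL andbT.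
  apply: (leq_trans (size_sum _ _ _)); apply/bigmax_leqP => k _.
  rewrite mul_polyC (leq_trans (size_scale_leq _ _)) //.
  have hs l : (size (1 - (c l)%:P * 'X : {poly F})%R <= 2)%N.
    rewrite (leq_trans (size_polyD _ _)) // geq_max size_poly1 size_polyN mul_polyC.
    by rewrite (leq_trans (size_scale_leq _ _)) // size_polyX.
  rewrite (eq_bigl (mem (predC1 k))); last by move=> l; rewrite !inE.
  rewrite (leq_trans (size_prod_leq _ _)) // leq_subLR.
  have : (\sum_(l in predC1 k) size (1 - (c l)%:P * 'X : {poly F})%R <= \sum_(l in predC1 k) 2)%N.
    by apply: leq_sum => l _.
  rewrite sum_nat_const; have := cardC1 k; have : (0 < #|T|)%N by apply/card_gt0P; exists k.
  move=> h0 h1 h2; apply: (leq_ltn_trans h2).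
  by rewrite (_ : #|mem (predC1 k)| = #|predC1 k|) ?h1 //; lia.
have := congr1 (horner^~ x) p0.
rewrite /p hornerD hornerN hornerXn horner0 horner_sum => /eqP; rewrite subr_eq0 => /eqP <-.
rewrite mulr_suml; apply: eq_bigr => k _.
rewrite -/(a k) [X in _ / X = _](bigD1 k) //= hornerM hornerC horner_prod.
rewrite [X in a k * X / _](eq_bigr (fun l => 1 - x * c l)); last first.
  by move=> l _; rewrite !hornerE mulrC.
have nz' : \prod_(l | l != k) (1 - x * c l) != 0 by apply/prodf_neq0.
by field; rewrite nz' hx.
Qed.

End Lagrange.

(** * Partial fractions *)

Lemma bs_ord (V : comNzRingType) (f : int -> V) N :
  \sum_(k < N.*2.+1) f (k%:Z - N%:Z) = bs f N.
Proof.
elim: N => [|N IH]; first by rewrite big_ord1 bs0.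
rewrite doubleS big_ord_recl big_ord_recr bsS -IH /=.
rewrite (eq_bigr (fun i : 'I_N.*2.+1 => f (i%:Z - N%:Z))); last first.
  by move=> i _; congr f; rewrite /bump /=; lia.
have -> : (bump 0 N.*2.+1)%:Z - N.+1%:Z = N.+1%:Z by rewrite /bump /=; lia.
have -> : 0%:Z - N.+1%:Z = - N.+1%:Z by lia.
ring.
Qed.

Section FinitePartialFractions.
Variables (F : fieldType) (s Q : F).
Hypotheses (s0 : s != 0) (QE : Q = s ^+ 2).

Let Q0 : Q != 0. Proof. by rewrite QE expf_neq0. Qed.

(** The factors are 1 - g Q^-i with 1 <= i <= k. Each is reversed to -g Q^-i (1 - Q^i / g), and the
    extracted powers of Q multiply to [s ^+ (k * k.+1)] in the denominator. *)
Lemma prod_below (g : F) k : g != 0 ->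
  \prod_(l < k) (1 - g / Q ^+ k * Q ^+ l) = (- g) ^+ k / s ^+ (k * k.+1) * poch Q (Q / g) k.
Proof.
move=> g0; elim: k => [|k IH]; first by rewrite big_ord0 poch0 mulr1 mul0n expr0 divr1.
rewrite big_ord_recl /= [X in _ * X](_ : _ = \prod_(l < k) (1 - g / Q ^+ k * Q ^+ l)); last first.
  apply: eq_bigr => i _; rewrite /bump /= !exprS; field.
  by rewrite Q0 expf_neq0.
rewrite IH pochS expr0 mulr1.
have -> : (k.+1 * k.+2 = k * k.+1 + k.+1 * 2)%N by lia.
rewrite exprD (mulnC k.+1) (exprM s 2 k.+1) -QE !exprS.
have := expf_neq0 k Q0; set q := Q ^+ k => q0.
have := expf_neq0 (k * k.+1) s0; set w := s ^+ _ => w0.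
by move: (_ ^+ k) => gk; field; rewrite q0 w0 Q0 g0.
Qed.

Lemma poch_center (y : F) N : y != 0 ->
  poch Q (y / Q ^+ N) N.*2.+1 =
  (- y) ^+ N / s ^+ (N * N.+1) * (poch Q y N.+1 * poch Q (Q / y) N).
Proof.
move=> y0; have -> : N.*2.+1 = (N + N.+1)%N by lia.
rewrite pochD mulfVK ?expf_neq0 // [poch Q _ N](_ : _ = \prod_(l < N) (1 - y / Q ^+ N * Q ^+ l)) //.
rewrite prod_below //; ring.
Qed.

Lemma prod_punctured (g : F) k m : g != 0 ->
  \prod_(l < (k + m).+1 | l != k :> nat) (1 - g / Q ^+ k * Q ^+ l) =
  (- g) ^+ k / s ^+ (k * k.+1) * (poch Q (Q / g) k * poch Q (g * Q) m).
Proof.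
move=> g0; rewrite big_mkcond /= -addnS big_split_ord /= big_ord_recl /= addn0 eqxx mul1r.
rewrite mulrA -prod_below //; congr (_ * _).
  by apply: eq_bigr => i _; rewrite neq_ltn ltn_ord.
apply: eq_bigr => i _.
rewrite /bump /= -{2}[k]addn0 eqn_add2l /= addnA addn1 addSn exprS exprD.
have := expf_neq0 k Q0 => h; congr (1 - _); field => //.
Qed.

(** The monomials left in a coefficient depend on [N] and [k] only through the centred index k - N,
    which is what lets each coefficient converge as N grows. *)
Lemma center_monomial (g : F) (N k : nat) : g != 0 ->
  g ^+ N * s ^+ (2 * (N * N)) / s ^+ (N * N.+1) / Q ^+ (k * N) / (g ^+ k / s ^+ (k * k.+1)) =
  g ^ (- (k%:Z - N%:Z)) * s ^ ((k%:Z - N%:Z) * (k%:Z - N%:Z + 1)).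
Proof.
move=> g0.
have -> : g ^ (- (k%:Z - N%:Z)) = g ^+ N / g ^+ k.
  by rewrite opprB expfzDr // -exprnP exprnN.
have -> : s ^ ((k%:Z - N%:Z) * (k%:Z - N%:Z + 1)) =
  s ^+ (2 * (N * N)) / s ^+ (N * N.+1) / Q ^+ (k * N) * s ^+ (k * k.+1).
  rewrite QE -exprM !exprnP !invr_expz -!expfzDr //; congr (s ^ _); lia.
have := expf_neq0 k g0; have := expf_neq0 (N * N.+1) s0.
have := expf_neq0 (k * N) Q0; have := expf_neq0 (k * k.+1) s0.
by move=> *; field; do !(apply/andP; split).
Qed.

Variables (I : finType) (b : I -> F).
Hypothesis b0 : forall i, b i != 0.

(** The part of a partial fraction coefficient that is free of [N]. The factor [j = i] contributes
    (-1)^n s^(n(n+1)); the others carry the ratios of the nodes. *)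
Definition pf_weight i (n : int) :=
  \prod_j ((- (b j / b i)) ^ (- n) * s ^ (n * (n + 1))).

(** The part that depends on [N]; for fixed [n] it tends to the inverse of a product of infinite
    products. The absolute values only produce natural numbers and change nothing for |n| <= N. *)
Definition pf_coef i (N : nat) (n : int) :=
  (\prod_j (poch Q (Q / (b j / b i)) (absz (N%:Z + n)%R) *
             poch Q (b j / b i * Q) (absz (N%:Z - n)%R)))^-1.

Lemma prod_pairs_punctured N (i : I) (k : 'I_N.*2.+1) :
  \prod_(p : I * 'I_N.*2.+1 | p != (i, k)) (1 - b p.1 * Q ^+ p.2 / (b i * Q ^+ k)) =
  (\prod_j \prod_(l < N.*2.+1 | l != k :> nat) (1 - b j / b i / Q ^+ k * Q ^+ l)) *
  \prod_(j | j != i) (1 - b j / b i).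
Proof.
have Qk0 : Q ^+ k != 0 by rewrite expf_neq0.
have e j (l : 'I_N.*2.+1) : b j * Q ^+ l / (b i * Q ^+ k) = b j / b i / Q ^+ k * Q ^+ l.
  by field; rewrite Qk0 b0.
rewrite big_mkcond -(pair_bigA _ (fun j l =>
  if (j, l) != (i, k) then 1 - b j * Q ^+ l / (b i * Q ^+ k) else 1)) /=.
rewrite [\prod_(j | j != i) _]big_mkcond -big_split /=; apply: eq_bigr => j _.
case: (eqVneq j i) => [->|ji] /=.
  rewrite mulr1 [RHS]big_mkcond; apply: eq_bigr => l _.
  by rewrite xpair_eqE eqxx /= -e.
rewrite (bigD1 k) //= xpair_eqE (negPf ji) /= mulrC; congr (_ * _).
  by apply: eq_bigr => l _; rewrite xpair_eqE (negPf ji) /= e.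
by rewrite e mulfVK.
Qed.

(** Interpolation with the numbers b_i Q^k, 0 <= k <= 2N, in the variable x / Q^N, which recentres
    the exponents to the range -N..N. *)
Lemma finite_partial_fractions (i0 : I) (x : F) N :
  x != 0 ->
  (forall i j k l, b i * Q ^+ k = b j * Q ^+ l -> i = j /\ k = l) ->
  (forall i (n : int), 1 - x * b i * Q ^ n != 0) ->
  (\prod_i (poch Q (x * b i) N.+1 * poch Q (Q / (x * b i)) N))^-1 =
  \sum_i (\prod_(j | j != i) (1 - b j / b i))^-1 *
     bs (fun n => pf_coef i N n * (pf_weight i n / (1 - x * b i * Q ^ n))) N.
Proof.
move=> x0 binj hx.
have QN0 : Q ^+ N != 0 by rewrite expf_neq0.
pose c (p : I * 'I_N.*2.+1) := b p.1 * Q ^+ p.2.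
have ci : injective c by move=> [i k] [j l] /binj [/= -> h]; congr pair; apply: val_inj.
have c0 p : c p != 0 by rewrite mulf_neq0 ?expf_neq0.
have cx p : 1 - x / Q ^+ N * c p = 1 - x * b p.1 * Q ^ (p.2%:Z - N%:Z).
  rewrite /c expfzDr // -exprnP exprnN; congr (1 - _); field => //.
have hx' p : 1 - x / Q ^+ N * c p != 0 by rewrite cx.
(* The degree [N * #|I|] is chosen so that the numerator cancels the power x^N that [poch_center]
   extracts for each [i]. *)
have hL : (N * #|I| < #|{: I * 'I_N.*2.+1}|)%N.
  by rewrite card_prod card_ord; have : (0 < #|I|)%N by [apply/card_gt0P; exists i0]; lia.
have := lagrange_partial_fractions ci c0 hx' hL.
pose A i := poch Q (x * b i) N.+1 * poch Q (Q / (x * b i)) N.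
have -> : \prod_p (1 - x / Q ^+ N * c p) =
  \prod_i ((- (x * b i)) ^+ N / s ^+ (N * N.+1) * A i).
  rewrite -(pair_bigA _ (fun i k => 1 - x / Q ^+ N * c (i, k))) /=; apply: eq_bigr => i _.
  rewrite -poch_center ?mulf_neq0 // /poch; apply: eq_bigr => k _.
  by rewrite /c /=; congr (1 - _); ring.
rewrite exprM -prodr_const -[X in X / _ = _]/(\prod_(i : I) ((x / Q ^+ N) ^+ N)) -prodf_div.
pose C i := (- b i) ^+ N * s ^+ (2 * (N * N)) / s ^+ (N * N.+1).
have sN0 k : s ^+ k != 0 by rewrite expf_neq0.
rewrite (eq_bigr (fun i => (C i)^-1 * (A i)^-1)) => [|i _]; last first.
  rewrite -[X in X / _]mulr1.
  have -> : - (x * b i) = (- b i) * (x / Q ^+ N) * Q ^+ N by field.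
  set y := x / Q ^+ N; rewrite (exprMn N (- b i * y)) (exprMn N (- b i)) /C.
  have -> : (Q ^+ N) ^+ N = s ^+ (2 * (N * N)) by rewrite QE -!exprM; congr (_ ^+ _); lia.
  have h1 : y ^+ N != 0 by rewrite expf_neq0 ?mulf_neq0 ?invr_neq0.
  have h2 : (- b i) ^+ N != 0 by rewrite expf_neq0 ?oppr_eq0.
  rewrite [in LHS]invfM mulrA; congr (_ * _); move: h1 h2 (sN0 (2 * (N * N))%N) (sN0 (N * N.+1)%N).
  move: (y ^+ N) ((- b i) ^+ N) (s ^+ (2 * _)) (s ^+ (N * _)) => u1 u2 u3 u4 *.
    by field; do !(apply/andP; split).
rewrite big_split /= !prodfV => h.
have C0 : \prod_i C i != 0.
  by apply/prodf_neq0 => i _; rewrite !mulf_neq0 ?invr_neq0 ?expf_neq0 ?oppr_eq0.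
have -> : (\prod_i A i)^-1 = \prod_i C i * ((\prod_i C i)^-1 * (\prod_i A i)^-1).
  by rewrite mulrA mulfV // mul1r.
rewrite h -(pair_bigA _ (fun i k => (c (i, k))^-1 ^+ (N * #|I|) /
  \prod_(p | p != (i, k)) (1 - c p / c (i, k)) / (1 - x / Q ^+ N * c (i, k)))) /=.
rewrite mulr_sumr; apply: eq_bigr => i _; rewrite -bs_ord !mulr_sumr; apply: eq_bigr => k _.
rewrite cx /= prod_pairs_punctured.
have main : \prod_j C j * (c (i, k))^-1 ^+ (N * #|I|) /
  (\prod_j \prod_(l < N.*2.+1 | l != k :> nat) (1 - b j / b i / Q ^+ k * Q ^+ l)) =
  pf_coef i N (k%:Z - N%:Z) * pf_weight i (k%:Z - N%:Z).
  rewrite exprM -prodr_const -[X in _ * X / _]/(\prod_(j : I) ((c (i, k))^-1 ^+ N)).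
  rewrite /pf_coef /pf_weight -!prodfV -!big_split /=; apply: eq_bigr => j _.
  have hk : N.*2.+1 = (k + (N.*2 - k)).+1 by have := ltn_ord k; lia.
  have -> : \prod_(l < N.*2.+1 | l != k :> nat) (1 - b j / b i / Q ^+ k * Q ^+ l) =
     \prod_(l < (k + (N.*2 - k)).+1 | l != k :> nat) (1 - b j / b i / Q ^+ k * Q ^+ l).
    have cast n m (p : pred nat) (G : nat -> F) : n = m ->
      \prod_(l < n | p l) G l = \prod_(l < m | p l) G l by move=> ->.
    exact: (cast _ _ (fun l => l != k) (fun l => 1 - b j / b i / Q ^+ k * Q ^+ l) hk).
  have g0 : b j / b i != 0 by rewrite mulf_neq0 ?invr_neq0.
  rewrite prod_punctured // -center_monomial ?oppr_eq0 //.
  have -> : absz (N%:Z + (k%:Z - N%:Z))%R = k by lia.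
  have -> : absz (N%:Z - (k%:Z - N%:Z))%R = (N.*2 - k)%N by have := ltn_ord k; lia.
  set P1 := poch _ _ _; set P2 := poch _ _ _.
  rewrite /c /= /C.
  have -> : (b i * Q ^+ k)^-1 ^+ N = (b i ^+ N)^-1 / Q ^+ (k * N).
    by rewrite exprVn exprMn invfM -exprM.
  have -> : (- (b j / b i)) ^+ N = (- b j) ^+ N / b i ^+ N by rewrite -mulNr exprMn exprVn.
  move: (_ ^+ k) (_ ^+ N) (b i ^+ N) (s ^+ _) (s ^+ _) (s ^+ _) (Q ^+ _) (P1 * P2) => *.
  by rewrite !invfM !invrK; ring.
move: main; rewrite /c /=; move: (\prod_i C i) (_ ^+ (N * _)) (\prod_j \prod_(l < _ | _) _) => u1 u2 u3.
move: (pf_coef _ _ _) (pf_weight _ _) (\prod_(j | _) _) => u4 u5 u6 main.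
rewrite -[u6^-1 * _]mulrC [u4 * _]mulrA -main (invfM u3); ring.
Qed.

End FinitePartialFractions.

Section ThetaPartialFractions.
Variable K : vfield.
Implicit Types (Q x y : K).

Lemma lim_absz (u : nat -> K) l (n : int) : lim u l -> lim (fun N => u (absz (N%:Z + n)%R)) l.
Proof. by move=> h m; have [N hN] := h m; exists (N + absz n)%N => k hk; apply: hN; lia. Qed.

Lemma lim_abszB (u : nat -> K) l (n : int) : lim u l -> lim (fun N => u (absz (N%:Z - n)%R)) l.
Proof. exact: lim_absz. Qed.

Lemma small_pos_exp Q x n : small 1 (x * Q) -> small 1 Q -> small 1 (x * Q ^+ n.+1).
Proof.
by move=> hx hQ; rewrite exprS mulrA; apply: smallMr => //; apply: smallX0; apply: small_weak hQ.
Qed.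

(** For n = -k < 0 the factor is -(x Q^-k) (1 - Q^k / x), so both signs reduce to 1 minus something
    small. At n = 0 there is no uniform bound, because 1 - x may itself be small. *)
Lemma regular_factor Q x (n : int) : regular Q x -> small 1 Q -> Q != 0 ->
  1 - x * Q ^ n != 0 /\ ((0 < absz n)%N -> small 0 (1 - x * Q ^ n)^-1).
Proof.
move=> [x0 x1 h h'] hQ Q0.
have hp (k : nat) y : small 1 (y * Q) -> 1 - y * Q ^+ k.+1 != 0 /\ small 0 (1 - y * Q ^+ k.+1)^-1.
  by move=> hy; have hs := small_pos_exp k hy hQ; split; [apply: small1_neq1|apply: small_geom].
case: n => [[|k]|k].
- by rewrite expr0z mulr1 subr_eq0 eq_sym x1.
- by rewrite -exprnP; have [? ?] := hp k _ h.
- rewrite NegzE -exprnN; have [|h1 h2] := hp k x^-1; first by rewrite mulrC.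
  have q0 := expf_neq0 k.+1 Q0.
  have e : 1 - x / Q ^+ k.+1 = - (x / Q ^+ k.+1) * (1 - x^-1 * Q ^+ k.+1).
    by field; rewrite q0 x0.
  have h3 : - (x / Q ^+ k.+1) != 0 by rewrite oppr_eq0 mulf_neq0 ?invr_neq0.
  split; first by rewrite e mulf_neq0.
  move=> _; rewrite e invfM; apply: smallMl => //.
  rewrite invrN invfM invrK; apply: smallN.
  by apply: small_weak; apply: small_pos_exp => //; rewrite mulrC.
Qed.

Lemma vanish_factor Q x f : regular Q x -> small 1 Q -> Q != 0 -> vanish f ->
  vanish (fun n => f n / (1 - x * Q ^ n)).
Proof.
move=> hr hQ Q0 hf; apply: vanishMr => //; exists 1 => n hn.
by have [_] := regular_factor n hr hQ Q0; apply.
Qed.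

Section General.
Variables (s Q x : K) (I : finType) (b : I -> K) (i0 : I).
Hypotheses (s0 : s != 0) (hs : small 1 s) (QE : Q = s ^+ 2).
Hypotheses (b0 : forall i, b i != 0) (x0 : x != 0).
Hypotheses (hb : forall i j, i != j -> regular Q (b j / b i)).
Hypotheses (hx : forall i, regular Q (x * b i)).
Hypothesis hv : forall i, vanish (pf_weight s b i).

Let Q0 : Q != 0. Proof. by rewrite QE expf_neq0. Qed.
Let hQ : small 1 Q. Proof. by rewrite QE; apply: small_expS. Qed.

Let ratio_small i j : small 1 (b j / b i * Q) /\ small 1 (Q / (b j / b i)).
Proof.
case: (eqVneq i j) => [->|/hb []] //.
by rewrite mulfV // mul1r divr1.
Qed.

(** The limit of [finite_partial_fractions] by [tannery]: [pf_weight] supplies the decay while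
    [pf_coef] stays bounded. *)
Theorem theta_partial_fractions :
  (\prod_i theta Q (x * b i))^-1 =
  \sum_i (pinf Q Q ^+ 2 * \prod_(j | j != i) theta Q (b j / b i))^-1 *
    bsum (fun n => pf_weight s b i n / (1 - x * b i * Q ^ n)).
Proof.
have hl : lim (fun N => (\prod_i (poch Q (x * b i) N.+1 * poch Q (Q / (x * b i)) N))^-1)
              (\prod_i theta Q (x * b i))^-1.
  apply: limV; first by apply/prodf_neq0 => i _; apply: theta_neq0.
  apply: lim_prod => i _; have [_ _ h h'] := hx i; apply: limM.
    by apply: (@lim_sub K (poch Q (x * b i)) _ S) => //; apply: lim_poch => //; apply: small_weak h.
  by apply: lim_poch0 => //; apply: small_weak h'.
apply: lim_uniq hl _.
apply: (@lim_ext K (fun N => \sum_i (\prod_(j | j != i) (1 - b j / b i))^-1 *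
     bs (fun n => pf_coef Q b i N n * (pf_weight s b i n / (1 - x * b i * Q ^ n))) N)).
  move=> N; rewrite -(finite_partial_fractions s0 QE b0 i0 N x0) //; last first.
    by move=> i n; have [] := regular_factor n (hx i) hQ Q0.
  (* A coincidence of two nodes would give 1 - (b_j / b_i) Q^(l - k) = 0, against the regularity of
     the ratio. *)
  move=> i j k l e; have e2 : b j / b i * Q ^ (l%:Z - k%:Z) = 1.
    have qk := expf_neq0 k Q0.
    have -> : b j / b i * Q ^ (l%:Z - k%:Z) = b j * Q ^+ l / (b i * Q ^+ k).
      by rewrite expfzDr // -exprnP -exprnN; field; rewrite qk b0.
    by rewrite -e mulfV ?mulf_neq0.
  case: (eqVneq i j) => [ij|/hb hr]; last first.
    by have [] := regular_factor (l%:Z - k%:Z) hr hQ Q0; rewrite e2 subrr eqxx.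
  split=> //; apply/eqP; apply: contraT => kl.
  have hn (n : nat) : Q ^+ n.+1 != 1.
    by rewrite eq_sym -subr_eq0; apply: small1_neq1; apply: small_expS.
  rewrite ij mulfV // mul1r in e2; case: (ltngtP k l) kl => // kl _.
    have : Q ^+ (l - k.+1).+1 = 1 by rewrite exprnP -e2; congr (Q ^ _); lia.
    by move/eqP; rewrite (negPf (hn _)).
  have : Q ^+ (k - l.+1).+1 = 1.
    by rewrite exprnP -[RHS]invr1 -e2 invr_expz; congr (Q ^ _); lia.
  by move/eqP; rewrite (negPf (hn _)).
apply: lim_sum => i _.
(* In the limit of [pf_coef] each theta function lacks its factor 1 - b_j / b_i, which the finite
   prefactor supplies. The index [j = i] accounts for the square of [pinf Q Q]. *)
have -> : (pinf Q Q ^+ 2 * \prod_(j | j != i) theta Q (b j / b i))^-1 =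
  (\prod_(j | j != i) (1 - b j / b i))^-1 *
  (\prod_j (pinf Q (Q / (b j / b i)) * pinf Q (b j / b i * Q)))^-1.
  rewrite -invfM [\prod_j _](bigD1 i) //= mulfV // mul1r divr1 -expr2; congr (_^-1).
  rewrite mulrCA; congr (_ * _); rewrite -big_split /=; apply: eq_bigr => j ji.
  have [h _] := ratio_small i j.
  by rewrite /theta (pinfS _ hQ) //; [ring | apply: small_weak h].
rewrite -mulrA; apply: limZ.
rewrite -bsumZ; last by apply: vanish_factor.
apply: tannery => [n|m].
  apply: limM; last exact: lim_cst.
  apply: limV; first by apply/prodf_neq0 => j _; have [h h'] := ratio_small i j;
    rewrite mulf_neq0 ?pinf_neq0.
  apply: lim_prod => j _; have [h h'] := ratio_small i j; apply: limM.
    by apply: lim_absz; apply: lim_poch0 => //; apply: small_weak h'.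
  by apply: lim_abszB; apply: lim_poch0 => //; apply: small_weak h.
have [N hN] := vanish_factor (hx i) hQ Q0 (hv i) m; exists N => M z hz _.
apply: smallMl; last exact: hN.
rewrite /pf_coef -prodfV; apply: small_prod0 => j _; have [h h'] := ratio_small i j.
by rewrite invfM; apply: smallMl; apply: pochV_small => //; apply: small_weak hQ.
Qed.
End General.
End ThetaPartialFractions.

(** * Finite identities: q-Vandermonde and the q-binomial theorem *)

Section FiniteSums.
Variables (F : fieldType) (s Q : F).
Hypothesis QE : Q = s ^+ 2.
Hypothesis hq : forall n, Q ^+ n.+1 != 1.

Let e n := poch Q Q n.
Let e0 n : e n != 0.
Proof. by apply/prodf_neq0 => i _; rewrite -exprS subr_eq0 eq_sym. Qed.
Let eS n : e n.+1 = e n * (1 - Q ^+ n.+1).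
Proof. by rewrite /e pochS exprS. Qed.

(** Induction on [M] for all [a]. Multiply by 1 - Q^(M+1) = (1 - Q^(M+1-k)) + Q^(M+1-k) (1 - Q^k):
    the first part is the sum for (M, a), and the second, shifted in k, is Q^(M+1+a) times the sum
    for (M, a+1). *)
Lemma q_vandermonde M a :
  \sum_(k < M.+1) Q ^+ (k * (k + a)) / (e k * e (k + a) * e (M - k)) = (e M * e (M + a))^-1.
Proof.
elim: M a => [|M IH] a.
  by rewrite big_ord1 mul0n expr0 !add0n subn0 /e !poch0 mul1r mulr1.
have q1 : 1 - Q ^+ M.+1 != 0 by rewrite subr_eq0 eq_sym.
apply: (mulfI q1); rewrite mulr_sumr.
rewrite (eq_bigr (fun k : 'I_M.+2 =>
   (1 - Q ^+ (M.+1 - k)) * (Q ^+ (k * (k + a)) / (e k * e (k + a) * e (M.+1 - k))) +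
   Q ^+ (M.+1 - k) * (1 - Q ^+ k) * (Q ^+ (k * (k + a)) / (e k * e (k + a) * e (M.+1 - k)))));
  last first.
  move=> k _; have -> : Q ^+ M.+1 = Q ^+ (M.+1 - k) * Q ^+ k.
    by rewrite -exprD subnK // -ltnS.
  ring.
rewrite big_split /= big_ord_recr /= subnn expr0 subrr mul0r addr0.
rewrite [X in _ + X]big_ord_recl /= expr0 subrr mulr0 mul0r add0r.
rewrite (eq_bigr (fun k : 'I_M.+1 => Q ^+ (k * (k + a)) / (e k * e (k + a) * e (M - k)))); last first.
  move=> k _; rewrite subSn -1?ltnS // eS.
  have := e0 k; have := e0 (k + a)%N; have := e0 (M - k)%N.
  have : 1 - Q ^+ (M - k).+1 != 0 by rewrite subr_eq0 eq_sym.
  by move=> *; field; do !(apply/andP; split).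
rewrite [X in _ + X](eq_bigr (fun k : 'I_M.+1 => Q ^+ (M.+1 + a) *
   (Q ^+ (k * (k + a.+1)) / (e k * e (k + a.+1) * e (M - k))))); last first.
  move=> k _; rewrite /bump /= add1n subSS addSnnS eS.
  have -> : Q ^+ (M.+1 + a) * (Q ^+ (k * (k + a.+1)) / (e k * e (k + a.+1) * e (M - k))) =
     (Q ^+ (M.+1 + a) * Q ^+ (k * (k + a.+1))) / (e k * e (k + a.+1) * e (M - k)) by ring.
  have -> : Q ^+ (M.+1 + a) * Q ^+ (k * (k + a.+1)) = Q ^+ (M - k) * Q ^+ (k.+1 * (k + a.+1)).
    by rewrite -!exprD; congr (_ ^+ _); have := ltn_ord k; nia.
  have := e0 k; have := e0 (k + a.+1)%N; have := e0 (M - k)%N.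
  have : 1 - Q ^+ k.+1 != 0 by rewrite subr_eq0 eq_sym.
  by move=> *; field; do !(apply/andP; split).
rewrite IH -mulr_sumr IH addnS addSn !eS.

have := e0 M; have := e0 (M + a)%N; move: q1.
have : 1 - Q ^+ (M + a).+1 != 0 by rewrite subr_eq0 eq_sym.
by move: (Q ^+ _) (Q ^+ _) (e M) (e _) => *; field; do !(apply/andP; split).
Qed.

Lemma q_binomial y M : poch Q y M =
  \sum_(k < M.+1) (- y) ^+ k * s ^+ (k * k.-1) * (e M / (e k * e (M - k))).
Proof.
(* Gaussian binomial coefficients, extended by 0 beyond k = M so that the q-Pascal rule [TS] covers
   the last term. *)
pose T M k := if (k <= M)%N then e M / (e k * e (M - k)) else 0.
rewrite (eq_bigr (fun k : 'I_M.+1 => (- y) ^+ k * s ^+ (k * k.-1) * T M k)); last first.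
  by move=> k _; rewrite /T -ltnS ltn_ord.
elim: M => [|M IH]; first by rewrite big_ord1 poch0 /T /e /= !poch0 !mulr1 invr1 !mulr1.
have T0 N : T N 0 = 1 by rewrite /T /= subn0 /e poch0 mul1r mulfV // e0.
have TS k : (k <= M)%N -> T M.+1 k.+1 = T M k.+1 + Q ^+ (M - k) * T M k.
  move=> hk; rewrite /T ltnS hk subSS.
  case: ltngtP hk => // [hk _|-> _].
    have -> : (M - k)%N = (M - k.+1).+1 by lia.
    rewrite !eS.
    have -> : Q ^+ M.+1 = Q ^+ (M - k.+1).+1 * Q ^+ k.+1 by rewrite -exprD; congr (_ ^+ _); lia.
    have h1 n : 1 - Q ^+ n.+1 != 0 by rewrite subr_eq0 eq_sym.
    have := h1 k; have := h1 (M - k.+1)%N; have := e0 k; have := e0 (M - k.+1)%N.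
    by move=> *; field; do !(apply/andP; split).
  rewrite subnn expr0 /e poch0; have := e0 M; have := e0 M.+1; rewrite /e => *.
  by field; do !(apply/andP; split).
rewrite big_ord_recl /= expr0 mul0n expr0 T0.
rewrite (eq_bigr (fun k : 'I_M.+1 =>
  (- y) ^+ k.+1 * s ^+ (k.+1 * k) * T M k.+1 +
  - (y * Q ^+ M) * ((- y) ^+ k * s ^+ (k * k.-1) * T M k))); last first.
  move=> k _; rewrite /bump /= !add1n TS -1?ltnS //=.
  have -> : (- y) ^+ k.+1 * s ^+ (k.+1 * k) * (T M k.+1 + Q ^+ (M - k) * T M k) =
    (- y) ^+ k.+1 * s ^+ (k.+1 * k) * T M k.+1 + (- y) ^+ k.+1 * (s ^+ (k.+1 * k) * Q ^+ (M - k)) * T M k.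
    by ring.
  have -> : s ^+ (k.+1 * k) * Q ^+ (M - k) = Q ^+ M * s ^+ (k * k.-1).
    by rewrite QE -!exprM -!exprD; congr (_ ^+ _); have := ltn_ord k; case: (nat_of_ord k) => [|j] ?; nia.
  by rewrite exprS; ring.
rewrite big_split /= -mulr_sumr -IH pochS.
have -> : \sum_(k < M.+1) (- y) ^+ k.+1 * s ^+ (k.+1 * k) * T M k.+1 = poch Q y M - 1.
  rewrite IH [in RHS]big_ord_recl /= expr0 mul0n expr0 T0 [LHS]big_ord_recr /=.
  rewrite {2}/T ltnn mulr0 addr0 !mulr1 addrC addKr //.
ring.
Qed.

End FiniteSums.

Lemma eq_bs (V : comNzRingType) (f g : int -> V) N :
  (forall z, (absz z <= N)%N -> f z = g z) -> bs f N = bs g N.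
Proof. by move=> h; apply: eq_big_seq => z; rewrite mem_zrange => /h. Qed.

Lemma bs_widen (V : comNzRingType) (f : int -> V) n N : (n <= N)%N ->
  bs f n = bs (fun z => if (absz z <= n)%N then f z else 0) N.
Proof.
elim: N => [|N IH] h.
  have -> : n = 0 by lia.
  by rewrite !bs0.
case: (ltngtP n N.+1) h => // [h _|-> _]; last by apply: eq_bs => z ->.
rewrite bsS -IH; last by lia.
rewrite ifF; last by apply/negbTE; lia.
by rewrite ifF ?addr0 //; apply/negbTE; lia.
Qed.

Lemma sum_from (V : comNzRingType) (f : nat -> V) m N : (m <= N)%N ->
  \sum_(n < N.+1) (if (m <= n)%N then f n else 0) = \sum_(k < (N - m).+1) f (m + k)%N.
Proof.
move=> h.
have cast a c (G : nat -> V) : a = c -> \sum_(l < a) G l = \sum_(l < c) G l by move=> ->.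
rewrite (cast _ (m + (N - m).+1)%N (fun n => if (m <= n)%N then f n else 0)); last by lia.
rewrite big_split_ord /= big1 ?add0r; last by move=> i _; rewrite leqNgt ltn_ord.
by apply: eq_bigr => i _; rewrite leq_addr.
Qed.

Lemma expf_inj (F : fieldType) (Q : F) : Q != 0 -> (forall n, Q ^+ n.+1 != 1) ->
  injective (fun n => Q ^+ n).
Proof.
move=> Q0 hq k l; wlog lkl : k l / (k < l)%N.
  move=> w h; case: (ltngtP k l) => // h'; first exact: w.
  by apply/esym/w.
have e : Q ^+ l = Q ^+ k * Q ^+ (l - k.+1).+1 by rewrite -exprD; congr (_ ^+ _); lia.
rewrite e -{1}[Q ^+ k]mulr1 => /(mulfI (expf_neq0 k Q0)) /esym h.
by have := hq (l - k.+1)%N; rewrite h eqxx.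
Qed.

(* The universal mock theta function is [g(x;Q) = (gsum Q x - 1) / x]. *)
Definition gsum (K : vfield) (Q x : K) :=
  Lim (fun N => \sum_(n < N.+1) Q ^+ (n * n) / (poch Q x n.+1 * poch Q (Q / x) n)).

(** * The Appell form of the universal mock theta function and the triple product *)

Section Expansions.
Variable K : vfield.
Implicit Types (s Q x y : K).

Lemma tannery_nat (F : nat -> nat -> K) f :
  (forall n, lim (F^~ n) (f n)) ->
  (forall m, exists I, forall N n, (I <= n <= N)%N -> small m (F N n)) ->
  lim (fun N => \sum_(n < N.+1) F N n) (Lim (fun N => \sum_(n < N.+1) f n)).
Proof.
move=> hl hu.
pose ext (g : nat -> K) (z : int) := if z is Posz n then g n else 0.
have extE g N : bs (ext g) N = \sum_(n < N.+1) g n by rewrite bsE /= [X in _ + X]big1 ?addr0.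
rewrite -(eq_Lim (extE f)).
apply: (lim_ext (fun N => extE (F N) N)); apply: tannery => [[n|n]|m].
- exact: hl.
- exact: (@lim_cst K 0).
- have [I hI] := hu m; exists I => N [n|n] h h'; last exact: small0.
  by apply: hI; rewrite h.
Qed.

Lemma small0_exprz x (z : int) : small 0 x -> small 0 x^-1 -> small 0 (x ^ z).
Proof.
move=> h h'; case: z => n; first exact: smallX0.
by rewrite NegzE -exprnN -exprVn; apply: smallX0.
Qed.

Lemma small0N1 : small 0 (-1 : K). Proof. by apply: smallN; apply: small1. Qed.

Lemma small0_sign (z : int) : small 0 ((-1 : K) ^ z).
Proof. by apply: small0_exprz; rewrite ?invrN ?invr1; apply: small0N1. Qed.

(** The exponents met below are quadratic, so a linear lower bound |z| - k is always available. *)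
Lemma vanish_exp s (c : int -> K) (p : int -> int) k : small 1 s ->
  (forall z, small 0 (c z)) -> (forall z, (absz z)%:Z <= p z + k%:Z) ->
  vanish (fun z => c z * s ^ p z).
Proof.
move=> hs hc hp n; exists (n + k)%N => z hz; apply: smallMl => //.
have [m -> hm] : exists2 m : nat, p z = m & (n <= m)%N.
  by have := hp z; case: (p z) => m h; [exists m => //|]; lia.
by rewrite -exprnP; apply: small_le hm (smallX1 m hs).
Qed.

Section Watson.
Variables (s Q x : K).
Hypotheses (s0 : s != 0) (hs : small 1 s) (QE : Q = s ^+ 2).
Hypothesis hx : regular Q x.

Let Q0 : Q != 0. Proof. by rewrite QE expf_neq0. Qed.
Let hQ : small 1 Q. Proof. by rewrite QE; apply: small_expS. Qed.
Let hq n : Q ^+ n.+1 != 1.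
Proof. by rewrite eq_sym -subr_eq0; apply: small1_neq1; apply: small_expS. Qed.
Let e n := poch Q Q n.
Let e0 n : e n != 0. Proof. exact: poch_neq0 (small_weak hQ). Qed.

(** The case of a single theta factor, with node 1, of [finite_partial_fractions]. *)
Lemma rank_term_partial_fractions n :
  (poch Q x n.+1 * poch Q (Q / x) n)^-1 =
  bs (fun z => (e (absz (n%:Z + z)%R) * e (absz (n%:Z - z)%R))^-1 *
               ((-1) ^ z * s ^ (z * (z + 1)) / (1 - x * Q ^ z))) n.
Proof.
have x0 : x != 0 by case: hx.
pose b (_ : unit) : K := 1.
have hinj i j (k l : nat) : b i * Q ^+ k = b j * Q ^+ l -> i = j /\ k = l.
  by case: i j => [] []; rewrite !mul1r => /(expf_inj Q0 hq).
have hne i (z : int) : 1 - x * b i * Q ^ z != 0.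
  by rewrite /b mulr1; have [] := regular_factor z hx hQ Q0.
have un (G : unit -> K) : \prod_i G i = G tt by rewrite (big_pred1 tt) // => -[].
have := finite_partial_fractions s0 QE (fun _ => oner_neq0 _ : b _ != 0) tt n x0 hinj hne.
rewrite un mulr1 => ->; rewrite (big_pred1 tt); last by case.
rewrite big_pred0 ?invr1 ?mul1r; last by case.
apply: eq_bs => z _; rewrite /pf_coef /pf_weight !un /b !divr1 mul1r.
by rewrite -exprz_inv invrN invr1.
Qed.

(** Each summand is expanded in partial fractions and the sums are exchanged. For fixed z the sum
    over n >= |z| is [q_vandermonde] with M = N - |z| and a = 2|z|; the weight 1 / (Q)_(N-n), which
    tends to a constant, is inserted to make this sum closed. It is a step of Bailey's lemma. *)
Lemma watson_finite N :
  \sum_(n < N.+1) (e (N - n))^-1 * (Q ^+ (n * n) / (poch Q x n.+1 * poch Q (Q / x) n)) =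
  bs (fun z => (e (absz (N%:Z + z)%R) * e (absz (N%:Z - z)%R))^-1 *
               ((-1) ^ z * s ^ (z * (3 * z + 1)) / (1 - x * Q ^ z))) N.
Proof.
pose W (z : int) := (-1) ^ z * s ^ (z * (z + 1)) / (1 - x * Q ^ z).
pose F n z := (e (N - n))^-1 * Q ^+ (n * n) * (e (n + absz z) * e (n - absz z))^-1 * W z.
have hsym m z : (absz z <= m)%N ->
    e (absz (m%:Z + z)%R) * e (absz (m%:Z - z)%R) = e (m + absz z) * e (m - absz z).
  case: z => k hk; first by congr (e _ * e _); lia.
  by rewrite mulrC; congr (e _ * e _); lia.
transitivity (\sum_(n < N.+1) bs (fun z => if (absz z <= n)%N then F n z else 0) N).
  apply: eq_bigr => n _; rewrite rank_term_partial_fractions -bs_widen; last by rewrite -ltnS.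
  rewrite mulrA /bs mulr_sumr; apply: eq_bs => z hz.
  by rewrite hsym // /F /W; ring.
rewrite /bs exchange_big /=; apply: eq_bs => z hz.
rewrite hsym // (sum_from (fun n => F n z) hz) /F -mulr_suml.
set m := absz z in hz *.
rewrite (eq_bigr (fun k : 'I_(N - m).+1 => Q ^+ (m * m) *
   (Q ^+ (k * (k + m.*2)) / (e k * e (k + m.*2) * e (N - m - k))))); last first.
  move=> k _; have -> : (m + k - m = k)%N by lia.
  have -> : (m + k + m = k + m.*2)%N by lia.
  have -> : (N - (m + k) = N - m - k)%N by lia.
  have -> : Q ^+ ((m + k) * (m + k)) = Q ^+ (m * m) * Q ^+ (k * (k + m.*2)).
    by rewrite -exprD; congr (_ ^+ _); lia.
  by rewrite !invfM; ring.
rewrite -mulr_sumr (q_vandermonde hq) -/e.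
have -> : (N - m + m.*2 = N + m)%N by lia.
have -> : s ^ (z * (3 * z + 1)) = Q ^+ (m * m) * s ^ (z * (z + 1)).
  rewrite QE -exprM exprnP -expfzDr //; congr (s ^ _).
  rewrite /m; case: (z) => k; lia.
by rewrite /W; rewrite !invfM; ring.
Qed.

(** In [watson_finite] the weights tend to 1 / (Q)_oo on the left and to 1 / (Q)_oo^2 on the right,
    so one factor (Q)_oo survives. *)
Theorem watson : pinf Q Q * gsum Q x =
  bsum (fun z => (-1) ^ z * s ^ (z * (3 * z + 1)) / (1 - x * Q ^ z)).
Proof.
have hv : vanish (fun z => (-1) ^ z * s ^ (z * (3 * z + 1)) / (1 - x * Q ^ z)).
  apply: vanish_factor => //; apply: (@vanish_exp s _ _ 0 hs); first exact: small0_sign.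
  by move=> z; nia.
have p0 : pinf Q Q != 0 by apply: pinf_neq0.
have le : lim e (pinf Q Q) by apply: lim_poch0 => //; apply: small_weak hQ.
have sV n : small 0 (e n)^-1 by apply: pochV_small => //; apply: small_weak hQ.
pose t n := Q ^+ (n * n) / (poch Q x n.+1 * poch Q (Q / x) n).
(* The factor 1 / (1 - x) has no bound from regularity; its fixed loss [k] is split off from the
   rest, which is bounded. *)
have [k hk] : exists k, forall n m, small (m + k) (Q ^+ (n * n)) -> small m (t n).
  have [x0 x1 h h'] := hx; have [k hk] := small_bounded (1 - x)^-1; exists k => n m hn.
  rewrite /t pochSl !invfM; set P1 := poch _ _ _; set P2 := poch _ _ _.
  have -> : Q ^+ (n * n) * ((1 - x)^-1 / P1 / P2) = (1 - x)^-1 * (P1^-1 / P2 * Q ^+ (n * n)) by ring.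
  by apply: hk; apply: smallMl => //; apply: smallMl; apply: pochV_small => //; apply: small_weak hQ.
have st m n : (m + k <= n)%N -> small m (t n).
  by move=> h; apply: hk; apply: small_le (smallX1 _ hQ); nia.
have L1 : lim (fun N => \sum_(n < N.+1) (e (N - n))^-1 * t n) ((pinf Q Q)^-1 * gsum Q x).
  have -> : (pinf Q Q)^-1 * gsum Q x = Lim (fun N => \sum_(n < N.+1) (pinf Q Q)^-1 * t n).
    apply/esym/LimE; apply: (lim_ext (fun N => mulr_sumr _ _ _ _)); apply: limZ.
    rewrite /gsum; apply: (@tannery_nat (fun _ n => t n) t) => [n|m]; first exact: lim_cst.
    by exists (m + k)%N => N n /andP [h _]; apply: st.
  apply: (@tannery_nat (fun N n => (e (N - n))^-1 * t n) (fun n => (pinf Q Q)^-1 * t n)) => [n|m].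
    apply: limM; last exact: lim_cst.
    apply: limV => //.
    apply: (lim_near _ (lim_abszB n%:Z le)); exists n => N hN; congr e; lia.
  exists (m + k)%N => N n /andP [h _]; apply: smallMl => //; exact: st.
have L2 : lim (fun N => \sum_(n < N.+1) (e (N - n))^-1 * t n)
   ((pinf Q Q * pinf Q Q)^-1 *
    bsum (fun z => (-1) ^ z * s ^ (z * (3 * z + 1)) / (1 - x * Q ^ z))).
  apply: (lim_ext (fun N => esym (watson_finite N))).
  rewrite -bsumZ //; apply: tannery => [z|m].
    apply: limM; last exact: lim_cst.
    apply: limV; first exact: mulf_neq0.
    by apply: limM; [apply: lim_absz|apply: lim_abszB].
  have [N hN] := hv m; exists N => M z hz _; apply: smallMl; last exact: hN.
  by rewrite invfM; apply: smallMl.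
have := lim_uniq L1 L2; set A := bsum _ => h.
have -> : gsum Q x = pinf Q Q * ((pinf Q Q)^-1 * gsum Q x) by rewrite mulrA mulfV // mul1r.
by rewrite h; field.
Qed.

End Watson.

Section TripleProduct.
Variables (s Q x : K).
Hypotheses (s0 : s != 0) (hs : small 1 s) (QE : Q = s ^+ 2).
Hypotheses (x0 : x != 0) (h1 : small 0 (x * Q)) (h2 : small 0 (Q / x)).
Hypothesis hv : vanish (fun z => (- x) ^ z * s ^ (z * (z - 1))).

Let Q0 : Q != 0. Proof. by rewrite QE expf_neq0. Qed.
Let hQ : small 1 Q. Proof. by rewrite QE; apply: small_expS. Qed.
Let hq n : Q ^+ n.+1 != 1.
Proof. by rewrite eq_sym -subr_eq0; apply: small1_neq1; apply: small_expS. Qed.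
Let e n := poch Q Q n.
Let e0 n : e n != 0. Proof. exact: poch_neq0 (small_weak hQ). Qed.

(** The q-binomial theorem for 2N factors starting at x / Q^N, where [prod_below] reverses the first
    N of them. *)
Lemma triple_product_finite N :
  poch Q x N * poch Q (Q / x) N =
  bs (fun z => e N.*2 / (e (absz (N%:Z + z)%R) * e (absz (N%:Z - z)%R)) *
               ((- x) ^ z * s ^ (z * (z - 1)))) N.
Proof.
have qN := expf_neq0 N Q0.
have c0 : (- x) ^+ N / s ^+ (N * N.+1) != 0.
  by rewrite mulf_neq0 ?invr_neq0 ?expf_neq0 ?oppr_eq0.
apply: (mulfI c0).
have -> : (- x) ^+ N / s ^+ (N * N.+1) * (poch Q x N * poch Q (Q / x) N) = poch Q (x / Q ^+ N) N.*2.
  have -> : N.*2 = (N + N)%N by lia.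
  rewrite pochD mulfVK // [poch Q (x / _) N](_ : _ = \prod_(l < N) (1 - x / Q ^+ N * Q ^+ l)) //.
  by rewrite (prod_below s0 QE) //; ring.
rewrite (q_binomial QE hq) -bs_ord mulr_sumr; apply: eq_bigr => k _; rewrite -/e.
have -> : absz (N%:Z + (k%:Z - N%:Z))%R = k by lia.
have -> : absz (N%:Z - (k%:Z - N%:Z))%R = (N.*2 - k)%N by have := ltn_ord k; lia.
have -> : (- (x / Q ^+ N)) ^+ k * s ^+ (k * k.-1) =
   (- x) ^+ N / s ^+ (N * N.+1) * ((- x) ^ (k%:Z - N%:Z) * s ^ ((k%:Z - N%:Z) * (k%:Z - N%:Z - 1))).
  have -> : (- x) ^+ N / s ^+ (N * N.+1) *
      ((- x) ^ (k%:Z - N%:Z) * s ^ ((k%:Z - N%:Z) * (k%:Z - N%:Z - 1))) =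
     ((- x) ^+ N * (- x) ^ (k%:Z - N%:Z)) *
     ((s ^+ (N * N.+1))^-1 * s ^ ((k%:Z - N%:Z) * (k%:Z - N%:Z - 1))) by ring.
  have -> : (- (x / Q ^+ N)) ^+ k = (- x) ^+ k / s ^+ (2 * (N * k)).
    by rewrite -mulNr exprMn exprVn QE -!exprM !mulnA.
  rewrite -mulrA; congr (_ * _); rewrite !exprnP ?invr_expz -!expfzDr ?oppr_eq0 //; congr (_ ^ _).
    by lia.
  case: (nat_of_ord k) => [|j]; lia.
by rewrite /e; ring.
Qed.

Theorem triple_product : theta Q x * pinf Q Q = bsum (fun z => (- x) ^ z * s ^ (z * (z - 1))).
Proof.
have le : lim e (pinf Q Q) by apply: lim_poch0 => //; apply: small_weak hQ.
have sV n : small 0 (e n)^-1 by apply: pochV_small => //; apply: small_weak hQ.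
have p0 : pinf Q Q != 0 by apply: pinf_neq0.
have L1 : lim (fun N => poch Q x N * poch Q (Q / x) N) (theta Q x).
  by apply: limM; [apply: lim_poch | apply: lim_poch0].
have L2 : lim (fun N => poch Q x N * poch Q (Q / x) N)
    ((pinf Q Q)^-1 * bsum (fun z => (- x) ^ z * s ^ (z * (z - 1)))).
  apply: (lim_ext (fun N => esym (triple_product_finite N))).
  rewrite -bsumZ //; apply: tannery => [z|m].
    apply: limM; last exact: lim_cst.
    have -> : (pinf Q Q)^-1 = pinf Q Q / (pinf Q Q * pinf Q Q) by field.
    apply: limM; first by apply: (@lim_sub K e _ double) le => j; lia.
    apply: limV; first exact: mulf_neq0.
    by apply: limM; [apply: lim_absz|apply: lim_abszB].
  have [N hN] := hv m; exists N => M z hz _; apply: smallMl; last exact: hN.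
  apply: smallMl; first by apply: poch_small; apply: small_weak hQ.
  by rewrite invfM; apply: smallMl.
by rewrite (lim_uniq L1 L2); field.
Qed.

End TripleProduct.
End Expansions.

(** * Pentagonal numbers and shifted Appell sums *)

Section Pentagonal.
Variable K : vfield.
Variables (s Q : K).
Hypotheses (s0 : s != 0) (hs : small 1 s) (QE : Q = s ^+ 2).

Let Q0 : Q != 0. Proof. by rewrite QE expf_neq0. Qed.
Let hQ : small 1 Q. Proof. by rewrite QE; apply: small_expS. Qed.

Lemma signV (z : int) : (-1 : K) ^ (- z) = (-1) ^ z.
Proof. by rewrite -exprz_inv invrN invr1. Qed.

Lemma vanish_pentagonal : vanish (fun z => (-1) ^ z * s ^ (z * (3 * z + 1)) : K).
Proof.
by apply: (@vanish_exp K s _ _ 0 hs); [exact: small0_sign | move=> z; nia].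
Qed.

(** Triple product in base Q^3 at x = Q: the three progressions modulo 3 recombine to (Q;Q)_oo by
    [pinf_triple]. The series comes out with z replaced by -z. *)
Lemma pentagonal : bsum (fun z => (-1) ^ z * s ^ (z * (3 * z + 1))) = pinf Q Q.
Proof.
have s3 : s ^+ 3 != 0 by rewrite expf_neq0.
have e z : (- Q) ^ z * (s ^+ 3) ^ (z * (z - 1)) = (-1) ^ (- z) * s ^ ((- z) * (3 * (- z) + 1)).
  have -> : - Q = -1 * Q by rewrite mulN1r.
  rewrite expfzMl signV -mulrA; congr (_ * _).
  rewrite QE !exprnP !exprz_exp -expfzDr //; congr (s ^ _); lia.
have hv : vanish (fun z => (- Q) ^ z * (s ^+ 3) ^ (z * (z - 1))).
  apply: eq_vanish (fun z => esym (e z)) _.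
  by apply: (@vanish_comp K _ -%R) vanish_pentagonal; exists 0 => z; lia.
have hQ0 := small_weak hQ.
have := triple_product s3 (small_expS 2 hs) (erefl _) Q0 _ _ hv.
rewrite -(bsum_opp (fun z => (-1) ^ z * s ^ (z * (3 * z + 1)))) (eq_bsum e) => <-; last 2 first.
- by apply: smallMl => //; do 2!apply: smallX0; apply: small_weak hs.
- have -> : (s ^+ 3) ^+ 2 / Q = s ^+ 4 by rewrite QE; field.
  by apply: smallX0; apply: small_weak hs.
rewrite (pinf_triple hQ0 hQ) /theta.
have -> : (s ^+ 3) ^+ 2 = Q ^+ 3 by rewrite QE; ring.
by congr (_ * pinf _ _ * pinf _ _); field.
Qed.

Variable x : K.
Hypothesis hx : regular Q x.

Let x0 : x != 0. Proof. by case: hx. Qed.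
Let fac z : 1 - x * Q ^ z != 0.
Proof. by have [] := regular_factor z hx hQ Q0. Qed.

Let vanish_w : vanish (fun z => (-1) ^ z * s ^ (z * (3 * z + 1)) / (1 - x * Q ^ z)).
Proof. by apply: vanish_factor => //; apply: vanish_pentagonal. Qed.

(** By [pentagonal], (Q)_oo is the Appell series with its denominators removed, so the subtraction
    is termwise: 1 / (1 - y) - 1 = y / (1 - y). *)
Lemma gsum_sub1 : pinf Q Q * (gsum Q x - 1) =
  bsum (fun z => (-1) ^ z * s ^ (z * (3 * z + 1)) * (x * Q ^ z) / (1 - x * Q ^ z)).
Proof.
rewrite mulrBr mulr1 (watson s0 hs QE hx) -pentagonal -[- bsum _]mulN1r -bsumZ; last exact: vanish_pentagonal.
rewrite -bsumD //; last by apply: vanishZ; apply: vanish_pentagonal.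
by apply: eq_bsum => z; field.
Qed.

(** Termwise again, then z -> -z: with y = x Q^-z, the term -y / (1 - y) equals 1 / (1 - x^-1 Q^z).
    This shape occurs in the odd half of the dissection, that of [gsum_sub1] in the even half. *)
Lemma one_sub_gsum : pinf Q Q * (1 - gsum Q x) =
  bsum (fun z => (-1) ^ z * s ^ (z * (3 * z - 1)) / (1 - x^-1 * Q ^ z)).
Proof.
rewrite mulrBr mulr1 (watson s0 hs QE hx) -[X in X - _]pentagonal -[- bsum _]mulN1r -bsumZ //.
rewrite -bsumD //; last 2 first.
- exact: vanish_pentagonal.
- exact: vanishZ.
rewrite -bsum_opp; apply: eq_bsum => z; rewrite signV.
have -> : - z * (3 * - z + 1) = z * (3 * z - 1) by ring.
have := fac (- z); rewrite -invr_expz; have := expfz_neq0 z Q0 => q0.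
have := x0; move: (s ^ _) (Q ^ z) q0 => a q q0 xx h.
have h1 : x - q != 0.
  have -> : x - q = - q * (1 - x / q) by field.
  by rewrite mulf_neq0 // oppr_eq0.
have h2 : q - x != 0 by rewrite -opprB oppr_eq0.
by field; do !(apply/andP; split).
Qed.

End Pentagonal.

(** * Two-fold dissection of the universal mock theta function *)

Section Dissection.
Variable K : vfield.
Variables (s Q ii x : K).
Hypotheses (s0 : s != 0) (hs : small 1 s) (QE : Q = s ^+ 2).
Hypotheses (iiE : ii ^+ 2 = -1) (si : small 0 ii) (two0 : 2 != 0 :> K).
Implicit Types (v y : K).
(** A square root of -Q. Then Q / u = -u, so [theta] takes the same value at u and -u; and (-u) u =
    Q lowers the exponent 3n(n+1) of s at node 1 to the n(3n+1) of [watson]. *)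
Let u := ii * s.
Hypotheses (hx : regular Q x) (hxu : regular Q (x * u)) (hxu' : regular Q (x * - u)).
Hypotheses (sx : small 0 (x * u)).

Let Q0 : Q != 0. Proof. by rewrite QE expf_neq0. Qed.
Let hQ : small 1 Q. Proof. by rewrite QE; apply: small_expS. Qed.
Let x0 : x != 0. Proof. by case: hx. Qed.
Let ii0 : ii != 0.
Proof. by apply/negP => /eqP h; move: iiE; rewrite h expr0n /= => /eqP; rewrite eq_sym oppr_eq0 oner_eq0. Qed.
Let u0 : u != 0. Proof. exact: mulf_neq0. Qed.
Let uu : u ^+ 2 = - Q. Proof. by rewrite exprMn iiE QE mulN1r. Qed.
Let su : small 1 u. Proof. exact: smallMl. Qed.
Let iiV : ii^-1 = - ii.
Proof. by apply: (mulfI ii0); rewrite mulfV // mulrN -expr2 iiE opprK. Qed.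

Let Qu : Q / u = - u. Proof. by rewrite -[Q]opprK -uu; field. Qed.

Let su' : small 1 (- u). Proof. exact: smallN. Qed.

Let neq1 y : small 1 y -> y != 1.
Proof. by move=> /small1_neq1; rewrite subr_eq0 eq_sym. Qed.

Let reg_u v : small 1 v -> v != 0 -> Q / v = - v -> regular Q v.
Proof.
move=> sv v0 e; split=> //; [exact: neq1 | | by rewrite e; apply: smallN].
by apply: smallMr => //; apply: small_weak hQ.
Qed.

Let regu : regular Q u. Proof. exact: reg_u. Qed.
Let regu' : regular Q (- u).
Proof. by apply: reg_u; rewrite ?oppr_eq0 // invrN mulrN Qu. Qed.

Let reg_inv v : regular Q v -> regular Q v^-1.
Proof.
case=> v0 v1 h h'; split; rewrite ?invr_eq0 ?invr_eq1 // ?invrK mulrC //.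
Qed.

Let regN1 : regular Q (-1).
Proof.
split; rewrite ?oppr_eq0 ?oner_eq0 //.
- by rewrite eq_sym -subr_eq0 opprK.
- by rewrite mulN1r; apply: smallN.
- by rewrite invrN invr1 mulrN1; apply: smallN.
Qed.

Let b (i : 'I_3) : K := nth 0 [:: 1; u; - u] i.
Let b0 i : b i != 0.
Proof. by case: i => [[|[|[]]]] //= ?; rewrite /b /= ?oner_eq0 ?oppr_eq0. Qed.

Let regb i j : i != j -> regular Q (b j / b i).
Proof.
case: i j => [[|[|[]]]] //= hi [[|[|[]]]] //= hj _; rewrite /b /= ?divr1 ?div1r //.
- exact: reg_inv.
- by rewrite mulNr mulfV.
- exact: reg_inv.
- by rewrite invrN mulrN mulfV.
Qed.

Let regxb i : regular Q (x * b i).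
Proof. by case: i => [[|[|[]]]] //= hi; rewrite /b /= ?mulr1. Qed.

Let ord3 (P : 'I_3 -> Prop) : P ord0 -> P (inord 1) -> P (inord 2) -> forall i, P i.
Proof.
move=> h0 h1 h2 [[|[|[]]]] //= hi.
- by have -> : Ordinal hi = ord0 by apply: val_inj.
- by have -> : Ordinal hi = inord 1 by apply: val_inj; rewrite /= inordK.
- by have -> : Ordinal hi = inord 2 by apply: val_inj; rewrite /= inordK.
Qed.

Let weight0 n : pf_weight s b ord0 n = (-1) ^ n * s ^ (n * (3 * n + 1)).
Proof.
rewrite /pf_weight !big_ord_recl big_ord0 /b /= !divr1 mulr1 opprK signV.
rewrite -!mulrA; congr (_ * _).
have -> : s ^ (n * (n + 1)) * ((- u) ^ (- n) * (s ^ (n * (n + 1)) * (u ^ (- n) * s ^ (n * (n + 1))))) =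
  ((- u) ^ (- n) * u ^ (- n)) * (s ^ (n * (n + 1)) * s ^ (n * (n + 1)) * s ^ (n * (n + 1))) by ring.
rewrite -expfzMl mulNr -expr2 uu opprK QE -!expfzDr // exprnP exprz_exp -expfzDr //; congr (s ^ _); lia.
Qed.

Let weight_aux jj n : (- (jj * s)^-1) ^ (- n) * (-1) ^ (- n) *
  (s ^ (n * (n + 1)) * s ^ (n * (n + 1)) * s ^ (n * (n + 1))) = jj ^ n * s ^ (n * (3 * n + 4)).
Proof.
rewrite -expfzMl mulrN1 opprK exprz_inv opprK expfzMl -!expfzDr // -mulrA -expfzDr //.
congr (_ * s ^ _); lia.
Qed.

Let weight1 n : pf_weight s b (inord 1) n = ii ^ n * s ^ (n * (3 * n + 4)).
Proof.
rewrite /pf_weight !big_ord_recl big_ord0 /b /= !inordK //= mulr1 mulfV // mulNr mulfV // opprK.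
rewrite exp1rz !mul1r -weight_aux /u; ring.
Qed.

Let weight2 n : pf_weight s b (inord 2) n = (- ii) ^ n * s ^ (n * (3 * n + 4)).
Proof.
rewrite /pf_weight !big_ord_recl big_ord0 /b /= !inordK //= mulr1.
have -> : - (1 / - u) = - (- ii * s)^-1 by rewrite mulNr div1r.
have -> : - (u / - u) = 1 by rewrite invrN mulrN mulfV ?opprK.
have -> : - (- u / - u) = -1 by rewrite mulfV ?oppr_eq0.
rewrite exp1rz mul1r -weight_aux; ring.
Qed.

Let weightV i : vanish (pf_weight s b i).
Proof.
elim/ord3: i.
- by apply: eq_vanish (fun n => esym (weight0 n)) _; apply: vanish_pentagonal.
- apply: eq_vanish (fun n => esym (weight1 n)) _; apply: (@vanish_exp K s _ _ 2 hs) => z; last by nia.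
  by apply: small0_exprz => //; rewrite iiV; apply: smallN.
- apply: eq_vanish (fun n => esym (weight2 n)) _; apply: (@vanish_exp K s _ _ 2 hs) => z; last by nia.
  by apply: small0_exprz; rewrite ?invrN ?iiV ?opprK //; apply: smallN.
Qed.

Let E := pinf (Q ^+ 2) (- Q).

Let thetau : theta Q u = E.
Proof. by rewrite /theta Qu pinf_sqr ?uu //; apply: small_weak su. Qed.

Let thetau' : theta Q (- u) = E.
Proof. by rewrite /theta invrN mulrN Qu opprK mulrC pinf_sqr ?uu //; apply: small_weak su. Qed.

Let theta_inv' v : small 1 v -> v != 0 -> Q / v = - v -> theta Q v^-1 = - v^-1 * theta Q v.
Proof.
move=> sv v0 e; have v1 : 1 - v != 0 by apply: small1_neq1.
have e1 : v^-1 * Q = - v by rewrite mulrC.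
have svQ : small 0 (v * Q) by apply: smallMl; [apply: small_weak sv | apply: small_weak hQ].
have svN : small 0 (- v) by apply/smallNE; apply: small_weak sv.
rewrite /theta invrK e [Q * v]mulrC pinfS ?e1 // [pinf Q v]pinfS //.
by field.
Qed.

Let thetaN1 : theta Q (-1) = 2 * pinf Q (- Q) ^+ 2.
Proof.
rewrite /theta invrN invr1 mulrN1 pinfS //; last by rewrite mulN1r; apply: smallN; apply: small_weak hQ.
by rewrite mulN1r; ring.
Qed.

Let y := - Q * x ^+ 2.
Let y' := - Q / x ^+ 2.
Let P4 := pinf (Q ^+ 4) (Q ^+ 4).
Let xu_y : y = (x * u) ^+ 2. Proof. by rewrite exprMn uu /y; ring. Qed.
Let y'E : y' = (Q / (x * u)) ^+ 2.
Proof. by rewrite expr_div_n exprMn uu /y'; field; rewrite oppr_eq0 Q0 x0. Qed.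

Let s4 : s ^+ 4 != 0. Proof. exact: expf_neq0. Qed.
Let hs4 : small 1 (s ^+ 4). Proof. exact: small_expS. Qed.
Let Q4E : Q ^+ 4 = (s ^+ 4) ^+ 2. Proof. by rewrite QE; ring. Qed.

Let small_sqr v : small 1 v -> small 1 (v ^+ 2). Proof. exact: small_expS. Qed.

Let regy : regular (Q ^+ 4) y.
Proof.
have [xu0 xu1 h h'] := hxu; have [_ xu1' _ _] := hxu'.
rewrite xu_y; split.
- exact: expf_neq0.
- by rewrite sqrf_eq1 negb_or xu1 /= -eqr_oppLR -mulrN.
- have -> : (x * u) ^+ 2 * Q ^+ 4 = (x * u * Q) ^+ 2 * Q ^+ 2 by ring.
  by apply: smallMr; [exact: small_sqr | apply: smallX0; apply: small_weak hQ].
- have -> : Q ^+ 4 / (x * u) ^+ 2 = (Q / (x * u)) ^+ 2 * Q ^+ 2 by field; rewrite ?x0 ?u0.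
  by apply: smallMr; [exact: small_sqr | apply: smallX0; apply: small_weak hQ].
Qed.

Let regy' : regular (Q ^+ 4) y'.
Proof.
have [xu0 xu1 h h'] := hxu; rewrite y'E; have sy := small_sqr h'; split.
- by rewrite expf_neq0 // mulf_neq0 ?invr_neq0.
- exact: neq1.
- by apply: smallMr => //; apply: smallX0; apply: small_weak hQ.
- have -> : Q ^+ 4 / (Q / (x * u)) ^+ 2 = (x * u * Q) ^+ 2 by field; rewrite ?Q0 ?x0 ?u0.
  exact: small_sqr.
Qed.

Let B v jj := bsum (fun n => jj ^ n * s ^ (n * (3 * n + 4)) / (1 - x * v * Q ^ n)).

(** The two fractions have the common denominator 1 - (x u Q^n)^2. For even n the numerators ii^n
    and (-ii)^n agree, and the fractions differ by 2 x u Q^n over it; for odd n they are opposite,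
    and the fractions add up to 2 over it. The two halves are the shifted Appell sums in base Q^4 at
    [y] and [y']. *)
Let even_odd_difference :
  u * (B u ii - B (- u) (- ii)) = 2 * P4 * (x^-1 * (gsum (Q ^+ 4) y - 1) + (1 - gsum (Q ^+ 4) y')).
Proof.
have hw1 : vanish (fun n => ii ^ n * s ^ (n * (3 * n + 4)) / (1 - x * u * Q ^ n)).
  by have := weightV (inord 1) => /(eq_vanish weight1); apply: vanish_factor.
have hw2 : vanish (fun n => (- ii) ^ n * s ^ (n * (3 * n + 4)) / (1 - x * - u * Q ^ n)).
  by have := weightV (inord 2) => /(eq_vanish weight2); apply: vanish_factor.
pose h n := u * (ii ^ n * s ^ (n * (3 * n + 4)) / (1 - x * u * Q ^ n) +
   (-1) * ((- ii) ^ n * s ^ (n * (3 * n + 4)) / (1 - x * - u * Q ^ n))).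
have hv : vanish h by apply: vanishZ; apply: vanishD => //; apply: vanishZ.
have -> : u * (B u ii - B (- u) (- ii)) = bsum h.
  rewrite bsumZ; last by apply: vanishD => //; apply: vanishZ.
  by rewrite bsumD //; [rewrite bsumZ // mulN1r | apply: vanishZ].
rewrite bsum_even_odd //.
pose t1 z := (-1) ^ z * (s ^+ 4) ^ (z * (3 * z + 1)) * (y * (Q ^+ 4) ^ z) / (1 - y * (Q ^+ 4) ^ z).
pose t2 z := (-1) ^ z * (s ^+ 4) ^ (z * (3 * z - 1)) / (1 - y'^-1 * (Q ^+ 4) ^ z).
have y_u : y = x ^+ 2 * u ^+ 2 by rewrite xu_y exprMn.
have s0' z : s ^ z != 0 by rewrite expfz_neq0.
have f1 z := regular_factor z hxu hQ Q0.
have f2 z := regular_factor z hxu' hQ Q0.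
have hsgn (jj : K) z : jj ^+ 2 = -1 -> jj ^ (z *+ 2) = (-1) ^ z.
  by move=> <-; rewrite exprnP exprz_exp; congr (_ ^ _); lia.
have iiN : (- ii) ^+ 2 = -1 by rewrite sqrrN.
have e1 z : h (z *+ 2) = 2 * x^-1 * t1 z.
  have [+ _] := f1 (z *+ 2); have [+ _] := f2 (z *+ 2).
  rewrite /h /t1 (hsgn ii) // (hsgn (- ii)) //; have := x0; rewrite y_u.
  have -> : s ^ (z *+ 2 * (3 * (z *+ 2) + 4)) = (s ^+ 4) ^ (z * (3 * z + 1)) * Q ^ (z *+ 2).
    rewrite QE !exprnP !exprz_exp -expfzDr //; congr (s ^ _); lia.
  have -> : (Q ^+ 4) ^ z = (Q ^ (z *+ 2)) ^+ 2.
    rewrite !exprnP !exprz_exp; congr (Q ^ _); lia.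
  move: (Q ^ _) ((-1) ^ z) ((s ^+ 4) ^ _) => w e a xx h2 h1.
  have h3 : 1 - (x * u * w) ^+ 2 != 0.
    have -> : 1 - (x * u * w) ^+ 2 = (1 - x * u * w) * (1 - x * - u * w) by ring.
    exact: mulf_neq0.
  by field; do !(apply/andP; split).
(* For n = 2z + 1 the denominator 1 - y Q^(2n) is 1 - y'^-1 (Q^4)^(z + 1), hence the shift by
   one. *)
have e2 z : h (z *+ 2 + 1) = 2 * t2 (z + 1).
  have [+ _] := f1 (z *+ 2 + 1); have [+ _] := f2 (z *+ 2 + 1).
  have -> : t2 (z + 1) = - (-1) ^ z * (s * s ^ ((z *+ 2 + 1) * (3 * (z *+ 2 + 1) + 4))) /
      (1 - x ^+ 2 * u ^+ 2 * (Q ^ (z *+ 2 + 1)) ^+ 2).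
    rewrite /t2 expfzDr ?oppr_eq0 ?oner_eq0 // expr1z mulrN1; congr (_ * _ / (1 - _)).
      by rewrite !exprnP exprz_exp -{2}[s]expr1z -expfzDr //; congr (s ^ _); lia.
    rewrite -y_u.
    have -> : (Q ^+ 4) ^ (z + 1) = Q ^+ 2 * (Q ^ (z *+ 2 + 1)) ^+ 2.
      rewrite !exprnP !exprz_exp -expfzDr //; congr (Q ^ _); lia.
    by rewrite /y' /y; field; rewrite oppr_eq0 Q0 x0.
  have iiO (jj : K) : jj ^+ 2 = -1 -> jj != 0 -> jj ^ (z *+ 2 + 1) = (-1) ^ z * jj.
    by move=> hj jj0; rewrite expfzDr // hsgn // expr1z.
  rewrite /h (iiO ii) // (iiO (- ii)) ?oppr_eq0 //.
  move: (s ^ _) (Q ^ _) ((-1) ^ z) => a w e h2 h1.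
  have h3 : 1 - (x * u * w) ^+ 2 != 0.
    have -> : 1 - (x * u * w) ^+ 2 = (1 - x * u * w) * (1 - x * - u * w) by ring.
    exact: mulf_neq0.
  have -> : s = - u * ii.
    have -> : - u * ii = - ii ^+ 2 * s by rewrite /u; ring.
    by rewrite iiE opprK mul1r.
  by field; do !(apply/andP; split).
have ht1 : vanish t1.
  apply: (@eq_vanish K (fun z => 2^-1 * x * h (z *+ 2))).
    move=> z; rewrite e1; move: (t1 z) => t; field; by rewrite ?two0 ?x0.
  by apply: vanishZ; apply: vanish_comp hv; exists 0 => z; lia.
have ht2 : vanish t2.
  apply: (@eq_vanish K (fun z => 2^-1 * h ((z - 1) *+ 2 + 1))).
    move=> z; rewrite e2 subrK; move: (t2 z) => t; field; by rewrite ?two0.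
  by apply: vanishZ; apply: vanish_comp hv; exists 2 => z; lia.
rewrite (eq_bsum e1) (eq_bsum e2) !bsumZ //; last by apply: vanish_comp ht2; exists 1 => z; lia.
rewrite bsum_shift1 // -(gsum_sub1 s4 hs4 Q4E regy) -(one_sub_gsum s4 hs4 Q4E regy') -/P4; ring.
Qed.

(** (-Q;Q) splits into (-Q;Q^2)(-Q^2;Q^2), and (Q;Q)(-Q;Q) = (Q^2;Q^2) is completed by (-Q^2;Q^2) to
    (Q^4;Q^4). This makes the coefficient of the base Q^4 terms in [dissection] equal to 1. *)
Let P4E : E * P4 = pinf Q (- Q) ^+ 2 * pinf Q Q.
Proof.
have sQ := small_weak hQ; have sNQ := smallN sQ; have hQ2 := small_expS 1 hQ.
have -> : pinf Q (- Q) ^+ 2 * pinf Q Q = pinf Q (- Q) * (pinf Q Q * pinf Q (- Q)) by ring.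
rewrite pinf_sqr // (pinf_double sNQ hQ) -/E -!mulrA; congr (_ * _).
have -> : - Q * Q = - Q ^+ 2 by ring.
by rewrite [RHS]mulrC pinf_sqr -?exprM //; apply: small_weak hQ2.
Qed.

(** The three-term partial fraction is solved for its term at node 1, which is [gsum Q x] by
    [watson]; the terms at u and -u combine in [even_odd_difference], and the reciprocal of the
    three theta functions becomes the quotient. *)
Theorem dissection :
  gsum Q x = 1 - gsum (Q ^+ 4) (- Q / x ^+ 2) + x^-1 * (gsum (Q ^+ 4) (- Q * x ^+ 2) - 1) +
    pinf Q Q * pinf (Q ^+ 2) (- Q) ^+ 2 / (theta Q x * theta (Q ^+ 2) (- Q * x ^+ 2)).
Proof.
rewrite -/y -/y' -/E.
have := theta_partial_fractions ord0 s0 hs QE b0 x0 regb regxb weightV.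
rewrite !big_ord_recl !big_ord0.
have -> : \prod_(j | j != ord0) theta Q (b j / b ord0) = theta Q u * theta Q (- u).
  by rewrite big_mkcond !big_ord_recl big_ord0 /= /b /= !divr1 mul1r mulr1.
have -> : \prod_(j | j != lift ord0 ord0) theta Q (b j / b (lift ord0 ord0)) =
   theta Q u^-1 * theta Q (-1).
  by rewrite big_mkcond !big_ord_recl big_ord0 /= /b /= mulNr mulfV // !mul1r mulr1.
have -> : \prod_(j | j != lift ord0 (lift ord0 ord0)) theta Q (b j / b (lift ord0 (lift ord0 ord0))) =
   theta Q (- u)^-1 * theta Q (-1).
  have uN : u / - u = -1 by rewrite invrN mulrN mulfV.
  by rewrite big_mkcond !big_ord_recl big_ord0 /= /b /= uN mul1r !mulr1.
have w1 : lift ord0 ord0 = inord 1 :> 'I_3 by apply: val_inj; rewrite /= inordK.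
have w2 : lift ord0 (lift ord0 ord0) = inord 2 :> 'I_3 by apply: val_inj; rewrite /= inordK.
have -> : bsum (fun n => pf_weight s b ord0 n / (1 - x * b ord0 * Q ^ n)) = pinf Q Q * gsum Q x.
  by rewrite (watson s0 hs QE hx); apply: eq_bsum => n; rewrite weight0 /b /= mulr1.
have -> : bsum (fun n => pf_weight s b (lift ord0 ord0) n / (1 - x * b (lift ord0 ord0) * Q ^ n)) = B u ii.
  by apply: eq_bsum => n; rewrite w1 weight1 -w1.
have -> : bsum (fun n => pf_weight s b (lift ord0 (lift ord0 ord0)) n /
    (1 - x * b (lift ord0 (lift ord0 ord0)) * Q ^ n)) = B (- u) (- ii).
  by apply: eq_bsum => n; rewrite w2 weight2 -w2.
rewrite {1 2 3}/b /= !mulr1 addr0 thetaN1.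
(* Inverting u and -u costs the factors -1/u and 1/u; these opposite signs produce the difference
   [B u ii - B (- u) (- ii)]. *)
rewrite theta_inv' // theta_inv' ?oppr_eq0 //; last by rewrite invrN mulrN Qu.
have xuN : x * - u = - (x * u) by rewrite mulrN.
have [_ _ _ sxu] := hxu.
rewrite thetau thetau' xuN theta_sqr // -xu_y.
have E0 : E != 0 by rewrite -thetau theta_neq0.
have p0 : pinf Q Q != 0 by apply: pinf_neq0.
have r0 : pinf Q (- Q) != 0 by apply: pinf_neq0 => //; apply: smallN.
have Ty : theta (Q ^+ 2) y != 0.
  by rewrite xu_y -theta_sqr // -xuN mulf_neq0 ?theta_neq0.
have Tx : theta Q x != 0 by apply: theta_neq0.
have := P4E; have := even_odd_difference.
move: (theta (Q ^+ 2) y) (theta Q x) Ty Tx => Ty Tx Ty0 Tx0.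
move: (_ * (_ - 1)) (gsum _ y') => X g'.
move: (pinf Q Q) (pinf Q (- Q)) (gsum Q x) p0 r0 => p r G p0 r0.
move: (B u ii) (B (- u) (- ii)) => Bp Bm eB eP h.
have rp : r ^+ 2 * p != 0 by rewrite mulf_neq0 ?expf_neq0.
have h2 : p * E ^+ 2 / (Tx * Ty) = G - (E / (2 * p * r ^+ 2)) * (u * (Bp - Bm)).
  by rewrite h; field; rewrite !oppr_eq0 oner_eq0 two0 r0 E0 u0 p0.
rewrite h2 eB.
have -> : E / (2 * p * r ^+ 2) * (2 * P4 * (X + (1 - g'))) = (E * P4) / (r ^+ 2 * p) * (X + (1 - g')).
  by field; rewrite two0 p0 r0.
by rewrite eP mulfV // mul1r; ring.
Qed.

End Dissection.

(** * Theta functions at eighth roots of unity *)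

Section ThetaSquare.
Variable K : vfield.
Implicit Types (s x : K).

Lemma bsum_sqr (f : int -> K) : vanish f -> (forall z, small 0 (f z)) ->
  bsum f ^+ 2 = bsum (fun n => bsum (fun k => f k * f (n - k))).
Proof.
move=> hv hb.
transitivity (bsum (fun k => bsum (fun n => f k * f (n - k)))); last first.
  apply: bsum_exchange => m; have [N hN] := hv m; exists (N + N)%N => k n h.
  case: (leqP N (absz k)) => hk; first by apply: smallMr; [apply: hN|].
  by apply: smallMl => //; apply: hN; lia.
rewrite expr2 -bsumZ //; apply: eq_bsum => k.
rewrite mulrC -bsumZ // -(bsum_shift (- k)) //; exact: vanishZ.
Qed.

Lemma theta_series_sqr s x : s != 0 -> x != 0 -> small 1 s ->
  vanish (fun z => (- x) ^ z * s ^ (z * (z - 1))) ->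
  (forall z, small 0 ((- x) ^ z * s ^ (z * (z - 1)))) ->
  vanish (fun k => x ^ (k *+ 2) * s ^ (k *+ 2 * (k - 1))) ->
  vanish (fun k => x ^ (k *+ 2) * s ^ (k *+ 2 * k)) ->
  bsum (fun z => (- x) ^ z * s ^ (z * (z - 1))) ^+ 2 =
  bsum (fun k => x ^ (k *+ 2) * s ^ (k *+ 2 * (k - 1))) * bsum (fun l => s ^ (l *+ 2 * l)) -
  x * bsum (fun k => x ^ (k *+ 2) * s ^ (k *+ 2 * k)) * bsum (fun l => s ^ (l *+ 2 * (l + 1))).
Proof.
move=> s0 x0 hs hv hb hv1 hv2.
have nx0 : - x != 0 by rewrite oppr_eq0.
have vs (p : int -> int) k : (forall z, (absz z)%:Z <= p z + k%:Z) -> vanish (fun z => s ^ p z).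
  move=> hp; apply: (@eq_vanish K (fun z => 1 * s ^ p z)) => [z|]; first by rewrite mul1r.
  by apply: (vanish_exp hs _ hp) => z; apply: small1.
have vl0 : vanish (fun l => s ^ (l *+ 2 * l)) by apply: (vs _ 0) => z; nia.
have vl1 : vanish (fun l => s ^ (l *+ 2 * (l + 1))) by apply: (vs _ 1) => z; nia.
have xN (k : int) : (- x) ^ (k *+ 2) = x ^ (k *+ 2).
  have -> : k *+ 2 = 2 * k by lia.
  by rewrite -!exprz_exp -!exprnP sqrrN.
set f := fun z => _.
have dv : vanish (fun n => bsum (fun k => f k * f (n - k))).
  move=> m; have [N hN] := hv m; exists (N + N)%N => n hn.
  apply: small_bsum => [|k].
    by apply: vanishMr => //; exists 0 => z _; apply: hb.
  case: (leqP N (absz k)) => hk; first by apply: smallMr; [apply: hN|apply: hb].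
  by apply: smallMl; [apply: hb | apply: hN]; lia.
rewrite bsum_sqr // bsum_even_odd // -[- (x * _ * _)]mulNr; congr (_ + _).
  rewrite mulrC -bsumZ //; apply: eq_bsum => n.
  rewrite -(@bsum_shift K _ n); last first.
    by apply: vanishMr => //; exists 0 => z _; apply: hb.
  rewrite mulrC -bsumZ //; apply: eq_bsum => k; rewrite /f.
  have -> : n *+ 2 - (k + n) = n - k by lia.
  have -> : (- x) ^ (k + n) * s ^ ((k + n) * (k + n - 1)) * ((- x) ^ (n - k) * s ^ ((n - k) * (n - k - 1))) =
    ((- x) ^ (k + n) * (- x) ^ (n - k)) * (s ^ ((k + n) * (k + n - 1)) * s ^ ((n - k) * (n - k - 1))) by ring.
  rewrite -!expfzDr //.
  have -> : k + n + (n - k) = n *+ 2 by lia.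
  rewrite xN -mulrA -expfzDr //; congr (_ * s ^ _); lia.
set A := bsum (fun k => x ^ (k *+ 2) * _); set B := bsum (fun l => s ^ _).
have -> : - (x * A) * B = - x * (B * A) by ring.
rewrite -[B * A]bsumZ // -bsumZ; last exact: vanishZ.
apply: eq_bsum => n.
rewrite -(@bsum_shift K _ (n + 1)); last first.
  by apply: vanishMr => //; exists 0 => z _; apply: hb.
rewrite mulrCA mulrC -bsumZ //; apply: eq_bsum => k; rewrite /f.
have -> : n *+ 2 + 1 - (k + (n + 1)) = n - k by lia.
have -> : (- x) ^ (k + (n + 1)) * s ^ ((k + (n + 1)) * (k + (n + 1) - 1)) *
    ((- x) ^ (n - k) * s ^ ((n - k) * (n - k - 1))) =
  ((- x) ^ (k + (n + 1)) * (- x) ^ (n - k)) *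
  (s ^ ((k + (n + 1)) * (k + (n + 1) - 1)) * s ^ ((n - k) * (n - k - 1))) by ring.
rewrite -!expfzDr //.
have -> : k + (n + 1) + (n - k) = n *+ 2 + 1 by lia.
have -> : (- x) ^ (n *+ 2 + 1) = - x * x ^ (n *+ 2) by rewrite expfzDr // xN expr1z mulrC.
rewrite -!mulrA -expfzDr //.
congr (_ * (_ * s ^ _)); lia.
Qed.

(** Triple product at x = -s, where Q / x = x and the theta function is a square. *)
Lemma phi_series s : s != 0 -> small 1 s ->
  pinf (s ^+ 2) (- s) ^+ 2 * pinf (s ^+ 2) (s ^+ 2) = bsum (fun z => s ^ (z * z)).
Proof.
move=> s0 hs; have ns0 : - s != 0 by rewrite oppr_eq0.
have e z : (- - s) ^ z * s ^ (z * (z - 1)) = s ^ (z * z).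
  by rewrite opprK -expfzDr //; congr (s ^ _); lia.
have hv : vanish (fun z => (- - s) ^ z * s ^ (z * (z - 1))).
  apply: (@eq_vanish K (fun z => 1 * s ^ (z * z))) => [z|]; first by rewrite e mul1r.
  by apply: (@vanish_exp K s _ _ 0) => // z; [apply: small1 | nia].
have sN : s ^+ 2 / - s = - s by field.
have s2 : small 1 (s ^+ 2) by apply: small_expS.
rewrite (_ : pinf (s ^+ 2) (- s) ^+ 2 = theta (s ^+ 2) (- s)); last by rewrite /theta sN expr2.
rewrite (triple_product s0 hs (erefl _) ns0 _ _ hv).
- exact: eq_bsum.
- by apply: smallMl; [apply/smallNE; apply: small_weak hs|apply: small_weak s2].
- by rewrite sN; apply/smallNE; apply: small_weak hs.
Qed.

End ThetaSquare.

Section Monomials.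
Variable K : vfield.
Variable t : K.
Hypotheses (t0 : t != 0) (ht : small 1 t).
Implicit Types c j : K.

(** Valuation zero. Roots of unity are of this kind, so the size of a monomial c t^m can be read
    from m. *)
Definition bounded_unit c := [/\ c != 0, small 0 c & small 0 c^-1].

Lemma bounded_unitN c : bounded_unit c -> bounded_unit (- c).
Proof. by case=> h h1 h2; split; rewrite ?oppr_eq0 ?invrN //; apply: smallN. Qed.

Lemma bounded_unit1 : bounded_unit 1.
Proof. by split; rewrite ?oner_eq0 ?invr1 //; apply: small1. Qed.

Lemma bounded_unitM c d : bounded_unit c -> bounded_unit d -> bounded_unit (c * d).
Proof.
case=> h h1 h2 [g g1 g2]; split; rewrite ?mulf_neq0 ?invfM //; exact: smallMl.
Qed.

Lemma bounded_unit_i j : j ^+ 2 = -1 -> small 0 j -> bounded_unit j.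
Proof.
move=> jj sj; have j0 : j != 0.
  by apply/negP => /eqP h; move/eqP: jj; rewrite h expr0n /= eq_sym oppr_eq0 oner_eq0.
split=> //; suff -> : j^-1 = - j by apply: smallN.
by apply: (mulfI j0); rewrite mulfV // mulrN -expr2 jj opprK.
Qed.

Lemma small_mono c m n : small 0 c -> (n <= m)%N -> small n (c * t ^+ m).
Proof. by move=> hc h; apply: smallMl => //; apply: small_le h (smallX1 m ht). Qed.

Lemma small_pow m n : (n <= m)%N -> small n (t ^+ m).
Proof. by move=> h; apply: small_le h (smallX1 m ht). Qed.

Lemma mono_div c m n : c != 0 -> (m <= n)%N -> t ^+ n / (c * t ^+ m) = c^-1 * t ^+ (n - m).
Proof.
move=> c0 h; rewrite -{1}(subnK h) exprD; have := expf_neq0 m t0 => tm.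
by field; rewrite tm c0.
Qed.

Lemma regular_mono c m n : bounded_unit c -> (0 < m < n)%N -> regular (t ^+ n) (c * t ^+ m).
Proof.
case=> c0 c1 c2 /andP [m0 mn]; have sm := small_mono c1 m0; split.
- by rewrite mulf_neq0 ?expf_neq0.
- by rewrite eq_sym -subr_eq0; apply: small1_neq1.
- by apply: smallMr => //; apply: small_pow.
- by rewrite mono_div ?(ltnW mn) //; apply: small_mono => //; rewrite subn_gt0.
Qed.

(** The triple product with all exponents in [t]. The base exponent is even so that t^n serves as
    the square root [s], and m <= 2n keeps Q / x bounded. *)
Lemma theta_mono c m n : bounded_unit c -> (m <= n.*2)%N -> (0 < n)%N ->
  theta (t ^+ n.*2) (c * t ^+ m) * pinf (t ^+ n.*2) (t ^+ n.*2) =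
  bsum (fun z => (- c) ^ z * t ^ (n%:Z * (z * (z - 1)) + m%:Z * z)).
Proof.
move=> hc mn n0; have [c0 c1 c2] := hc; have [nc0 nc1 nc2] := bounded_unitN hc.
have e z : (- (c * t ^+ m)) ^ z * (t ^+ n) ^ (z * (z - 1)) =
  (- c) ^ z * t ^ (n%:Z * (z * (z - 1)) + m%:Z * z).
  rewrite -mulNr expfzMl -mulrA; congr (_ * _).
  rewrite !exprnP !exprz_exp -expfzDr //; congr (t ^ _); lia.
rewrite -(eq_bsum e); apply: triple_product.
- exact: expf_neq0.
- exact: small_pow.
- by rewrite -exprM muln2.
- by rewrite mulf_neq0 ?expf_neq0.
- by apply: smallMl; [exact: small_mono | exact: small_pow].
- by rewrite mono_div //; apply: small_mono.
- apply: eq_vanish (fun z => esym (e z)) _.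
  apply: (@vanish_exp K t _ _ 1 ht) => z; first exact: small0_exprz.
  have hz : z * (z - 1) >= 0 by case: (z) => k; nia.
  case: (leP 0 z) => h.
    have : n%:Z * (z * (z - 1)) >= z * (z - 1) by nia.
    have : m%:Z * z >= 0 by nia.
    by nia.
  have : m%:Z * z >= n.*2%:Z * z by nia.
  have : n%:Z * (z * (z - 1)) + n.*2%:Z * z = n%:Z * (z * (z + 1)) by lia.
  have h2 : z * (z + 1) >= 0 by nia.
  have : n%:Z * (z * (z + 1)) >= z * (z + 1) by nia.
  by nia.
Qed.

End Monomials.

Lemma sq_ge (z : int) : (absz z)%:Z <= z * z.
Proof. by case: z => k; nia. Qed.

Section RankAtEighthRoot.
Variable K : vfield.
Variable t : K.
Hypotheses (t0 : t != 0) (ht : small 1 t).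

(* The exponents are those of the paper's series in [q = t^2]: [qJ2_16] is
   [q J_{2,16}] and [phi m = j(-t^m; t^(2m))], so that [phi 4] is [\overline{J}_{2,4}]. *)
Definition J6_16 := theta (t ^+ 32) (t ^+ 12) * pinf (t ^+ 32) (t ^+ 32).
Definition qJ2_16 := t ^+ 2 * (theta (t ^+ 32) (t ^+ 4) * pinf (t ^+ 32) (t ^+ 32)).
Definition phi m := pinf (t ^+ m.*2) (- t ^+ m) ^+ 2 * pinf (t ^+ m.*2) (t ^+ m.*2).
Local Notation a := J6_16.
Local Notation b := qJ2_16.

Let tX0 m : t ^+ m != 0. Proof. exact: expf_neq0. Qed.
Let st m : small 1 (t ^+ m.+1). Proof. exact: small_pow. Qed.
Let st0 m : small 0 (t ^+ m). Proof. exact: small_pow. Qed.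
Let u1 : bounded_unit (1 : K). Proof. exact: bounded_unit1. Qed.

Let vb : vanish (fun z => (-1) ^ z * t ^ (16 * (z * z) - 12 * z + 2)).
Proof. by apply: (@vanish_exp K t _ _ 1 ht) => z; [exact: small0_sign | have := sq_ge z; lia]. Qed.

Lemma J6_series : a = bsum (fun z => (-1) ^ z * t ^ (16 * (z * z) - 4 * z)).
Proof.
have := theta_mono t0 ht u1 (isT : 12 <= 16.*2)%N isT; rewrite mul1r /J6_16 => ->.
by apply: eq_bsum => z; congr (_ * t ^ _); lia.
Qed.

Lemma J2_series : b = bsum (fun z => (-1) ^ z * t ^ (16 * (z * z) - 12 * z + 2)).
Proof.
have := theta_mono t0 ht u1 (isT : 4 <= 16.*2)%N isT; rewrite mul1r /qJ2_16 => ->.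
rewrite -bsumZ.
  apply: eq_bsum => z; rewrite mulrCA; congr (_ * _).
  by rewrite exprnP -expfzDr //; congr (t ^ _); lia.
by apply: (@vanish_exp K t _ _ 1 ht) => z; [exact: small0_sign | have := sq_ge z; lia].
Qed.

Let a_opp : a = bsum (fun z => (-1) ^ z * t ^ (16 * (z * z) + 4 * z)).
Proof.
rewrite J6_series -bsum_opp; apply: eq_bsum => z; rewrite signV; congr (_ * t ^ _); lia.
Qed.

Let b_opp : b = bsum (fun z => (-1) ^ z * t ^ (16 * (z * z) + 12 * z + 2)).
Proof.
rewrite J2_series -bsum_opp; apply: eq_bsum => z; rewrite signV; congr (_ * t ^ _); lia.
Qed.

Let sgn2 (c d : K) z : c ^+ 2 = d -> c ^ (z *+ 2) = d ^ z.
Proof. by move=> <-; rewrite exprnP exprz_exp; congr (_ ^ _); lia. Qed.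

(** Triple product split by the parity of the index: as j^(2z) = (-1)^z, the even indices give
    [J6_16] and the odd ones j times [qJ2_16]. *)
Lemma theta_i_series j : j ^+ 2 = -1 -> small 0 j ->
  theta (t ^+ 8) (- j * t ^+ 2) * pinf (t ^+ 8) (t ^+ 8) = a + j * b.
Proof.
move=> jj sj; have bj := bounded_unit_i jj sj; have [j0 _ sj'] := bj.
have := theta_mono t0 ht (bounded_unitN bj) (isT : 2 <= 4.*2)%N isT => ->.
rewrite opprK bsum_even_odd; last first.
  by apply: (@vanish_exp K t _ _ 1 ht) => z; [exact: small0_exprz | have := sq_ge z; lia].
rewrite J6_series b_opp; congr (_ + _).
  apply: eq_bsum => z; rewrite (sgn2 _ jj); congr (_ * t ^ _); lia.
rewrite -bsumZ; last by apply: (@vanish_exp K t _ _ 1 ht) => z; [exact: small0_sign | have := sq_ge z; lia].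
apply: eq_bsum => z; rewrite expfzDr // (sgn2 _ jj) expr1z [_ * j]mulrC -mulrA.
by congr (_ * (_ * t ^ _)); lia.
Qed.

(** Triple product split by the index modulo 4, as z8^4 = -1: the classes 0, 1 give [J6_16] and the
    classes 2, 3 give [qJ2_16], with coefficients 1, z8, z8^2, -z8^3. *)
Lemma theta_eighth_series z8 : z8 ^+ 4 = -1 -> small 0 z8 ->
  theta (t ^+ 2) (- z8) * pinf (t ^+ 2) (t ^+ 2) = (1 + z8) * a + (z8 ^+ 2 - z8 ^+ 3) * b.
Proof.
move=> z4 sz; have z0 : z8 != 0.
  by apply/negP => /eqP h; move/eqP: z4; rewrite h expr0n /= eq_sym oppr_eq0 oner_eq0.
have zV : z8^-1 = - z8 ^+ 3.
  by apply: (mulfI z0); rewrite mulfV // mulrN -exprS z4 opprK.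
have sz' : small 0 z8^-1 by rewrite zV; apply: smallN; apply: smallX0.
have hc : bounded_unit (- z8) by apply: bounded_unitN.
have := theta_mono t0 ht hc (isT : 0 <= 1.*2)%N isT; rewrite mulr1 => ->.
have vv : vanish (fun z => z8 ^ z * t ^ (1%N%:Z * (z * (z - 1)) + 0%N%:Z * z)).
  by apply: (@vanish_exp K t _ _ 1 ht) => z; [exact: small0_exprz | have := sq_ge z; have := sq_ge (z - 1); lia].
have v2 c f : vanish f -> vanish (fun z => f (z *+ 2 + c) : K).
  by move=> h; apply: vanish_comp h; exists (absz c) => z; lia.
have zz (z : int) : z8 ^ (z *+ 2 *+ 2) = (-1) ^ z.
  by rewrite -z4 exprnP exprz_exp; congr (_ ^ _); lia.
rewrite opprK bsum_even_odd // bsum_even_odd; last by apply: eq_vanish (v2 0 _ vv) => z; rewrite addr0.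
rewrite [X in _ + X]bsum_even_odd; last exact: v2 vv.
have -> : bsum (fun z => z8 ^ (z *+ 2 *+ 2) * t ^ (1%N%:Z * (z *+ 2 *+ 2 * (z *+ 2 *+ 2 - 1)) + 0%N%:Z * (z *+ 2 *+ 2))) = a.
  by rewrite J6_series; apply: eq_bsum => z; rewrite zz; congr (_ * t ^ _); lia.
have zS (z : int) (n : nat) : z8 ^ (z *+ 2 *+ 2 + n%:Z) = z8 ^+ n * (-1) ^ z.
  by rewrite expfzDr // zz mulrC.
have -> : bsum (fun z => z8 ^ (z *+ 2 *+ 2 + 1) *
    t ^ (1%N%:Z * ((z *+ 2 *+ 2 + 1) * (z *+ 2 *+ 2 + 1 - 1)) + 0%N%:Z * (z *+ 2 *+ 2 + 1))) = z8 * a.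
  rewrite a_opp -bsumZ; last by apply: (@vanish_exp K t _ _ 1 ht) => z; [exact: small0_sign | have := sq_ge z; lia].
  by apply: eq_bsum => z; rewrite (zS z 1) expr1 -mulrA; congr (_ * (_ * t ^ _)); lia.
have e2 (z : int) : (z *+ 2 + 1) *+ 2 = z *+ 2 *+ 2 + 2%N%:Z by lia.
have -> : bsum (fun z => z8 ^ ((z *+ 2 + 1) *+ 2) *
    t ^ (1%N%:Z * ((z *+ 2 + 1) *+ 2 * ((z *+ 2 + 1) *+ 2 - 1)) + 0%N%:Z * ((z *+ 2 + 1) *+ 2))) = z8 ^+ 2 * b.
  rewrite b_opp -bsumZ; last by apply: (@vanish_exp K t _ _ 1 ht) => z; [exact: small0_sign | have := sq_ge z; lia].
  by apply: eq_bsum => z; rewrite e2 (zS z 2) -mulrA; congr (_ * (_ * t ^ _)); lia.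
have -> : bsum (fun z => z8 ^ ((z *+ 2 + 1) *+ 2 + 1) *
    t ^ (1%N%:Z * (((z *+ 2 + 1) *+ 2 + 1) * ((z *+ 2 + 1) *+ 2 + 1 - 1)) + 0%N%:Z * ((z *+ 2 + 1) *+ 2 + 1))) =
    - z8 ^+ 3 * b.
  rewrite J2_series -[in RHS]bsum_shift1 // -bsumZ; last by apply: vanish_comp vb; exists 1 => z; lia.
  apply: eq_bsum => z; have -> : (z *+ 2 + 1) *+ 2 + 1 = z *+ 2 *+ 2 + 3%N%:Z by lia.
  rewrite (zS z 3) [(-1) ^ (z + 1)]expfzDr ?oppr_eq0 ?oner_eq0 // expr1z mulrN1 -mulrA mulNr.
  by rewrite mulNr mulrN opprK; congr (_ * (_ * t ^ _)); lia.
ring.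
Qed.

Local Notation J4 := (pinf (t ^+ 8) (t ^+ 8)).
(** In q = t^2, [Psi] is 2 psi(q^8) in Ramanujan's notation and [c4] is J_{2,8}. *)
Let Psi := bsum (fun z => t ^ (8 * (z * (z + 1)))).
Let c4 := theta (t ^+ 16) (t ^+ 4) * pinf (t ^+ 16) (t ^+ 16).

Let phiE m : phi m.+1 = bsum (fun z => t ^ (m.+1%:Z * (z * z))).
Proof.
have -> : phi m.+1 = pinf ((t ^+ m.+1) ^+ 2) (- t ^+ m.+1) ^+ 2 * pinf ((t ^+ m.+1) ^+ 2) ((t ^+ m.+1) ^+ 2).
  by rewrite -exprM muln2.
by rewrite phi_series //; apply: eq_bsum => z; rewrite exprnP exprz_exp.
Qed.

Let v_exp (p : int -> int) k : (forall z, (absz z)%:Z <= p z + k%:Z) -> vanish (fun z => t ^ p z).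
Proof.
move=> hp; apply: (@eq_vanish K (fun z => 1 * t ^ p z)) => [z|]; first by rewrite mul1r.
by apply: (vanish_exp ht _ hp) => z; apply: small1.
Qed.

Lemma phi_dissection : phi 2 = phi 8 + t ^+ 2 * Psi.
Proof.
rewrite !phiE bsum_even_odd; last by apply: (@v_exp _ 0) => z; have := sq_ge z; lia.
congr (_ + _); first by apply: eq_bsum => z; congr (t ^ _); lia.
rewrite /Psi -bsumZ; last by apply: (@v_exp _ 1) => z; have := sq_ge z; have := sq_ge (z + 1); lia.
by apply: eq_bsum => z; rewrite exprnP -expfzDr //; congr (t ^ _); lia.
Qed.

(** [theta_series_sqr] at x = -j t^2. Only x^2 = -t^4 enters the two sums over k, which are
    reflections of each other and both equal [c4]. So [j] survives only in front of [Psi], and the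
    cases j and -j can be separated. *)
Lemma theta_i_sqr j : j ^+ 2 = -1 -> small 0 j ->
  (a + j * b) ^+ 2 = c4 * (phi 8 + j * t ^+ 2 * Psi).
Proof.
move=> jj sj; have bj := bounded_unit_i jj sj; have [j0 _ sj'] := bj.
rewrite -theta_i_series // (theta_mono t0 ht (bounded_unitN bj) (isT : 2 <= 4.*2)%N isT).
have cE : c4 = bsum (fun z => (-1) ^ z * t ^ (8 * (z * (z - 1)) + 4 * z)).
  by rewrite /c4; have := theta_mono t0 ht u1 (isT : 4 <= 8.*2)%N isT; rewrite mul1r.
pose x := - j * t ^+ 2; pose s := t ^+ 4.
have e z : (- - j) ^ z * t ^ (4%N%:Z * (z * (z - 1)) + 2%N%:Z * z) = (- x) ^ z * s ^ (z * (z - 1)).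
  rewrite /x mulNr !opprK expfzMl -mulrA; congr (_ * _).
  rewrite /s !exprnP !exprz_exp -expfzDr //; congr (t ^ _); lia.
have x2 z : x ^ (z *+ 2) = (-1) ^ z * t ^ (4 * z).
  have -> : z *+ 2 = 2 * z by lia.
  rewrite -exprz_exp -exprnP /x exprMn sqrrN jj expfzMl; congr (_ * _).
  by rewrite !exprnP !exprz_exp; congr (t ^ _); lia.
have e3 z : x ^ (z *+ 2) * s ^ (z *+ 2 * (z - 1)) = (-1) ^ z * t ^ (8 * (z * (z - 1)) + 4 * z).
  rewrite x2 -mulrA /s !exprnP !exprz_exp -expfzDr //; congr (_ * t ^ _); lia.
have e4 z : x ^ (z *+ 2) * s ^ (z *+ 2 * z) = (-1) ^ z * t ^ (8 * (z * z) + 4 * z).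
  rewrite x2 -mulrA /s !exprnP !exprz_exp -expfzDr //; congr (_ * t ^ _); lia.
have cE' : c4 = bsum (fun z => (-1) ^ z * t ^ (8 * (z * z) + 4 * z)).
  by rewrite cE -bsum_opp; apply: eq_bsum => z; rewrite signV; congr (_ * t ^ _); lia.
have v1 : vanish (fun z => x ^ (z *+ 2) * s ^ (z *+ 2 * (z - 1))).
  apply: eq_vanish (fun z => esym (e3 z)) _.
  by apply: (@vanish_exp K t _ _ 1 ht) => z; [exact: small0_sign | have := sq_ge z; lia].
have v2 : vanish (fun z => x ^ (z *+ 2) * s ^ (z *+ 2 * z)).
  apply: eq_vanish (fun z => esym (e4 z)) _.
  by apply: (@vanish_exp K t _ _ 1 ht) => z; [exact: small0_sign | have := sq_ge z; lia].
have v3 : vanish (fun z => (- x) ^ z * s ^ (z * (z - 1))).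
  apply: eq_vanish e _; rewrite opprK.
  by apply: (@vanish_exp K t _ _ 1 ht) => z; [exact: small0_exprz | have := sq_ge z; lia].
have v4 z : small 0 ((- x) ^ z * s ^ (z * (z - 1))).
  rewrite -e opprK; apply: smallMl; first exact: small0_exprz.
  have : 0 <= 4%N%:Z * (z * (z - 1)) + 2%N%:Z * z by have := sq_ge z; lia.
  by case: (_ + _) => // n _; apply: st0.
have x0 : x != 0 by rewrite mulf_neq0 ?oppr_eq0.
rewrite (eq_bsum e) (theta_series_sqr (tX0 4) x0 (st 3) v3 v4 v1 v2).
rewrite (eq_bsum e3) (eq_bsum e4) -cE -cE'.
have -> : bsum (fun l => s ^ (l *+ 2 * l)) = phi 8.
  by rewrite phiE; apply: eq_bsum => z; rewrite /s exprnP exprz_exp; congr (t ^ _); lia.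
have -> : bsum (fun l => s ^ (l *+ 2 * (l + 1))) = Psi.
  by apply: eq_bsum => z; rewrite /s exprnP exprz_exp; congr (t ^ _); lia.
by rewrite /x; ring.
Qed.

Variable j : K.
Hypotheses (two0 : 2 != 0 :> K) (jj : j ^+ 2 = -1) (sj : small 0 j).

Let c4_neq0 : c4 != 0.
Proof.
apply: mulf_neq0; last exact: pinf_neq0.
by apply: theta_neq0 => //; rewrite -[t ^+ 4]mul1r; apply: regular_mono.
Qed.

Let phi_neq0 m : phi m.+1 != 0.
Proof.
have s2 : small 1 (t ^+ m.+1.*2) by apply: st.
by apply: mulf_neq0; [apply: expf_neq0|]; apply: pinf_neq0 => //; apply: smallN.
Qed.

Let Nj : (- j) ^+ 2 = -1. Proof. by rewrite sqrrN. Qed.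
Let sNj : small 0 (- j). Proof. exact: smallN. Qed.
Let bj : bounded_unit j. Proof. exact: bounded_unit_i. Qed.

Let a2_sub_b2 : a ^+ 2 - b ^+ 2 = c4 * phi 8.
Proof.
have j0 : j != 0 by case: bj.
have h1 := theta_i_sqr jj sj; have h2 := theta_i_sqr Nj sNj.
apply: (mulfI two0).
have -> : 2 * (c4 * phi 8) = c4 * (phi 8 + j * t ^+ 2 * Psi) + c4 * (phi 8 + - j * t ^+ 2 * Psi) by ring.
rewrite -h1 -h2.
have -> : (a + j * b) ^+ 2 + (a + - j * b) ^+ 2 = 2 * (a ^+ 2 + j ^+ 2 * b ^+ 2) by ring.
rewrite jj; ring.
Qed.

Let two_ab : 2 * (a * b) = c4 * (t ^+ 2 * Psi).
Proof.
have j0 : j != 0 by case: bj.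
have h1 := theta_i_sqr jj sj; have h2 := theta_i_sqr Nj sNj.
apply: (mulfI two0); apply: (mulfI j0).
have -> : j * (2 * (c4 * (t ^+ 2 * Psi))) =
  c4 * (phi 8 + j * t ^+ 2 * Psi) - c4 * (phi 8 + - j * t ^+ 2 * Psi) by ring.
rewrite -h1 -h2; ring.
Qed.

Let theta_half_neg : theta (t ^+ 16) (- t ^+ 4) = pinf (t ^+ 8) (- t ^+ 4).
Proof.
have s4 : small 0 (- t ^+ 4) by apply: smallN.
rewrite (pinf_double s4 (st 7)) /theta -exprM; congr (_ * pinf _ _).
have := mono_div t0 (oner_neq0 K) (isT : 4 <= 16)%N; rewrite invr1 !mul1r invrN mulrN => ->.
by rewrite mulNr -exprD.
Qed.

Let theta_half : theta (t ^+ 16) (t ^+ 4) = pinf (t ^+ 8) (t ^+ 4).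
Proof.
rewrite (pinf_double (st0 4) (st 7)) /theta -exprM; congr (_ * pinf _ _).
have := mono_div t0 (oner_neq0 K) (isT : 4 <= 16)%N; rewrite invr1 !mul1r => ->.
by rewrite -exprD.
Qed.

Let J4E : J4 = pinf (t ^+ 8) (t ^+ 4) * pinf (t ^+ 8) (- t ^+ 4) * pinf (t ^+ 16) (t ^+ 16).
Proof.
by rewrite (pinf_sqr (st0 4) (st 7)) -!exprM /= {1}(pinf_double (st0 8) (st 7)) -exprM -exprD.
Qed.

(** Lets a theta function at c t^2 in a denominator be traded for one at -c t^2 in the numerator,
    and gives a^2 + b^2 as a product. *)
Let theta_i_pair c : c ^+ 2 = -1 -> small 0 c ->
  theta (t ^+ 8) (c * t ^+ 2) * theta (t ^+ 8) (- c * t ^+ 2) = pinf (t ^+ 8) (- t ^+ 4).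
Proof.
move=> cc sc; have [c0 _ sc'] := bounded_unit_i cc sc.
rewrite mulNr theta_sqr //; last 2 first.
- exact: small_mono.
- by rewrite mono_div //; apply: small_mono.
by rewrite (exprMn 2 c) cc -!exprM /= mulN1r theta_half_neg.
Qed.

Let a2_add_b2 : a ^+ 2 + b ^+ 2 = phi 4 * c4.
Proof.
have -> : a ^+ 2 + b ^+ 2 = (a + j * b) * (a + - j * b).
  have -> : (a + j * b) * (a + - j * b) = a ^+ 2 - j ^+ 2 * b ^+ 2 by ring.
  by rewrite jj; ring.
rewrite -!theta_i_series // opprK.
have -> : forall A B C : K, A * C * (B * C) = (B * A) * C ^+ 2 by move=> *; ring.
by rewrite theta_i_pair // /c4 theta_half /phi /= J4E; ring.
Qed.

(* [theta_i_sqr] at [j] and [-j] gives [a^2 - b^2] and [2ab]; the product of the two thetas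
   gives [a^2 + b^2]. *)
Lemma phi_sum : 2 * phi 8 * a = (phi 2 + phi 4) * (a - b) /\ 2 * phi 8 * b = (phi 2 - phi 4) * (a + b).
Proof.
have d0 : (a - b) * (a + b) != 0.
  have -> : (a - b) * (a + b) = a ^+ 2 - b ^+ 2 by ring.
  by rewrite a2_sub_b2 mulf_neq0.
(* Multiplied by a^2 - b^2 = c4 phi 8, both [phi 2] and [phi 4] become multiples of [phi 8]; their
   sum and difference contain a factor a + b or a - b, which is cancelled by [d0]. *)
have h2 : phi 2 * (a ^+ 2 - b ^+ 2) = phi 8 * (a ^+ 2 - b ^+ 2 + 2 * (a * b)).
  rewrite phi_dissection two_ab a2_sub_b2; ring.
have h4 : phi 4 * (a ^+ 2 - b ^+ 2) = phi 8 * (a ^+ 2 + b ^+ 2).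
  by rewrite a2_sub_b2 a2_add_b2; ring.
move: d0; rewrite mulf_eq0 negb_or => /andP [d1 d2]; split.
  apply: (mulIf d2).
  have -> : (phi 2 + phi 4) * (a - b) * (a + b) = phi 2 * (a ^+ 2 - b ^+ 2) + phi 4 * (a ^+ 2 - b ^+ 2) by ring.
  rewrite h2 h4; ring.
apply: (mulIf d1).
have -> : (phi 2 - phi 4) * (a + b) * (a - b) = phi 2 * (a ^+ 2 - b ^+ 2) - phi 4 * (a ^+ 2 - b ^+ 2) by ring.
rewrite h2 h4; ring.
Qed.

(** [dissection] in base t^8 with s = t^4. As (c t^2)^2 = -t^4, the new arguments t^4 and t^12 are
    free of [c], which remains in one coefficient and in the theta quotient. *)
Lemma gsum_at_i c : c ^+ 2 = -1 -> small 0 c ->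
  gsum (t ^+ 8) (c * t ^+ 2) =
  1 - gsum (t ^+ 32) (t ^+ 4) + (c * t ^+ 2)^-1 * (gsum (t ^+ 32) (t ^+ 12) - 1) +
  (a + c * b) * phi 8 / J4.
Proof.
move=> cc sc; have bc := bounded_unit_i cc sc; have [c0 _ sc'] := bc.
have e1 : c * t ^+ 2 * (c * t ^+ 4) = -1 * t ^+ 6.
  by rewrite -cc -[(6)%N]/(2 + 4)%N exprD; ring.
have e2 : c * t ^+ 2 * - (c * t ^+ 4) = 1 * t ^+ 6 by rewrite mulrN e1; ring.
have h1 : regular (t ^+ 8) (c * t ^+ 2 * (c * t ^+ 4)).
  by rewrite e1; apply: regular_mono => //; apply: bounded_unitN.
have h2 : regular (t ^+ 8) (c * t ^+ 2 * - (c * t ^+ 4)) by rewrite e2; apply: regular_mono.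
have h3 : regular (t ^+ 8) (c * t ^+ 2) by apply: regular_mono.
have h4 : small 0 (c * t ^+ 2 * (c * t ^+ 4)) by rewrite e1; apply: small_mono => //; apply: small0N1.
have h0 : t ^+ 8 = t ^+ 4 ^+ 2 by rewrite -exprM.
rewrite (dissection (tX0 4) (st 3) h0 cc sc two0 h3 h1 h2 h4).
have x2 : (c * t ^+ 2) ^+ 2 = - t ^+ 4 by rewrite exprMn cc mulN1r -exprM.
rewrite x2 mulrNN -exprD /= invrN mulrNN -!exprM /=.
have -> : t ^+ 8 / t ^+ 4 = t ^+ 4.
  by have := mono_div t0 (oner_neq0 K) (isT : 4 <= 8)%N; rewrite invr1 !mul1r.
congr (_ + _).
have -> : theta (t ^+ 16) (t ^+ 12) = pinf (t ^+ 8) (t ^+ 4).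
  have e12 : t ^+ 16 / t ^+ 12 = t ^+ 4.
    by have := mono_div t0 (oner_neq0 K) (isT : 12 <= 16)%N; rewrite invr1 !mul1r.
  by rewrite -theta_inv // e12 theta_half.
rewrite -theta_i_series // /phi /=.
have p1 : pinf (t ^+ 8) (t ^+ 4) != 0 by apply: pinf_neq0.
have p2 : pinf (t ^+ 8) (- t ^+ 4) != 0 by apply: pinf_neq0 => //; apply: smallN.
have p3 : pinf (t ^+ 16) (t ^+ 16) != 0 by apply: pinf_neq0.
have T0 := theta_neq0 h3 (st 7).
have := theta_i_pair cc sc; rewrite J4E.
move: (theta (t ^+ 8) (- c * _)) (theta (t ^+ 8) (c * _)) T0 => T' T T0 e.
by rewrite -e in p2 *; move: p2; rewrite mulf_eq0 negb_or => /andP [_ T'0]; field; rewrite p3 T0 T'0 p1.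
Qed.

End RankAtEighthRoot.

(** Since z^-1 = -z^3, [w] is z + z^-1: the right side depends on z only through it, in accordance
    with the invariance of the rank generating function under z -> 1/z. *)
Theorem rank_at_eighth_root (K : vfield) (t z : K) :
  t != 0 -> small 1 t -> 2 != 0 :> K -> z ^+ 4 = -1 -> small 0 z ->
  let w := z - z ^+ 3 in
  (1 - z) * gsum (t ^+ 2) z =
  (2 - w) * gsum (t ^+ 32) (t ^+ 4) + w * ((gsum (t ^+ 32) (t ^+ 12) - 1) / t ^+ 2) +
  ((w - 1) * phi t 4 * J6_16 t + phi t 4 * qJ2_16 t) / pinf (t ^+ 8) (t ^+ 8).
Proof.
move=> t0 ht two0 z4 sz w.
have z0 : z != 0.
  by apply/negP => /eqP h; move/eqP: z4; rewrite h expr0n /= eq_sym oppr_eq0 oner_eq0.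
have zV : z^-1 = - z ^+ 3 by apply: (mulfI z0); rewrite mulfV // mulrN -exprS z4 opprK.
pose j := z ^+ 2.
have jj : j ^+ 2 = -1 by rewrite -exprM.
have sj : small 0 j by apply: smallX0.
have bz : bounded_unit z by split=> //; rewrite zV; apply: smallN; apply: smallX0.
have bj := bounded_unit_i jj sj; have [j0 _ sj'] := bj.
have jV : j^-1 = - j by apply: (mulfI j0); rewrite mulfV // mulrN -expr2 jj opprK.
have neqN1 : (-1 : K) != 1 by rewrite eq_sym -subr_eq0 opprK.
have z1 : z != 1 by apply: contraNneq neqN1 => h; rewrite -z4 h expr1n.
have j1 : 1 - j != 0.
  by rewrite subr_eq0 eq_sym; apply: contraNneq neqN1 => h; rewrite -jj h expr1n.
have tX0 m : t ^+ m != 0 by apply: expf_neq0.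
have st m : small 1 (t ^+ m.+1) by apply: small_pow.
have st0 m : small 0 (t ^+ m) by apply: small_pow.
have h1 : regular (t ^+ 2) z.
  by case: bz => ? ? ?; split=> //; [apply: smallMl|apply: smallMr].
have hzj : z * (j * t) = (z * j) * t ^+ 1 by rewrite mulrA.
have hzj' : z * - (j * t) = - (z * j) * t ^+ 1 by rewrite mulrN mulrA mulNr.
have bzj : bounded_unit (z * j) by apply: bounded_unitM.
have h2 : regular (t ^+ 2) (z * (j * t)) by rewrite hzj; apply: regular_mono.
have h3 : regular (t ^+ 2) (z * - (j * t)).
  by rewrite hzj'; apply: regular_mono => //; apply: bounded_unitN.
have h4 : small 0 (z * (j * t)) by rewrite hzj; apply: small_mono => //; case: bzj.
rewrite (dissection t0 ht (erefl _) jj sj two0 h1 h2 h3 h4) -/j.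
rewrite -!exprM /=.
have -> : - t ^+ 2 / j = j * t ^+ 2 by rewrite jV mulrNN mulrC.
have -> : - t ^+ 2 * j = - j * t ^+ 2 by rewrite mulNr mulrC -mulNr.
have Nj : (- j) ^+ 2 = -1 by rewrite sqrrN.
rewrite (gsum_at_i t0 ht two0 jj sj) (gsum_at_i t0 ht two0 Nj (smallN sj)).
set a := J6_16 t; set b := qJ2_16 t; set J4 := pinf (t ^+ 8) (t ^+ 8).
set P1 := _ / (theta _ _ * _).
have z5 : z ^+ 5 = - z by rewrite exprS z4 mulrN1.
(* The denominator theta(z) is traded for a numerator theta(-z), expanded by [theta_eighth_series]:
   their product is the theta function in base t^4 at z^2 = j, that is (1 - j) (-t^8;t^8)_oo. *)
have hP1 : (1 - z) * P1 = phi t 2 * (a + (w - 1) * b) / J4.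
  pose S := pinf (t ^+ 4) (- t ^+ 2) ^+ 2.
  pose e4 := pinf (t ^+ 4) (t ^+ 4).
  pose m1 := pinf (t ^+ 8) (- t ^+ 4); pose n1 := pinf (t ^+ 8) (- t ^+ 8).
  have m10 : m1 != 0 by apply: pinf_neq0 => //; apply: smallN.
  have n10 : n1 != 0 by apply: pinf_neq0 => //; apply: smallN.
  have e40 : e4 != 0 by apply: pinf_neq0.
  have s4 : small 0 (- t ^+ 4) by apply: smallN.
  have hJ4 : J4 = e4 * (m1 * n1).
    have -> : m1 * n1 = pinf (t ^+ 4) (- t ^+ 4).
      by rewrite (pinf_double s4 (st 3)) -exprM mulNr -exprD.
    by rewrite pinf_sqr // -!exprM.
  have hth : theta (t ^+ 4) (- j * t ^+ 2) = m1.
    rewrite /theta mono_div ?oppr_eq0 // invrN jV opprK mulNr mulrC pinf_sqr //; last exact: small_mono.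
    by rewrite (exprMn 2 j) jj -!exprM mulN1r.
  have hzz : theta (t ^+ 2) z * theta (t ^+ 2) (- z) = (1 - j) * n1.
    have [_ _ hz1 hz2] := h1.
    have sjt : small 0 (j * t ^+ 4) by apply: smallMl.
    rewrite theta_sqr // -/j /theta -exprM /= (pinfS sjt (st 3)).
    have -> : t ^+ 4 / j = - (j * t ^+ 4) by rewrite jV mulrN mulrC.
    rewrite -mulrA pinf_sqr //.
    by rewrite (exprMn 2 j) jj -!exprM mulN1r.
  have := theta_eighth_series t0 ht z4 sz; rewrite -/a -/b -/j.
  have T0 := theta_neq0 h1 (st 1).
  rewrite /P1 hth hJ4 /phi /= -/S -/e4; move: hzz T0; move: (theta _ z) (theta _ (- z)) => T T' hT T0.
  move: (pinf (t ^+ 2) _) => p hp.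
  have -> : (1 - z) * (p * S / (T * m1)) = (1 - z) * (T' * p) * S / ((T * T') * m1) * 1.
    have T'0 : T' != 0.
      by apply/eqP => h; move/eqP: hT; rewrite h mulr0 eq_sym mulf_eq0 (negPf j1) (negPf n10).
    by field; rewrite m10 T0 T'0.
  rewrite hT hp.
  have -> : (1 - z) * ((1 + z) * a + (j - z ^+ 3) * b) = (1 - j) * (a + (w - 1) * b).
    transitivity ((1 - j) * a + (j - z ^+ 3 - z * j + z ^+ 4) * b); first by rewrite /j; ring.
    have -> : (1 - j) * (a + (w - 1) * b) = (1 - j) * a + (z - z ^+ 3 - 1 - z * j + z ^+ 5 + j) * b.
      by rewrite /w /j; ring.
    by rewrite z4 z5; ring.
  by field; rewrite j1 n10 m10 e40.
have c1 : (1 - z) * (1 + z ^+ 3) = 2 - w.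
  have -> : (1 - z) * (1 + z ^+ 3) = 1 - z + z ^+ 3 - z ^+ 4 by ring.
  by rewrite z4 /w; ring.
have c2 : (1 - z) * (j - z ^+ 3 * j) = w.
  have -> : (1 - z) * (j - z ^+ 3 * j) = z ^+ 2 - z ^+ 3 - z ^+ 5 + z * z ^+ 5 by rewrite /j; ring.
  by rewrite z5 /w; ring.
have [f1 f2] := phi_sum t0 ht two0 jj sj; rewrite -/a -/b in f1 f2.
have J40 : J4 != 0 by apply: pinf_neq0.
have eA : (j * t ^+ 2)^-1 = - j * t ^- 2 by rewrite (invfM j) jV.
have eB : (- j * t ^+ 2)^-1 = j * t ^- 2 by rewrite (invfM (- j)) invrN jV opprK.
rewrite eA eB zV.
move: (gsum _ _) (gsum _ _) hP1 => g6 g2 hP1.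
rewrite mulrDr hP1.
set T := t ^- 2; set i4 := J4^-1.
have -> : 1 - (1 - g2 + - j * T * (g6 - 1) + (a + j * b) * phi t 8 * i4) +
   - z ^+ 3 * (1 - g2 + j * T * (g6 - 1) + (a + - j * b) * phi t 8 * i4 - 1) =
   (1 + z ^+ 3) * (g2 - a * phi t 8 * i4) + (j - z ^+ 3 * j) * (T * (g6 - 1) - b * phi t 8 * i4) by ring.
rewrite mulrDr (mulrA (1 - z) (1 + _)) (mulrA (1 - z) (j - _)) c1 c2.
(* With [phi t 8] eliminated by [phi_sum], the terms in [phi t 2] cancel against the theta quotient
   of [hP1], and only [phi t 4] is left. *)
have -> : a * phi t 8 = (phi t 2 + phi t 4) * (a - b) / 2.
  by apply: (mulfI two0); rewrite [RHS]mulrC divfK // -f1; ring.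
have -> : b * phi t 8 = (phi t 2 - phi t 4) * (a + b) / 2.
  by apply: (mulfI two0); rewrite [RHS]mulrC divfK // -f2; ring.
by rewrite /i4 /T; field; rewrite J40 two0 t0.
Qed.

(** * The rank generating function *)

Definition rank_sum (K : vfield) (Q z : K) :=
  Lim (fun N => \sum_(n < N.+1) Q ^+ (n * n) / (poch Q (z * Q) n * poch Q (Q / z) n)).

Section RogersFine.
Variable K : vfield.
Variable Q : K.
Hypothesis hQ : small 1 Q.
Implicit Types (b t z : K).

Let sQ : small 0 Q. Proof. exact: small_weak hQ. Qed.

(** Fine's function F(a,b;t), the sum of (aQ)_k t^k / (bQ)_k, at a = 0. *)
Definition fine b t := Lim (fun M => \sum_(k < M) t ^+ k / poch Q (b * Q) k).

Lemma fine_step b t M : small 1 (b * Q) ->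
  (1 - t) * \sum_(k < M.+1) t ^+ k / poch Q (b * Q) k =
  1 + b * t * Q / (1 - b * Q) * (\sum_(k < M) (t * Q) ^+ k / poch Q (b * Q * Q) k) -
  t ^+ M.+1 / poch Q (b * Q) M.
Proof.
move=> hb; have p0 k : poch Q (b * Q) k != 0 by apply: poch_neq0.
have b1 : 1 - b * Q != 0 by apply: small1_neq1.
elim: M => [|M IH]; first by rewrite big_ord1 big_ord0 !poch0; field; rewrite oner_neq0 b1.
rewrite big_ord_recr mulrDr IH big_ord_recr mulrDr /=.
have e : b * t * Q / (1 - b * Q) * ((t * Q) ^+ M / poch Q (b * Q * Q) M) =
   t ^+ M.+1 * (b * Q * Q ^+ M) / poch Q (b * Q) M.+1.
  rewrite pochSl exprMn exprS; have q0 : poch Q (b * Q * Q) M != 0.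
    by apply: poch_neq0 => //; apply: smallMr.
  by field; rewrite q0 b1.
rewrite e; have := p0 M.+1; rewrite pochS mulf_eq0 negb_or => /andP [h1 h2].
by rewrite [t ^+ M.+2]exprS; field; rewrite h1 h2.
Qed.

Lemma fine_lim b t : small 1 (b * Q) -> small 1 t ->
  lim (fun M => \sum_(k < M) t ^+ k / poch Q (b * Q) k) (fine b t).
Proof.
move=> hb ht; apply: (@Lim_series K (fun k => t ^+ k / poch Q (b * Q) k)) => n; exists n => m hm.
by apply: smallMr; [apply: small_le hm (smallX1 m ht) | apply: pochV_small].
Qed.

Lemma fine_small b t : small 1 (b * Q) -> small 1 t -> small 0 (fine b t).
Proof.
move=> hb ht; apply: (lim_small (fine_lim hb ht)); exists 0 => m _.
apply: small_sum => k _; apply: smallMl; last exact: pochV_small.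
by apply: smallX0; apply: small_weak ht.
Qed.

Lemma fine_functional b t : small 1 (b * Q) -> small 1 t ->
  (1 - t) * fine b t = 1 + b * t * Q / (1 - b * Q) * fine (b * Q) (t * Q).
Proof.
move=> hb ht; have hb' : small 1 (b * Q * Q) by apply: smallMr.
have ht' : small 1 (t * Q) by apply: smallMr.
have L : lim (fun M => (1 - t) * \sum_(k < M.+1) t ^+ k / poch Q (b * Q) k) ((1 - t) * fine b t).
  by apply: limZ; apply: (@lim_sub K _ _ S) (fine_lim hb ht).
apply: lim_uniq L _; apply: (lim_ext (fun M => esym (fine_step t M hb))).
rewrite -[X in lim _ X]subr0; apply: limB.
  by apply: limD; [apply: lim_cst | apply: limZ; apply: fine_lim].
apply: lim_small1 => m; apply: smallMr; last exact: pochV_small.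
by apply: small_le (smallX1 m.+1 ht).
Qed.

Variable z : K.
Hypothesis hz : bounded_unit z.

Let z0 : z != 0. Proof. by case: hz. Qed.
Let szQ : small 1 (z * Q). Proof. by case: hz => ? ? ?; apply: smallMl. Qed.
Let sQz : small 1 (Q / z). Proof. by case: hz => ? ? ?; apply: smallMr. Qed.

Let T n := Q ^+ (n * n) / (poch Q (z * Q) n * poch Q (Q / z) n).

Let T_small n : small n (T n).
Proof.
rewrite /T invfM; apply: smallMr; first by apply: small_le (smallX1 (n * n) hQ); nia.
by apply: smallMl; apply: pochV_small.
Qed.

Lemma rank_sum_lim : lim (fun N => \sum_(n < N.+1) T n) (rank_sum Q z).
Proof.
apply: Lim_cauchy => n; exists n => m hm.
by rewrite big_ord_recr /= addrAC subrr add0r; apply: small_le (T_small m.+1); lia.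
Qed.

(** (z)_(n+1) = (1 - z) (zQ)_n moves the factor 1 - z across the sum; at z = 1 it vanishes, hence
    the second alternative. *)
Lemma rank_sum_gsum : (1 - z) * gsum Q z = rank_sum Q z \/ z = 1.
Proof.
have [->|z1] := eqVneq z 1; [by right | left].
apply/esym; apply: lim_uniq rank_sum_lim _.
have z1' : 1 - z != 0 by rewrite subr_eq0 eq_sym.
apply: (@lim_ext K (fun N => (1 - z) *
   \sum_(n < N.+1) Q ^+ (n * n) / (poch Q z n.+1 * poch Q (Q / z) n))).
  move=> N; rewrite mulr_sumr; apply: eq_bigr => n _; rewrite /T pochSl.
  have h1 : poch Q (z * Q) n != 0 by apply: poch_neq0.
  have h2 : poch Q (Q / z) n != 0 by apply: poch_neq0.
  by field; rewrite h1 h2 z1'.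
apply: limZ.
have e N : \sum_(n < N.+1) Q ^+ (n * n) / (poch Q z n.+1 * poch Q (Q / z) n) =
   (1 - z)^-1 * \sum_(n < N.+1) T n.
  rewrite mulr_sumr; apply: eq_bigr => n _; rewrite /T pochSl !invfM; ring.
rewrite /gsum (eq_Lim e) (LimE (limZ _ rank_sum_lim)).
by apply: (lim_ext (fun N => esym (e N))); apply: limZ; apply: rank_sum_lim.
Qed.

(* Telescoping: [E j = T (j + 1) + E (j + 1)], by the functional equation of [fine]. *)
Lemma rogers_fine :
  lim (fun N => 1 + \sum_(k < N) z ^+ k * Q ^+ k.+1 / poch Q (Q / z) k.+1) (rank_sum Q z).
Proof.
pose H j := fine (Q ^+ j.+1 / z) (z * Q ^+ j.+1).
pose E j := Q ^+ (j.+1 * j.+1) / (poch Q (Q / z) j.+1 * poch Q (z * Q) j) * H j.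
have sb j : small 1 (Q ^+ j.+1 / z * Q).
  by apply: smallMr => //; rewrite exprS mulrAC; apply: smallMr => //; apply: smallX0.
have st j : small 1 (z * Q ^+ j.+1) by rewrite exprS mulrA; apply: smallMr => //; apply: smallX0.
have p0 x n : small 1 x -> poch Q x n != 0 by move=> hx; apply: poch_neq0.
have ES j : E j = T j.+1 + E j.+1.
  have e : (1 - z * Q ^+ j.+1) * H j = 1 + Q ^+ (j + j + 3) / (1 - Q ^+ j.+2 / z) * H j.+1.
    rewrite /H fine_functional //.
    have -> : Q ^+ j.+1 / z * Q = Q ^+ j.+2 / z by rewrite [Q ^+ j.+2]exprSr; ring.
    have -> : z * Q ^+ j.+1 * Q = z * Q ^+ j.+2 by rewrite [Q ^+ j.+2]exprSr; ring.
    congr (1 + _ / _ * _).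
    have -> : (j + j + 3 = j.+1 + j.+1 + 1)%N by lia.
    by rewrite !exprD expr1; field.
  have n1 : 1 - z * Q ^+ j.+1 != 0 by apply: small1_neq1.
  have n2 : 1 - Q ^+ j.+2 / z != 0.
    by apply: small1_neq1; have := sb j; rewrite mulrAC -exprSr.
  have eH : H j = (1 + Q ^+ (j + j + 3) / (1 - Q ^+ j.+2 / z) * H j.+1) / (1 - z * Q ^+ j.+1).
    by rewrite -e mulrC mulKf.
  rewrite /E eH /T.
  have a1 : poch Q (z * Q) j.+1 = poch Q (z * Q) j * (1 - z * Q ^+ j.+1).
    by rewrite pochS -mulrA -exprS.
  have a2 : poch Q (Q / z) j.+2 = poch Q (Q / z) j.+1 * (1 - Q ^+ j.+2 / z).
    by rewrite pochS [Q ^+ j.+2]exprS mulrAC.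
  have -> : (j.+2 * j.+2 = j.+1 * j.+1 + (j + j + 3))%N by lia.
  rewrite a1 a2 (exprD Q (j.+1 * j.+1)).
  have := p0 _ j szQ; have := p0 _ j.+1 sQz; move: n1 n2.
  move: (poch Q (z * Q) j) (poch Q (Q / z) j.+1) (H j.+1) (Q ^+ (j + j + 3)) (Q ^+ (j.+1 * j.+1)).
  move: (z * Q ^+ j.+1) (Q ^+ j.+2 / z) => c d A B C u v n1 n2 A0 B0.
  by field; rewrite A0 B0 n1 n2.
have EN N : E 0 = \sum_(n < N) T n.+1 + E N.
  elim: N => [|N IH]; first by rewrite big_ord0 add0r.
  by rewrite IH ES big_ord_recr /= addrA.
have E_small N : small N (E N).
  apply: smallMr; last exact: fine_small.
  apply: smallMr; first by apply: small_le (smallX1 (N.+1 * N.+1) hQ); nia.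
  by rewrite invfM; apply: smallMl; apply: pochV_small.
have L1 : lim (fun N => 1 + \sum_(n < N) T n.+1) (1 + E 0).
  have -> : E 0 = E 0 - 0 by rewrite subr0.
  apply: limD; first exact: lim_cst.
  apply: (@lim_ext K (fun N => E 0 - E N)); first by move=> N; rewrite (EN N) addrK.
  by apply: limB; [exact: lim_cst | exact: lim_small1].
have -> : rank_sum Q z = 1 + E 0.
  apply: lim_uniq rank_sum_lim _; apply: lim_ext _ L1 => N.
  by rewrite big_ord_recl /T /= mul0n expr0 !poch0 mulr1 divr1.
apply: limD; first exact: lim_cst.
(* The initial remainder is itself the other series: [H 0] is Fine's function at b = Q / z, t = z
   Q. *)
have -> : E 0 = Q / (1 - Q / z) * H 0 by rewrite /E poch0 pochS poch0 mul1r mulr1 expr0 mulr1 expr1.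
apply: (@lim_ext K (fun N => Q / (1 - Q / z) * \sum_(k < N) (z * Q ^+ 1) ^+ k / poch Q (Q ^+ 1 / z * Q) k)).
  move=> N; rewrite mulr_sumr; apply: eq_bigr => k _.
  rewrite pochSl !expr1 exprMn exprSr !invfM; ring.
by apply: limZ; apply: fine_lim.
Qed.

End RogersFine.

Lemma rank_sumV (K : vfield) (Q z : K) : rank_sum Q z^-1 = rank_sum Q z.
Proof.
apply: eq_Lim => N; apply: eq_bigr => n _.
by rewrite invrK [z^-1 * Q]mulrC [Q * z]mulrC [X in _ / X]mulrC.
Qed.

(** * Laurent series *)

Record fps (F : fieldType) := Fps { fcoef : nat -> F }.

Section FormalPowerSeries.
Variable F : fieldType.
Local Notation fps := (fps F).
Implicit Types f g h : fps.

HB.instance Definition _ := gen_eqMixin fps.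
HB.instance Definition _ := gen_choiceMixin fps.

Lemma fpsP f g : (forall n, fcoef f n = fcoef g n) -> f = g.
Proof. by case: f g => f [g] /= h; congr Fps; apply: funext. Qed.

Definition fps_add f g := Fps (fun n => fcoef f n + fcoef g n).
Definition fps_opp f := Fps (fun n => - fcoef f n).
Definition fps_cst c : fps := Fps (fun n => if n == 0%N then c else 0).

Lemma fps_addA : associative fps_add.
Proof. by move=> f g h; apply: fpsP => n /=; rewrite addrA. Qed.
Lemma fps_addC : commutative fps_add.
Proof. by move=> f g; apply: fpsP => n /=; rewrite addrC. Qed.
Lemma fps_add0 : left_id (fps_cst 0) fps_add.
Proof. by move=> f; apply: fpsP => n /=; rewrite if_same add0r. Qed.
Lemma fps_addN : left_inverse (fps_cst 0) fps_opp fps_add.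
Proof. by move=> f; apply: fpsP => n /=; rewrite if_same addNr. Qed.
HB.instance Definition _ := GRing.isZmodule.Build fps fps_addA fps_addC fps_add0 fps_addN.

Definition fps_mul f g := Fps (fun n => \sum_(i < n.+1) fcoef f i * fcoef g (n - i)).
Definition fps_trunc N f : {poly F} := \poly_(i < N.+1) fcoef f i.

(** A coefficient of a product involves finitely many coefficients of the factors, so commutativity
    and associativity are inherited from polynomials by truncation. *)
Lemma fps_mul_trunc f g N n : (n <= N)%N ->
  fcoef (fps_mul f g) n = (fps_trunc N f * fps_trunc N g)`_n.
Proof.
move=> h; rewrite coefM /=; apply: eq_bigr => i _.
rewrite !coef_poly; have hi := ltn_ord i.
by rewrite !ifT //; lia.
Qed.

Lemma fps_mul_truncl f (p : {poly F}) g N n : (n <= N)%N ->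
  (forall i, (i <= n)%N -> fcoef g i = p`_i) ->
  fcoef (fps_mul f g) n = (fps_trunc N f * p)`_n.
Proof.
move=> h hp; rewrite coefM /=; apply: eq_bigr => i _.
have hi := ltn_ord i; rewrite coef_poly ifT; last by lia.
by rewrite hp //; lia.
Qed.

Lemma fps_mulC : commutative fps_mul.
Proof. by move=> f g; apply: fpsP => n; rewrite !(@fps_mul_trunc _ _ n) // mulrC. Qed.

Lemma fps_mulA : associative fps_mul.
Proof.
move=> f g h; apply: fpsP => n.
rewrite (@fps_mul_truncl f (fps_trunc n g * fps_trunc n h) _ n) //; last first.
  by move=> i hi; rewrite (@fps_mul_trunc _ _ n).
rewrite fps_mulC (@fps_mul_truncl h (fps_trunc n f * fps_trunc n g) _ n) //; last first.
  by move=> i hi; rewrite (@fps_mul_trunc _ _ n).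
by rewrite (mulrC (fps_trunc n h)) mulrA.
Qed.

Lemma fps_mul1 : left_id (fps_cst 1) fps_mul.
Proof.
move=> f; apply: fpsP => n; rewrite /= big_ord_recl /= mul1r subn0 big1 ?addr0 // => i _.
by rewrite mul0r.
Qed.

Lemma fps_mulDl : left_distributive fps_mul fps_add.
Proof.
move=> f g h; apply: fpsP => n /=; rewrite -big_split; apply: eq_bigr => i _ /=.
by rewrite mulrDl.
Qed.

Lemma fps_1neq0 : fps_cst 1 != 0 :> fps.
Proof.
by apply/eqP => /(congr1 (fun f : fps => fcoef f 0)) /= /eqP; rewrite oner_eq0.
Qed.

HB.instance Definition _ :=
  GRing.Zmodule_isComNzRing.Build fps fps_mulA fps_mulC fps_mul1 fps_mulDl fps_1neq0.

Lemma fcoef0 n : fcoef (0 : fps) n = 0. Proof. exact: if_same. Qed.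
Lemma fcoefD f g n : fcoef (f + g) n = fcoef f n + fcoef g n. Proof. by []. Qed.
Lemma fcoefN f n : fcoef (- f) n = - fcoef f n. Proof. by []. Qed.
Lemma fcoefB f g n : fcoef (f - g) n = fcoef f n - fcoef g n. Proof. by []. Qed.
Lemma fcoef1 n : fcoef (1 : fps) n = (n == 0%N)%:R. Proof. by rewrite /=; case: eqP. Qed.
Lemma fcoefM f g n : fcoef (f * g) n = \sum_(i < n.+1) fcoef f i * fcoef g (n - i).
Proof. by []. Qed.
Lemma fcoefM0 f g : fcoef (f * g) 0 = fcoef f 0 * fcoef g 0.
Proof. by rewrite fcoefM big_ord1. Qed.

Lemma fcoef_sum (I : Type) (r : seq I) (P : pred I) (G : I -> fps) n :
  fcoef (\sum_(i <- r | P i) G i) n = \sum_(i <- r | P i) fcoef (G i) n.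
Proof.
by elim/big_rec2: _ => [|i x y _ <-]; [exact: fcoef0 | rewrite fcoefD].
Qed.

Definition fps_X : fps := Fps (fun n => (n == 1%N)%:R).

Lemma fcoef_XM f n : fcoef (fps_X * f) n = if n is m.+1 then fcoef f m else 0.
Proof.
case: n => [|n]; first by rewrite fcoefM0 mul0r.
rewrite fcoefM big_ord_recl mul0r add0r big_ord_recl /= mul1r subSS subn0 big1 ?addr0 // => i _.
by rewrite mul0r.
Qed.

Lemma fcoef_XnM f k n : fcoef (fps_X ^+ k * f) n = if (k <= n)%N then fcoef f (n - k) else 0.
Proof.
elim: k n => [|k IH] n; first by rewrite expr0 mul1r subn0.
by rewrite exprS -mulrA fcoef_XM; case: n => [|n] //; rewrite IH.
Qed.

Lemma fps_shift f n : (forall k, (k < n)%N -> fcoef f k = 0) ->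
  f = fps_X ^+ n * Fps (fun k => fcoef f (k + n)).
Proof.
move=> h; apply: fpsP => k; rewrite fcoef_XnM /=.
by case: leqP => hk; [rewrite subnK | apply: h].
Qed.

(** The recursion for the inverse refers to all earlier coefficients, so the list of the first [n]
    of them is built at once. *)
Fixpoint fps_inv_seq f n : seq F :=
  if n is m.+1 then
    let s := fps_inv_seq f m in
    rcons s ((fcoef f 0)^-1 * ((m == 0%N)%:R - \sum_(i < m) s`_i * fcoef f (m - i)))
  else [::].

Lemma fps_unit f : fcoef f 0 != 0 -> exists g, g * f = 1.
Proof.
move=> f0; have hs n : size (fps_inv_seq f n) = n by elim: n => //= n IH; rewrite size_rcons IH.
have step m i : (i < m)%N -> (fps_inv_seq f m.+1)`_i = (fps_inv_seq f m)`_i.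
  by move=> h; rewrite /= nth_rcons hs h.
have hn i k : (fps_inv_seq f (i + k).+1)`_i = (fps_inv_seq f i.+1)`_i.
  elim: k => [|k IH]; first by rewrite addn0.
  by rewrite addnS step ?IH //; lia.
exists (Fps (fun n => (fps_inv_seq f n.+1)`_n)); apply: fpsP => n.
rewrite fcoefM fcoef1 big_ord_recr subnn [fcoef _ n]/= nth_rcons hs ltnn eqxx.
rewrite [X in _ + X = _]mulrC mulrA mulfV // mul1r addrC.
rewrite [X in _ + X](eq_bigr (fun i : 'I_n => (fps_inv_seq f n)`_i * fcoef f (n - i))) ?subrK // => i _.
congr (_ * _); have := hn i (n - i.+1)%N.
by have -> : (i + (n - i.+1)).+1 = n by have := ltn_ord i; lia.
Qed.

Lemma fps_decomp f : f != 0 -> exists k u, f = fps_X ^+ k * u /\ fcoef u 0 != 0.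
Proof.
move=> f0; have [n hn] : exists n, fcoef f n != 0.
  apply: contrapT => h; case/eqP: f0; apply: fpsP => n; rewrite fcoef0.
  by apply/eqP; apply: contrapT => /negP hn; apply: h; exists n.
case: (ex_minnP (ex_intro _ n hn : exists n, fcoef f n != 0)) => k hk hmin.
exists k, (Fps (fun m => fcoef f (m + k))); split; last by rewrite /= add0n.
by apply: fps_shift => m hm; apply/eqP; apply: contraLR hm => /hmin; rewrite leqNgt.
Qed.

Definition fps_is_unit : {pred fps} := fun f => `[< exists g, g * f = 1 >].
(** A classical choice; outside the units the value is [f], the convention for inverses in a unit
    ring. *)
Definition fps_inv f : fps := if pselect (exists g, g * f = 1) is left h then sval (cid h) else f.

Lemma fps_mulVx : {in fps_is_unit, left_inverse 1 fps_inv *%R}.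
Proof.
move=> f /asboolP h; rewrite /fps_inv; case: pselect => // h'.
exact: svalP (cid h').
Qed.
Lemma fps_unitPl f g : g * f = 1 -> fps_is_unit f.
Proof. by move=> h; apply/asboolP; exists g. Qed.
Lemma fps_invr_out : {in [predC fps_is_unit], fps_inv =1 id}.
Proof.
move=> f /negP h; rewrite /fps_inv; case: pselect => // h'.
by case: h; apply/asboolP.
Qed.

HB.instance Definition _ :=
  GRing.ComNzRing_hasMulInverse.Build fps fps_mulVx fps_unitPl fps_invr_out.

Lemma fps_integral : GRing.integral_domain_axiom fps.
Proof.
move=> f g h; apply: contraT; rewrite negb_or => /andP [] /fps_decomp [k [u [ef u0]]].
move=> /fps_decomp [l [v [eg v0]]]; move/(congr1 (fun f : fps => fcoef f (k + l))): h.
have -> : f * g = fps_X ^+ (k + l) * (u * v) by rewrite ef eg exprD; ring.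
rewrite fcoef_XnM leqnn subnn fcoefM0 fcoef0 => /eqP.
by rewrite mulf_eq0 (negPf u0) (negPf v0).
Qed.

HB.instance Definition _ := GRing.ComUnitRing_isIntegral.Build fps fps_integral.

End FormalPowerSeries.

Section Fraction.
Variable R : idomainType.
Local Notation "x %:F" := (@FracField.tofrac R x).

Lemma frac_numden (x : {fraction R}) : exists a b, b != 0 /\ x = a%:F / b%:F.
Proof.
elim/quotW: x => x; exists (frac x).1, (frac x).2; have hd := denom_ratioP x; split=> //.
have hd' : (frac x).2%:F != 0 by rewrite tofrac_eq0.
apply: (mulIf hd'); rewrite mulfVK //.
rewrite -[LHS]/(FracField.mul _ _) !piE; apply/eqmodP => /=.
have n1 : (1 : R) != 0 by rewrite oner_neq0.
by rewrite FracField.equivfE /FracField.mulf !numden_Ratio ?mulf_neq0 // !mulr1 mulrC.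
Qed.

End Fraction.

Section LaurentSeries.
Variable F : fieldType.
Local Notation R := (fps F).
Local Notation X := (fps_X F).
Local Notation "x %:F" := (@FracField.tofrac R x).
Implicit Types (x y : {fraction R}) (f g : R).

Definition lsmall n x := exists f, x = (X ^+ n * f)%:F.

Lemma fps_X_neq0 : X != 0.
Proof.
by apply/eqP => /(congr1 (fun f => fcoef f 1)) /= /eqP; rewrite oner_eq0.
Qed.

Lemma lsmallB n x y : lsmall n x -> lsmall n y -> lsmall n (x - y).
Proof. by move=> [f ->] [g ->]; exists (f - g); rewrite mulrBr rmorphB. Qed.

Lemma lsmallM m n x y : lsmall m x -> lsmall n y -> lsmall (m + n) (x * y).
Proof.
by move=> [f ->] [g ->]; exists (f * g); rewrite -rmorphM; congr (_ %:F); rewrite exprD; ring.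
Qed.

Lemma lsmall_le m n x : (m <= n)%N -> lsmall n x -> lsmall m x.
Proof.
by move=> h [f ->]; exists (X ^+ (n - m) * f); rewrite mulrA -exprD subnKC.
Qed.

Lemma lsmall1 : lsmall 0 1.
Proof. by exists 1; rewrite expr0 mulr1 rmorph1. Qed.

Lemma lsmall0 n : lsmall n 0.
Proof. by exists 0; rewrite mulr0 rmorph0. Qed.

Lemma lsmall_sep x : (forall n, lsmall n x) -> x = 0.
Proof.
move=> h; have [f ef] := h 0; rewrite ef expr0 mul1r; apply/eqP; rewrite tofrac_eq0.
apply/eqP; apply: fpsP => n; rewrite fcoef0; have [g eg] := h n.+1.
have -> : f = X ^+ n.+1 * g.
  by apply/eqP; rewrite -tofrac_eq -eg ef expr0 mul1r.
by rewrite fcoef_XnM ltnn.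
Qed.

Lemma lsmall_geom x : lsmall 1 x -> lsmall 0 (1 - x)^-1.
Proof.
move=> [f ->]; have [|g hg] := @fps_unit F (1 - X ^+ 1 * f).
  by rewrite fcoefB fcoef_XnM fcoef1 subr0 oner_eq0.
exists g; rewrite expr0 mul1r.
have h : g%:F * (1 - (X ^+ 1 * f)%:F) = 1 by rewrite -(rmorph1 (@FracField.tofrac R)) -rmorphB -rmorphM hg.
have n0 : 1 - (X ^+ 1 * f)%:F != 0.
  by apply/eqP => e; move/eqP: h; rewrite e mulr0 eq_sym oner_eq0.
by apply: (mulIf n0); rewrite h mulVf.
Qed.

(** If the denominator of [x] is X^k times a unit, multiplication by [x] loses at most [k]
    orders. *)
Lemma lsmall_bounded x : exists k, forall n y, lsmall (n + k) y -> lsmall n (x * y).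
Proof.
have [a [b [b0 ->]]] := frac_numden x.
have [k [u [eb u0]]] := fps_decomp b0; have [g hg] := fps_unit u0.
exists k => n y [f ->]; exists (a * g * f).
have b0' : b%:F != 0 by rewrite tofrac_eq0.
rewrite mulrAC; apply: (mulIf b0'); rewrite mulfVK // -!rmorphM; congr (_ %:F).
rewrite eb exprD; have -> : X ^+ n * (a * g * f) * (X ^+ k * u) = X ^+ n * (a * f) * X ^+ k * (g * u) by ring.
rewrite hg; ring.
Qed.

Lemma lsmall_complete (u : nat -> {fraction R}) :
  (forall n, lsmall n (u n.+1 - u n)) -> exists l, forall n, lsmall n (u n - l).
Proof.
move=> /choice [f hf].
(* When the differences are X^n f_n, the tail g_n is f_n + X f_(n+1) + X^2 f_(n+2) + ..., finite in
   each coefficient, and u_0 + g_0 is the limit. *)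
pose g n := Fps (fun m => \sum_(k < m.+1) fcoef (f (n + k)%N) (m - k)).
have gS n : g n = f n + X * g n.+1.
  apply: fpsP => m; rewrite fcoefD fcoef_XM /= big_ord_recl /= addn0 subn0; congr (_ + _).
  case: m => [|m]; first by rewrite big_ord0.
  by apply: eq_bigr => i _; rewrite /bump /= add1n addnS addSn subSS.
exists (u 0 + (g 0)%:F) => n.
have -> : u 0 + (g 0)%:F = u n + (X ^+ n * g n)%:F.
  elim: n => [|n ->]; first by rewrite expr0 mul1r.
  have -> : u n.+1 = u n + (X ^+ n * f n)%:F by rewrite -hf addrC subrK.
  rewrite -addrA -rmorphD; congr (_ + _%:F); rewrite gS exprSr; ring.
by exists (- g n); rewrite mulrN rmorphN opprD addrA subrr sub0r.
Qed.

Definition laurent : vfield :=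
  VField lsmall0 lsmallB lsmallM lsmall_le lsmall1 lsmall_sep lsmall_geom lsmall_bounded
    lsmall_complete.

End LaurentSeries.

Lemma geometric_tail (K : vfield) (y : K) N : 1 - y != 0 ->
  (1 - y)^-1 - \sum_(k < N) y ^+ k = y ^+ N * (1 - y)^-1.
Proof.
move=> y1; have -> : y ^+ N = 1 + (y ^+ N - 1) by rewrite addrC subrK.
by rewrite subrX1; field.
Qed.

(** * Integer series in q inside Laurent series in t, with q = t^2 *)

Section Embedding.
Variable F : fieldType.
Local Notation R := (fps F).
Local Notation X := (fps_X F).
Local Notation K := (laurent F).
Definition of_fps (f : R) : K := FracField.tofrac f.
Local Notation "x %:F" := (of_fps x).
Implicit Types (f g : series) (x y : K).

Definition lX : K := X%:F.
Local Notation t := lX.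

Lemma of_fpsD (f g : R) : (f + g)%:F = f%:F + g%:F. Proof. exact: tofracD. Qed.
Lemma of_fpsB (f g : R) : (f - g)%:F = f%:F - g%:F. Proof. exact: tofracB. Qed.
Lemma of_fpsM (f g : R) : (f * g)%:F = f%:F * g%:F. Proof. exact: tofracM. Qed.
Lemma of_fpsXn (f : R) n : (f ^+ n)%:F = f%:F ^+ n. Proof. exact: tofracXn. Qed.
Lemma of_fps1 : (1 : R)%:F = 1. Proof. exact: tofrac1. Qed.
Lemma of_fps0 : (0 : R)%:F = 0. Proof. exact: tofrac0. Qed.
Lemma of_fps_inj : injective of_fps.
Proof. by move=> f g /eqP; rewrite /of_fps tofrac_eq => /eqP. Qed.

Lemma lX_neq0 : t != 0.
Proof. by rewrite -of_fps0 (inj_eq of_fps_inj) fps_X_neq0. Qed.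

Lemma lX_small : small 1 t.
Proof. by exists 1; rewrite expr1 mulr1. Qed.

Lemma small_of_fps (f : R) : small 0 f%:F.
Proof. by exists f; rewrite expr0 mul1r. Qed.

Lemma small_coef n (f : R) : small n f%:F <-> forall k, (k < n)%N -> fcoef f k = 0.
Proof.
split=> [[g] | h].
  by move=> /of_fps_inj -> k hk; rewrite fcoef_XnM leqNgt hk.
by exists (Fps (fun k => fcoef f (k + n))); rewrite -fps_shift.
Qed.

Definition lcst (c : F) : K := (fps_cst c)%:F.

Lemma lcst1 : lcst 1 = 1. Proof. exact: of_fps1. Qed.
Lemma lcst_small c : small 0 (lcst c). Proof. exact: small_of_fps. Qed.
Lemma lcstM c d : lcst (c * d) = lcst c * lcst d.
Proof.
rewrite -of_fpsM; congr (_%:F); apply: fpsP => n; rewrite fcoefM big_ord_recl big1 ?addr0 /=.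
  by rewrite subn0; case: eqP => // _; rewrite mulr0.
by move=> i _; rewrite mul0r.
Qed.
Lemma lcstD c d : lcst (c + d) = lcst c + lcst d.
Proof. by rewrite -of_fpsD; congr (_%:F); apply: fpsP => n /=; case: eqP; rewrite ?addr0. Qed.
Lemma lcstN c : lcst (- c) = - lcst c.
Proof.
apply/eqP; rewrite -subr_eq0 opprK -lcstD addNr; apply/eqP; rewrite -of_fps0; congr (_%:F).
Qed.
Lemma lcstX c n : lcst (c ^+ n) = lcst c ^+ n.
Proof. by elim: n => [|n IH]; rewrite ?lcst1 // !exprS lcstM IH. Qed.
Lemma lcst_neq0 c : c != 0 -> lcst c != 0.
Proof.
move=> c0; rewrite -of_fps0 (inj_eq of_fps_inj).
by apply/eqP => /(congr1 (fun h : R => fcoef h 0)) /= /eqP; rewrite (negPf c0).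
Qed.
Lemma lcstV c : c != 0 -> lcst c^-1 = (lcst c)^-1.
Proof.
move=> c0; apply: (mulIf (lcst_neq0 c0)); rewrite mulVf ?lcst_neq0 //.
by rewrite -lcstM mulVf // lcst1.
Qed.

(* Substitution [q = t^2]. *)
Definition emb f : R := Fps (fun n => if odd n then 0 else (f n./2)%:~R).
Definition ev f : K := (emb f)%:F.

Lemma eq_ev f g : f =1 g -> ev f = ev g.
Proof. by move=> h; congr (_%:F); apply: fpsP => n /=; rewrite h. Qed.

Lemma evD f g : ev (sadd f g) = ev f + ev g.
Proof.
rewrite -of_fpsD; congr (_%:F); apply: fpsP => n /=.
by case: odd; rewrite ?addr0 // /sadd intrD.
Qed.

Lemma evB f g : ev (ssub f g) = ev f - ev g.
Proof.
rewrite -of_fpsB; congr (_%:F); apply: fpsP => n; rewrite fcoefB /=.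
by case: odd; rewrite ?subr0 // /ssub intrB.
Qed.

Lemma sum_double (V : zmodType) (G : nat -> V) m : (forall k, G k.*2.+1 = 0) ->
  \sum_(i < m.*2.+1) G i = \sum_(k < m.+1) G k.*2.
Proof.
move=> h; elim: m => [|m IH]; first by rewrite !big_ord1.
by rewrite doubleS big_ord_recr big_ord_recr /= IH h addr0 [RHS]big_ord_recr.
Qed.

Lemma evM f g : ev (smul f g) = ev f * ev g.
Proof.
rewrite -of_fpsM; congr (_%:F); apply: fpsP => n; rewrite fcoefM /=.
case: (boolP (odd n)) => ho.
  rewrite big1 // => i _; case: (boolP (odd i)) => hi; first by rewrite mul0r.
  by rewrite oddB ?ho ?(negPf hi) ?mulr0 // -ltnS.
have [m ->] : exists m, n = m.*2 by exists n./2; rewrite -[LHS]odd_double_half (negPf ho).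
rewrite (@sum_double _ (fun i => (if odd i then 0 else (f i./2)%:~R) *
  (if odd (m.*2 - i) then 0 else (g (m.*2 - i)./2)%:~R))); last by move=> k; rewrite /= odd_double mul0r.
rewrite doubleK /smul rmorph_sum; apply: eq_bigr => i _ /=.
by rewrite -doubleB !odd_double !doubleK intrM.
Qed.

Lemma of_fpsXnE n : (X ^+ n)%:F = t ^+ n. Proof. exact: of_fpsXn. Qed.

Lemma fcoef_Xn n k : fcoef (X ^+ n) k = (k == n)%:R.
Proof.
rewrite -[X ^+ n]mulr1 fcoef_XnM fcoef1 subn_eq0.
by case: ltngtP.
Qed.

Lemma ev_mon c e : ev (smon c e) = c%:~R * t ^+ e.*2.
Proof.
have -> : (c%:~R : K) = (c%:~R : R)%:F by rewrite /of_fps rmorph_int.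
rewrite -of_fpsXnE -of_fpsM; congr (_%:F); apply: fpsP => n.
rewrite mulrzl.
have coefz (h : R) k : fcoef (h *~ c) k = fcoef h k *~ c.
  have hn (m : nat) : fcoef (h *+ m) k = fcoef h k *+ m.
    by elim: m => [|m IH]; [rewrite !mulr0n fcoef0 | rewrite !mulrS fcoefD IH].
  by case: c => m /=; rewrite ?NegzE ?mulrNz ?fcoefN -?pmulrn hn.
rewrite coefz fcoef_Xn /= /smon.
case: (boolP (odd n)) => ho.
  by rewrite [n == _](_ : _ = false) ?mul0rz //; apply/eqP => h; move: ho; rewrite h odd_double.
have -> : (n./2 == e) = (n == e.*2).
  by apply/eqP/eqP => [<-|->]; [rewrite -[LHS]odd_double_half (negPf ho) | rewrite doubleK].
by case: eqP => //; rewrite mul0rz.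
Qed.

Lemma ev_one : ev sone = 1.
Proof. by rewrite (eq_ev (g := smon 1 0)) // ev_mon mul1r. Qed.

Lemma ev_zero : ev szero = 0.
Proof. by rewrite (eq_ev (g := smon 0 0)) // ev_mon mul0r. Qed.

Lemma ev_const c : ev (sconst c) = c%:~R.
Proof. by rewrite (eq_ev (g := smon c 0)) // ev_mon mulr1. Qed.

Lemma ev_shift e f : ev (sshift e f) = t ^+ e.*2 * ev f.
Proof.
have -> : ev (sshift e f) = ev (smul (smon 1 e) f).
  apply: eq_ev => n; rewrite /sshift /smul /smon; case: leqP => h.
    rewrite (bigD1 (Ordinal (h : e < n.+1)%N)) //= eqxx mul1r big1 ?addr0 // => i hi.
    by rewrite ifF ?mul0r //; apply/negP => /eqP e1; case/eqP: hi; apply: val_inj.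
  by rewrite big1 // => i _; rewrite ifF ?mul0r //; have := ltn_ord i; lia.
by rewrite evM ev_mon mul1r.
Qed.

Lemma ev_sum (s : seq series) : ev (ssum s) = \sum_(f <- s) ev f.
Proof.
elim: s => [|f s IH]; first by rewrite big_nil /= ev_zero.
by rewrite big_cons /= evD IH.
Qed.

Lemma ev_prod (s : seq series) : ev (sprod s) = \prod_(f <- s) ev f.
Proof.
elim: s => [|f s IH]; first by rewrite big_nil /= ev_one.
by rewrite big_cons /= evM IH.
Qed.

Lemma ev_pow f k : ev (spow f k) = ev f ^+ k.
Proof.
elim: k => [|k IH]; first by rewrite expr0 ev_one.
by rewrite /spow iterS evM -/(spow f k) IH exprS.
Qed.

(* The infinite objects of Defs are read off along a diagonal:
   coefficient n comes from the (n+1)-st approximation. *)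
Lemma ev_diag (u : nat -> series) (l : K) : (forall N, small N.*2 (l - ev (u N))) ->
  ev (fun n => u n.+1 n) = l.
Proof.
move=> h.
have [g eg] : exists g : R, l = g%:F.
  have [g eg] := h 0%N; exists (g + emb (u 0)); rewrite of_fpsD -[g%:F]mul1r.
  by move/eqP: eg; rewrite expr0 mul1r subr_eq => /eqP ->; rewrite mul1r.
rewrite eg; congr (_%:F); apply: fpsP => k.
have := h k./2.+1; rewrite eg -of_fpsB small_coef => /(_ k).
rewrite fcoefB => /(_ _) /eqP; rewrite subr_eq0 => h2.
have hk : (k < k./2.+1.*2)%N by have := odd_double_half k; case: odd; lia.
by move/eqP: (h2 hk) => ->; rewrite /=; case: odd.
Qed.

Lemma sgn_intr b : ((sgn b)%:~R : K) = (-1) ^+ b.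
Proof. by case: b. Qed.

Lemma ev_qpoch b e m k : ev (qpoch b e m k) = poch (t ^+ m.*2) ((-1) ^+ b * t ^+ e.*2) k.
Proof.
rewrite /qpoch ev_prod big_map /poch -(big_mkord xpredT (fun i => 1 - (-1) ^+ b * t ^+ e.*2 * (t ^+ m.*2) ^+ i)).
rewrite /index_iota subn0; apply: eq_bigr => i _.
rewrite evB ev_one ev_mon sgn_intr -mulrA -exprM -exprD; congr (1 - _ * t ^+ _); lia.
Qed.

Lemma small_sign b : small 0 ((-1 : K) ^+ b).
Proof. by apply: smallX0; apply: small0N1. Qed.

Lemma small_t m n : (n <= m)%N -> small n (t ^+ m).
Proof. by move=> h; apply: small_le h (smallX1 m lX_small). Qed.

(** [Q] has order at least 2 in [t], so the factors from the N-th on change only orders >= 2N, the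
    accuracy [ev_diag] asks for. *)
Lemma ev_qpoch_inf b e m : (0 < m)%N ->
  ev (qpoch_inf b e m) = pinf (t ^+ m.*2) ((-1) ^+ b * t ^+ e.*2).
Proof.
move=> m0; apply: (ev_diag (u := qpoch b e m)) => N; rewrite ev_qpoch.
set Q := t ^+ _; set x := _ * _.
have sx : small 0 x by apply: smallMl; [apply: small_sign | apply: small_t].
have sQ : small 2 Q by apply: small_t; lia.
have hQ : small 1 Q by apply: small_le sQ.
apply: (lim_small (limB (lim_poch0 sx hQ) (lim_cst (poch Q x N)))).
exists N => k hk; apply: small_tail => // i hi.
have -> : poch Q x i.+1 - poch Q x i = - (poch Q x i * x * Q ^+ i) by rewrite pochS; ring.
apply: smallN; apply: smallMl.
  by apply: smallMl => //; apply: poch_small => //; apply: small_weak hQ.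
by apply: small_le (smallX i sQ); lia.
Qed.

(** [ev f] has only even powers of [t] and constant term 1, so 1 - ev f has order at least 2 and its
    geometric series gains two orders per term. *)
Lemma ev_inv f : f 0%N = 1 -> ev (sinv f) = (ev f)^-1.
Proof.
move=> f0; apply: (ev_diag (u := fun N => ssum [seq spow (ssub sone f) k | k <- iota 0 N])) => N.
rewrite ev_sum big_map.
set y := 1 - ev f; have -> : ev f = 1 - y by rewrite /y; ring.
have sy : small 2 y.
  rewrite /y -ev_one -evB; apply/small_coef => -[|[|]] // _.
  by rewrite /= /ssub f0 subrr.
have y1 : 1 - y != 0 by apply: small1_neq1; apply: small_le sy.
rewrite -[iota 0 N](_ : index_iota 0 N = _) ?big_mkord; last by rewrite /index_iota subn0.
rewrite (eq_bigr (fun i : 'I_N => y ^+ i)) => [|i _]; last by rewrite ev_pow evB ev_one.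
rewrite geometric_tail //.
apply: smallMr; last by apply: small_geom; apply: small_le sy.
by apply: small_le (smallX N sy); lia.
Qed.

Lemma smul_0 f g : smul f g 0%N = f 0%N * g 0%N.
Proof. by rewrite /smul big_ord1. Qed.

Lemma qpoch_0 b e m k : (0 < e)%N -> qpoch b e m k 0%N = 1.
Proof.
move=> e0; rewrite /qpoch; elim: (iota 0 k) => //= i s IH.
rewrite smul_0 IH mulr1 /ssub /smon /sone /sconst /= ifF ?subr0 //; lia.
Qed.

Lemma ev_div f g : g 0%N = 1 -> ev (sdiv f g) = ev f / ev g.
Proof. by move=> g0; rewrite /sdiv evM ev_inv. Qed.

Lemma ev_Gser a m : (0 < a < m)%N -> ev (Gser a m) = gsum (t ^+ m.*2) (t ^+ a.*2) - 1.
Proof.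
move=> /andP [a0 am].
set Q := t ^+ m.*2; set x := t ^+ a.*2.
have xV : Q / x = t ^+ (m - a).*2.
  rewrite /Q /x; have -> : m.*2 = ((m - a).*2 + a.*2)%N by lia.
  by rewrite exprD mulfK // expf_neq0 // lX_neq0.
have hQ : small 1 Q by apply: small_t; lia.
have hx : small 1 x by apply: small_t; lia.
have hx' : small 1 (Q / x) by rewrite xV; apply: small_t; lia.
pose T n := Q ^+ (n * n) / (poch Q x n.+1 * poch Q (Q / x) n).
have sT n : small n.*2 (T n).
  rewrite /T invfM; apply: smallMr.
    by rewrite /Q -exprM; apply: small_t; nia.
  by apply: smallMl; apply: pochV_small => //; apply: small_weak hQ.
pose D n := sshift (m * n * n) (sinv (smul (qpoch false a m n.+1) (qpoch false (m - a) m n))).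
have eD n : ev (D n) = T n.
  rewrite /D ev_shift ev_inv; last by rewrite smul_0 !qpoch_0 ?mulr1 //; lia.
  rewrite evM !ev_qpoch /= !expr0 !mul1r -xV /T; congr (_ / _).
  by rewrite /Q -exprM; congr (t ^+ _); lia.
have -> : ev (Gser a m) = ev (fun k => ssum [seq D n | n <- iota 0 k.+1] k) - 1.
  rewrite -ev_one -evB; apply: eq_ev => k; rewrite /Gser /ssub /sone /sconst.
  by case: (k == 0%N).
congr (_ - 1); apply: (ev_diag (u := fun N => ssum [seq D n | n <- iota 0 N])) => N.
rewrite ev_sum big_map -[iota 0 N](_ : index_iota 0 N = _) ?big_mkord; last by rewrite /index_iota subn0.
rewrite (eq_bigr (fun i : 'I_N => T i)) //.
have L : lim (fun M => \sum_(n < M.+1) T n) (gsum Q x).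
  apply: Lim_cauchy => n; exists n => k hk.
  by rewrite big_ord_recr /= addrAC subrr add0r; apply: small_le (sT k.+1); lia.
apply: (lim_small (limB L (lim_cst _))); exists N => k hk.
have := @small_tail K (fun M => \sum_(n < M) T n) N.*2 N; apply; last by lia.
move=> i hi; rewrite big_ord_recr /= addrAC subrr add0r; apply: small_le (sT i); lia.
Qed.

End Embedding.

(** * Ranks of partitions *)

Lemma small_prodB (K : vfield) (n m : nat) (a b : 'I_n -> K) :
  (forall i, small 0 (a i)) -> (forall i, small 0 (b i)) -> (forall i, small m (a i - b i)) ->
  small m (\prod_i a i - \prod_i b i).
Proof.
elim: n a b => [|n IH] a b ha hb hab; first by rewrite !big_ord0 subrr; apply: small0.
rewrite !big_ord_recl.
have e (x y u v : K) : x * u - y * v = (x - y) * u + y * (u - v) by ring.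
rewrite e; apply: smallD; first by apply: smallMr; [exact: hab | apply: small_prod0].
by apply: smallMl => //; apply: IH.
Qed.

Lemma leq_plargest n (mu : ptn n) (i : 'I_n) : mu i != 0%N :> nat -> (i < plargest mu)%N.
Proof. exact: (@leq_bigmax_cond _ (fun i => mu i != 0%N :> nat) (fun i : 'I_n => i.+1)). Qed.

Lemma plargestP n (mu : ptn n) (k : 'I_n) :
  (plargest mu == k.+1) = (mu k != 0%N :> nat) && [forall (i : 'I_n | (k < i)%N), mu i == 0%N :> nat].
Proof.
apply/eqP/andP => [h | [hk /forall_inP hi]]; last first.
  apply/eqP; rewrite eqn_leq leq_plargest // andbT.
  apply/bigmax_leqP => i mi; rewrite ltnS leqNgt; apply/negP => /hi.
  by rewrite (negPf mi).
have hle (i : 'I_n) : mu i != 0%N :> nat -> (i <= k)%N.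
  by move=> mi; rewrite -ltnS -h; apply: leq_plargest.
split; last first.
  by apply/forall_inP => i ki; apply: contraLR ki => /hle; rewrite -leqNgt.
apply/eqP => mk; have : (plargest mu <= k)%N.
  apply/bigmax_leqP => i mi; rewrite ltn_neqAle (hle _ mi) andbT.
  by apply/eqP => e; case/eqP: mi; rewrite -mk; congr (nat_of_ord (mu _)); apply: val_inj.
by rewrite h ltnn.
Qed.

Lemma plargest_eq0 n (mu : ptn n) : (plargest mu == 0%N) = (mu == [ffun=> ord0]).
Proof.
apply/eqP/eqP => [h | ->]; last first.
  by apply/eqP; rewrite -leqn0; apply/bigmax_leqP => i; rewrite ffunE.
apply/ffunP => i; rewrite ffunE; apply: val_inj => /=; apply/eqP; apply: contraT => mi.
by have := leq_plargest mi; rewrite h.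
Qed.

Lemma plargest_le n (mu : ptn n) : (plargest mu <= n)%N.
Proof. by apply/bigmax_leqP => i _. Qed.

Section RankPolynomial.
Variables (K : vfield) (Q z : K).
Hypotheses (z0 : z != 0) (sz : small 0 z) (szV : small 0 z^-1) (hQ : small 2 Q) (Q0 : Q != 0).
Variable n : nat.

Let hQ1 : small 1 Q. Proof. exact: small_le hQ. Qed.
Let y (i : nat) := z^-1 * Q ^+ i.+1.
Let sy i : small i.+1.*2 (y i).
Proof. by apply: smallMl => //; apply: small_le (smallX i.+1 hQ); lia. Qed.
Let sy1 i : small 1 (y i). Proof. by apply: small_le (sy i); lia. Qed.
Let y1 i : 1 - y i != 0. Proof. exact: small1_neq1. Qed.

(** Multiplicity functions of every weight are summed. Parts and multiplicities are capped at [n],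
    which loses nothing in weights up to [n]. *)
Definition rank_polynomial := \sum_(mu : ptn n) z ^ prank mu * Q ^+ pweight mu.

Lemma rank_monomial (mu : ptn n) :
  z ^ prank mu * Q ^+ pweight mu = z ^+ plargest mu * \prod_(i < n) y i ^+ mu i.
Proof.
have -> : \prod_(i < n) y i ^+ mu i = z ^ (- (pnparts mu)%:Z) * Q ^+ pweight mu.
  rewrite /pweight /pnparts -exprnN -exprVn -!prodrXr -big_split /=; apply: eq_bigr => i _.
  by rewrite /y exprMn exprM.
by rewrite mulrA [z ^+ _]exprnP -expfzDr.
Qed.

(* Which multiplicities [j] the part [i + 1] may have in a partition with largest
   part [k + 1]. *)
Definition allowed_mult (k : nat) (i : nat) (j : nat) :=
  if (i < k)%N then true else if i == k then j != 0%N else j == 0%N.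

(** Once the largest part is fixed, the multiplicities vary independently and the monomial is
    multiplicative in them, so the sum factors. *)
Lemma sum_largest (k : 'I_n) :
  \sum_(mu : ptn n | plargest mu == k.+1) z ^ prank mu * Q ^+ pweight mu =
  z ^+ k.+1 * \prod_(i < n) \sum_(j < n.+1 | allowed_mult k i j) y i ^+ j.
Proof.
rewrite (bigA_distr_big_dep (fun (i : 'I_n) (j : 'I_n.+1) => allowed_mult k i j) (fun i j => y i ^+ j)).
rewrite mulr_sumr; apply: eq_big => [mu | mu /eqP h]; last by rewrite rank_monomial h.
rewrite plargestP; apply/andP/familyP => [[hk /forall_inP hi] i | h].
  rewrite unfold_in /allowed_mult; case: ltngtP => // [ki | e]; first exact: hi.
  by have -> : i = k by apply: val_inj.
split; first by have := h k; rewrite unfold_in /allowed_mult ltnn eqxx.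
apply/forall_inP => i ki; have := h i; rewrite unfold_in /allowed_mult.
by case: ltngtP ki.
Qed.

Lemma rank_polynomialE : rank_polynomial =
  1 + \sum_(k < n) z ^+ k.+1 * \prod_(i < n) \sum_(j < n.+1 | allowed_mult k i j) y i ^+ j.
Proof.
pose L (mu : ptn n) : 'I_n.+1 := inord (plargest mu).
rewrite /rank_polynomial (partition_big L xpredT) //= big_ord_recl; congr (_ + _).
  rewrite (big_pred1 [ffun=> ord0]) => [|mu]; last first.
    by rewrite [RHS]/= -plargest_eq0 -val_eqE /= inordK // ltnS plargest_le.
  rewrite rank_monomial; have /eqP -> : plargest ([ffun=> ord0] : ptn n) == 0%N by rewrite plargest_eq0.
  by rewrite mul1r big1 // => i _; rewrite ffunE.
apply: eq_bigr => k _; rewrite -sum_largest; apply: eq_bigl => mu.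
by rewrite -val_eqE /= inordK ?ltnS ?plargest_le.
Qed.

(** The cap on multiplicities cuts the geometric series after y^n, and y^(n+1) has order at least
    2(n+1). The part k + 1 has to occur, which costs one factor y. *)
Lemma allowed_geometric k i : (k <= n)%N ->
  small (n.+1).*2 (\sum_(j < n.+1 | allowed_mult k i j) y i ^+ j -
    (if (i < k.+1)%N then (1 - y i)^-1 else 1) * (if i == k then y i else 1)).
Proof.
move=> kn; have tail : small (n.+1).*2 ((1 - y i)^-1 - \sum_(j < n.+1) y i ^+ j).
  rewrite geometric_tail //; apply: smallMr; last exact: small_geom.
  by apply: small_le (smallX n.+1 (sy i)); nia.
rewrite /allowed_mult ltnS; case: (ltngtP i k) => h.
- by rewrite mulr1 -opprB; apply: smallN.
- rewrite (big_pred1 ord0); last by move=> j; rewrite [RHS]/= -val_eqE.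
  by rewrite expr0 !mul1r subrr; apply: small0.
- have -> : \sum_(j < n.+1 | j != 0%N :> nat) y i ^+ j = \sum_(j < n.+1) y i ^+ j - 1.
    by rewrite [in RHS](bigD1 ord0) //= expr0 addrAC subrr add0r; apply: eq_bigl => j; rewrite -val_eqE.
  have -> : (1 - y i)^-1 * y i = (1 - y i)^-1 - 1 by field.
  have -> : \sum_(j < n.+1) y i ^+ j - 1 - ((1 - y i)^-1 - 1) =
     - ((1 - y i)^-1 - \sum_(j < n.+1) y i ^+ j) by ring.
  exact: smallN.
Qed.

(** Term k of [rogers_fine] generates the partitions with largest part k + 1. Its terms with k >= n
    start at order 2(n+1), and so do the errors of [allowed_geometric]; hence all coefficients up to
    that of t^(2n) agree. *)
Lemma rank_polynomial_approx : small (n.+1).*2 (rank_sum Q z - rank_polynomial).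
Proof.
have hz : bounded_unit z by [].
pose T k := z ^+ k * Q ^+ k.+1 / poch Q (Q / z) k.+1.
have sQz : small 1 (Q / z) by apply: smallMr.
have sT k : small k.+1.*2 (T k).
  apply: smallMr; last by apply: pochV_small => //; apply: small_weak hQ1.
  by apply: smallMl; [exact: smallX0 | apply: small_le (smallX k.+1 hQ); lia].
have e (u v : K) : 1 + u - (1 + v) = u - v by ring.
have h1 : small (n.+1).*2 (rank_sum Q z - (1 + \sum_(k < n) T k)).
  apply: (lim_small (limB (rogers_fine hQ1 hz) (lim_cst _))); exists n => m hm.
  rewrite e; have := @small_tail K (fun M => \sum_(k < M) T k) (n.+1).*2 n; apply => //.
  move=> i hi; rewrite big_ord_recr /= addrAC subrr add0r; apply: small_le (sT i); lia.
suff h2 : small (n.+1).*2 ((1 + \sum_(k < n) T k) - rank_polynomial).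
  have -> : rank_sum Q z - rank_polynomial =
    (rank_sum Q z - (1 + \sum_(k < n) T k)) + ((1 + \sum_(k < n) T k) - rank_polynomial) by ring.
  exact: smallD.
rewrite rank_polynomialE e -sumrB; apply: small_sum => k _.
have -> : T k = z ^+ k.+1 * \prod_(i < n) ((if (i < k.+1)%N then (1 - y i)^-1 else 1) *
    (if i == k :> nat then y i else 1)).
  rewrite big_split /= -[X in _ * (X * _)]big_mkcond /=.
  rewrite -(big_ord_widen n (fun i => (1 - y i)^-1)) ?ltn_ord //.
  rewrite prodfV [\prod_(i < n) _](bigD1 k) //= eqxx [\prod_(i < n | _) _]big1 ?mulr1; last first.
    by move=> i ik; rewrite ifF //; apply/negbTE; rewrite -val_eqE in ik.
  have -> : \prod_(i < k.+1) (1 - y i) = poch Q (Q / z) k.+1.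
    by apply: eq_bigr => i _; rewrite /y exprS; congr (1 - _); ring.
  by rewrite /T /y (exprS z); field; rewrite z0 poch_neq0 //; apply: small_weak hQ1.
rewrite -mulrBr; apply: smallMl; first exact: smallX0.
rewrite -[\prod_i _ - _]opprB; apply: smallN; apply: small_prodB => i.
- apply: small_sum => j _; apply: smallX0; exact: small_weak (sy1 i).
- apply: smallMl; first by case: ifP => _; [exact: small_geom | exact: small1].
  by case: ifP => _; [exact: small_weak (sy1 i) | exact: small1].
- by apply: allowed_geometric; apply: ltnW.
Qed.

End RankPolynomial.

Section RankCoefficients.
Variable F : fieldType.
Local Notation K := (laurent F).
Local Notation t := (lX F).
Implicit Types (z c : F).

Definition rank_coef z n : F := \sum_(mu : ptn n | pweight mu == n) z ^ prank mu.

Lemma lcst_bounded_unit z : z != 0 -> bounded_unit (lcst z).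
Proof. by move=> z0; split; rewrite ?lcst_neq0 -?lcstV //; apply: lcst_small. Qed.

Lemma lcstXz z (m : int) : z != 0 -> lcst (z ^ m) = lcst z ^ m.
Proof.
move=> z0; case: m => m; first exact: lcstX.
by rewrite !NegzE -!exprnN lcstV ?expf_neq0 // lcstX.
Qed.

Lemma fcoef_cstM c (f : fps F) n : fcoef (fps_cst c * f) n = c * fcoef f n.
Proof.
rewrite fcoefM big_ord_recl big1 ?addr0 /= ?subn0 // => i _.
by rewrite mul0r.
Qed.

Lemma rank_sum_coef z : z != 0 ->
  exists g, rank_sum (t ^+ 2) (lcst z) = of_fps g /\ forall n, fcoef g n.*2 = rank_coef z n.
Proof.
move=> z0; have [z0' sz szV] := lcst_bounded_unit z0.
have hQ : small 2 (t ^+ 2) by apply: small_t.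
have Q0 : t ^+ 2 != 0 := expf_neq0 2 (lX_neq0 F).
pose P n : fps F := \sum_(mu : ptn n) fps_cst (z ^ prank mu) * fps_X F ^+ (pweight mu).*2.
have hP n : rank_polynomial (t ^+ 2) (lcst z) n = of_fps (P n).
  rewrite /rank_polynomial /P /of_fps rmorph_sum; apply: eq_bigr => mu _.
  rewrite -[RHS]/(of_fps _) of_fpsM of_fpsXn -/(lcst _) lcstXz // -mul2n exprM; exact: erefl.
have h n : small (n.+1).*2 (rank_sum (t ^+ 2) (lcst z) - of_fps (P n)).
  by rewrite -hP; apply: rank_polynomial_approx.
have [g eg] : exists g, rank_sum (t ^+ 2) (lcst z) = of_fps g.
  have [g] := small_weak (h 0%N); rewrite expr0 mul1r => /eqP; rewrite subr_eq -[FracField.tofrac g]/(of_fps g).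
  by rewrite -of_fpsD => /eqP e; exists (g + P 0%N).
exists g; split=> // n; have := h n; rewrite eg -of_fpsB small_coef => /(_ n.*2).
rewrite fcoefB => h2; have /eqP := h2 ltac:(lia); rewrite subr_eq0 => /eqP ->.
rewrite /P fcoef_sum /rank_coef [RHS]big_mkcond; apply: eq_bigr => mu _.
rewrite fcoef_cstM fcoef_Xn (inj_eq double_inj) eq_sym.
by case: eqP => _; rewrite ?mulr1 ?mulr0.
Qed.

(** The symmetry N(m,n) = N(-m,n), read off from the series, which is visibly invariant under z ->
    1/z, in place of conjugating partitions. *)
Lemma rank_coefV z n : z != 0 -> rank_coef z^-1 n = rank_coef z n.
Proof.
move=> z0; have [g [eg hg]] := rank_sum_coef z0.
have [h [eh hh]] := rank_sum_coef (invr_neq0 z0).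
rewrite -hg -hh; congr (fcoef _ _); apply: (@of_fps_inj F).
rewrite -eg -eh (lcstV z0) rank_sumV; exact: erefl.
Qed.

Lemma rank_coef_eighth z n : z ^+ 8 = 1 ->
  rank_coef z n = \sum_(a < 8) (NM a%:Z 8 n)%:R * z ^+ a.
Proof.
move=> z8; pose r (mu : ptn n) : 'I_8 := inord (absz (prank mu %% 8)%Z).
have rE (mu : ptn n) : (r mu)%:Z = (prank mu %% 8)%Z.
  rewrite /r inordK; first by rewrite gez0_abs // modz_ge0.
  by have := ltz_pmod (prank mu) (isT : (0 < 8 :> int)); have := modz_ge0 (prank mu) (isT : (8 != 0 :> int)); lia.
rewrite /rank_coef (partition_big r xpredT) //=; apply: eq_bigr => a _.
have z0 : z != 0.
  by apply/negP => /eqP e; move/eqP: z8; rewrite e expr0n /= eq_sym oner_eq0.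
have mod_r (mu : ptn n) : (r mu == a) = (8 %| prank mu - a%:Z)%Z.
  rewrite -eqz_mod_dvd -val_eqE /= -eqz_nat rE.
  by rewrite [(a%:Z %% 8)%Z]modz_small //; have := ltn_ord a; lia.
rewrite (eq_bigr (fun=> z ^+ a)) => [|mu /andP [_ /eqP ra]]; last first.
  have zq (q : int) : z ^ (q * 8) = 1 by rewrite mulrC -exprz_exp -exprnP z8 exp1rz.
  by rewrite (divz_eq (prank mu) 8) -rE ra expfzDr // zq mul1r.
rewrite (eq_bigl (mem [set mu : ptn n | (pweight mu == n) && (8 %| prank mu - a%:Z)%Z])).
  by rewrite sumr_const mulr_natl.
by move=> mu; rewrite /= in_set mod_r.
Qed.

End RankCoefficients.

(** Sorting by powers of [w]: the part free of [w] is the first series of the theorem and the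
    coefficient of [w] the second. Plain variables give [ring] its atoms. *)
Lemma collect_main_series (K : fieldType) (w g2 h p a b T i : K) :
  (2 - w) * g2 + w * h + ((w - 1) * p * a + p * (T * b)) * i =
  2%:~R + (g2 - 1 + (g2 - 1)) - p * a * i + T * (p * b * i) +
  w * ((-1)%:~R - (g2 - 1) + h + p * a * i).
Proof. by rewrite mulrN1z; ring. Qed.

(** * The two series of the theorem and the separation of the residue classes modulo 8 *)

Definition main_series1 : series :=
  sadd (ssub (sadd (sconst 2) (sadd (qg 2 2 16) (qg 2 2 16)))
             (sdiv (smul (Jbar 2 4) (J 6 16)) (Jm 4)))
       (sshift 1 (sdiv (smul (Jbar 2 4) (J 2 16)) (Jm 4))).

Definition main_series2 : series :=
  sadd (sadd (ssub (sconst (-1)) (qg 2 2 16)) (qg 5 6 16))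
       (sdiv (smul (Jbar 2 4) (J 6 16)) (Jm 4)).

Section MainSeries.
Variable F : fieldType.
Local Notation K := (laurent F).
Local Notation t := (lX F).

Lemma ev_jth b e m : (0 < m)%N -> ev F (jth b e m) =
  pinf (t ^+ m.*2) ((-1) ^+ b * t ^+ e.*2) * pinf (t ^+ m.*2) ((-1) ^+ b * t ^+ (m - e).*2) *
  pinf (t ^+ m.*2) (t ^+ m.*2).
Proof. move=> m0; rewrite /jth !evM !(ev_qpoch_inf F _ _ m0) expr0 mul1r; exact: erefl. Qed.

Lemma t_div m n : (m <= n)%N -> t ^+ n / t ^+ m = t ^+ (n - m).
Proof. by move=> h; rewrite -{1}(subnK h) exprD mulfK // expf_neq0 // lX_neq0. Qed.

Lemma ev_Jbar : ev F (Jbar 2 4) = phi t 4.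
Proof. rewrite /Jbar (ev_jth _ _ (isT : 0 < 4)%N) expr1 !mulN1r -expr2; exact: erefl. Qed.

Lemma ev_J6 : ev F (J 6 16) = J6_16 t.
Proof.
rewrite /J (ev_jth _ _ (isT : 0 < 16)%N) expr0 !mul1r /J6_16 /theta (@t_div 12 32 isT).
exact: erefl.
Qed.

Lemma ev_J2 : t ^+ 2 * ev F (J 2 16) = qJ2_16 t.
Proof.
rewrite /J (ev_jth _ _ (isT : 0 < 16)%N) expr0 !mul1r /qJ2_16 /theta (@t_div 4 32 isT).
exact: erefl.
Qed.

Lemma ev_Jm4 : ev F (Jm 4) = pinf (t ^+ 8) (t ^+ 8).
Proof.
have s8 : small 1 (t ^+ 8) by apply: small_t.
rewrite /Jm /J ev_jth // expr0 !mul1r (pinf_triple (small_weak s8) s8).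
by rewrite -!exprM -!exprD.
Qed.

Lemma Jm4_0 : Jm 4 0%N = 1.
Proof. by rewrite /Jm /J /jth !smul_0 /qpoch_inf !qpoch_0. Qed.

Lemma ev_qg2 : ev F (qg 2 2 16) = gsum (t ^+ 32) (t ^+ 4) - 1.
Proof.
rewrite -[RHS](ev_Gser F (isT : (0 < 2 < 16)%N)); apply: eq_ev => k.
by rewrite /qg leq_addl addnK.
Qed.

Lemma ev_qg5 : ev F (qg 5 6 16) = (gsum (t ^+ 32) (t ^+ 12) - 1) / t ^+ 2.
Proof.
have t2 : t ^+ 2 != 0 by rewrite expf_neq0 // lX_neq0.
apply: (mulIf t2); rewrite mulfVK // -[RHS](ev_Gser F (isT : (0 < 6 < 16)%N)).
(* q^5 g(q^6;q^16) is q^-1 times [Gser 6 16], whose constant term is 1 - 1 = 0; the case of index 0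
   checks this. *)
rewrite mulrC -(@ev_shift F 1); apply: eq_ev => -[|k].
  by rewrite /sshift /Gser /=.
rewrite /sshift /qg subn1 /= ifT; last by lia.
by congr (Gser _ _ _); lia.
Qed.

Lemma rank_sum_eighth (z : F) : z ^+ 4 = -1 -> (2 : F) != 0 ->
  rank_sum (t ^+ 2) (lcst z) = ev F main_series1 + lcst (z - z ^+ 3) * ev F main_series2.
Proof.
move=> z4 two0.
have two0' : (2 : K) != 0.
  by rewrite -[2]/(1 + 1) -(lcst1 F) -lcstD lcst_neq0.
have z1 : z != 1.
  apply: contraNneq two0 => e; move/eqP: z4.
  by rewrite e expr1n -subr_eq0 opprK.
have z0 : z != 0.
  by apply/negP => /eqP e; move/eqP: z4; rewrite e expr0n /= eq_sym oppr_eq0 oner_eq0.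
have z4' : lcst z ^+ 4 = -1 by rewrite -lcstX z4 lcstN lcst1.
have hQ : small 1 (t ^+ 2) by apply: small_t.
have [<-|e] := rank_sum_gsum hQ (lcst_bounded_unit z0); last first.
  case/eqP: z1; have /(congr1 (fun f => fcoef f 0)) := of_fps_inj (etrans e (esym (of_fps1 F))).
  by [].
rewrite (rank_at_eighth_root (lX_neq0 F) (lX_small F) two0' z4' (lcst_small z)).
have -> : lcst (z - z ^+ 3) = lcst z - lcst z ^+ 3 by rewrite lcstD lcstN lcstX.
rewrite /main_series1 /main_series2 !(evD, evB) ev_shift !(ev_div _ _ Jm4_0) !(evM _ (Jbar 2 4)) !ev_const.
rewrite ev_qg2 ev_qg5 ev_Jbar ev_J6 ev_Jm4 -ev_J2.
exact: collect_main_series.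
Qed.

Lemma rank_coef_main (z : F) n : z ^+ 4 = -1 -> (2 : F) != 0 ->
  rank_coef z n = (main_series1 n)%:~R + (z - z ^+ 3) * (main_series2 n)%:~R.
Proof.
move=> z4 two0; have z0 : z != 0.
  by apply/negP => /eqP e; move/eqP: z4; rewrite e expr0n /= eq_sym oppr_eq0 oner_eq0.
have [g [eg <-]] := rank_sum_coef z0.
have -> : g = emb F main_series1 + fps_cst (z - z ^+ 3) * emb F main_series2.
  by apply: (@of_fps_inj F); rewrite -eg rank_sum_eighth // of_fpsD of_fpsM.
by rewrite fcoefD fcoef_cstM /= odd_double doubleK.
Qed.

End MainSeries.

(* The eighth roots of unity [z, -z, z^3, -z^3] determine [N a - N (a + 4)];
   the symmetry [N(a) = N(-a)], evaluated at ['i], does the rest. *)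
Lemma separate_classes (K : fieldType) (N : nat -> K) (A B z i : K) :
  (2 : K) != 0 -> z ^+ 4 = -1 -> i ^+ 2 = -1 ->
  (forall x : K, x ^+ 4 = -1 -> \sum_(a < 8) N a * x ^+ a = A + (x - x ^+ 3) * B) ->
  \sum_(a < 8) N a * i ^+ a = \sum_(a < 8) N a * (- i) ^+ a ->
  N 0%N - N 4 = A /\ N 1%N - N 3 = B.
Proof.
move=> two0 z4 i2 h hi.
have z0 : z != 0.
  by apply/negP => /eqP e; move/eqP: z4; rewrite e expr0n /= eq_sym oppr_eq0 oner_eq0.
have i0 : i != 0.
  by apply/negP => /eqP e; move/eqP: i2; rewrite e expr0n /= eq_sym oppr_eq0 oner_eq0.
have S (x : K) : \sum_(a < 8) N a * x ^+ a = (N 0%N + N 1%N * x + N 2 * x ^+ 2 + N 3 * x ^+ 3)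
    + x ^+ 4 * (N 4 + N 5 * x + N 6 * x ^+ 2 + N 7 * x ^+ 3).
  by rewrite !big_ord_recl big_ord0 /= /bump /= !add1n; ring.
have h4 (x : K) : x ^+ 4 = -1 -> (N 0%N - N 4) + (N 1%N - N 5) * x + (N 2 - N 6) * x ^+ 2
    + (N 3 - N 7) * x ^+ 3 = A + (x - x ^+ 3) * B.
  by move=> x4; rewrite -h // S x4; ring.
have {h hi} : i * (2 * (N 1%N - N 3 + N 5 - N 7)) = 0.
  rewrite -[RHS](subrr (\sum_(a < 8) N a * i ^+ a)).
  have e4 (x : K) : x ^+ 2 = -1 -> (x ^+ 3 = - x) * (x ^+ 4 = 1).
    by move=> x2; rewrite (exprM _ 2 2) exprS x2 sqrrN expr1n mulrN1.
  rewrite {2}hi !S !(e4 i) ?(e4 (- i)) ?sqrrN ?i2 //.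
  by ring.
move/eqP; rewrite !mulf_eq0 (negPf i0) (negPf two0) /= => /eqP hi.
have z34 : (z ^+ 3) ^+ 4 = -1 by rewrite exprAC z4 -signr_odd.
have N4 (x : K) : x ^+ 4 = -1 -> (- x) ^+ 4 = -1 by move=> <-; rewrite (exprM _ 2 2) sqrrN -exprM.
(* Comparing [x] with [-x] isolates the odd powers; as z^6 = -z^2, the roots [z] and [z ^+ 3] then
   separate the two remaining terms. *)
have odd (x : K) : x ^+ 4 = -1 -> x != 0 ->
    (N 1%N - N 5) + (N 3 - N 7) * x ^+ 2 = (1 - x ^+ 2) * B.
  move=> x4 x0; apply: (mulfI two0); apply: (mulfI x0).
  have e1 := h4 _ x4; have e2 := h4 _ (N4 _ x4); apply/eqP; rewrite -subr_eq0; apply/eqP.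
  by move/eqP: e1; rewrite -subr_eq0 => /eqP e1; move/eqP: e2; rewrite -subr_eq0 => /eqP e2;
    rewrite -[RHS](subrr 0) -{1}e1 -e2; ring.
have even (x : K) : x ^+ 4 = -1 -> (N 0%N - N 4) + (N 2 - N 6) * x ^+ 2 = A.
  move=> x4; apply: (mulfI two0).
  have e1 := h4 _ x4; have e2 := h4 _ (N4 _ x4).
  have -> : 2 * A = (A + (x - x ^+ 3) * B) + (A + (- x - (- x) ^+ 3) * B) by ring.
  by rewrite -e1 -e2; ring.
have z6 : (z ^+ 3) ^+ 2 = - z ^+ 2 by rewrite -exprM (exprD z 4 2) z4 mulN1r.
have ev1 := even _ z4; have := even _ z34; rewrite z6 => ev2.
have od1 := odd _ z4 z0; have := odd _ z34 (expf_neq0 _ z0); rewrite z6 => od2.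
have z20 : z ^+ 2 != 0 by rewrite expf_neq0.
have eu : N 1%N - N 5 = B.
  apply: (mulfI two0); have -> : 2 * B = (1 - z ^+ 2) * B + (1 - - z ^+ 2) * B by ring.
  by rewrite -od1 -od2; ring.
have ew : N 3 - N 7 = - B.
  by apply: (mulIf z20); apply: (addrI (N 1%N - N 5)); rewrite od1 eu; ring.
split; apply: (mulfI two0).
  transitivity (((N 0%N - N 4) + (N 2 - N 6) * z ^+ 2) + ((N 0%N - N 4) + (N 2 - N 6) * - z ^+ 2)).
    by ring.
  by rewrite ev1 ev2; ring.
transitivity ((N 1%N - N 5) - (N 3 - N 7) + (N 1%N - N 3 + N 5 - N 7)); first by ring.
by rewrite hi eu ew; ring.
Qed.

Lemma rank_classes (n : nat) :
  (NM 0 8 n)%:Z - (NM 4 8 n)%:Z = main_series1 n /\ (NM 1 8 n)%:Z - (NM 3 8 n)%:Z = main_series2 n.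
Proof.
pose N a : algC := (NM a%:Z 8 n)%:R.
have e8 x : (x : algC) ^+ 8 = 1 -> \sum_(a < 8) N a * x ^+ a = rank_coef x n.
  by move=> x8; rewrite rank_coef_eighth.
have i8 : ('i : algC) ^+ 8 = 1 by rewrite (exprM _ 2 4) sqrCi -signr_odd expr0.
have Ni8 : (- 'i : algC) ^+ 8 = 1 by rewrite (exprM _ 2 4) sqrrN sqrCi -signr_odd expr0.
have two0 : (2 : algC) != 0 by rewrite pnatr_eq0.
(* Any fourth root of -1 serves as primitive eighth root. The equality of the values at 'i and -'i
   holds because they are inverse to each other. *)
have [||||h1 h2] := @separate_classes _ N (main_series1 n)%:~R (main_series2 n)%:~R
    (4.-root (-1)) 'i two0.
- exact: rootCK.
- exact: sqrCi.
- by move=> x x4; rewrite e8 ?rank_coef_main // (exprM x 4 2) x4 sqrrN expr1n.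
- by rewrite !e8 // -invCi rank_coefV // neq0Ci.
by split; apply: (@intr_inj algC); rewrite rmorphB.
Qed.

Theorem theorem1p3 :
  (forall n : nat,
     (NM 0 8 n)%:Z - (NM 4 8 n)%:Z =
     sadd (ssub (sadd (sconst 2) (sadd (qg 2 2 16) (qg 2 2 16)))
                (sdiv (smul (Jbar 2 4) (J 6 16)) (Jm 4)))
          (sshift 1 (sdiv (smul (Jbar 2 4) (J 2 16)) (Jm 4))) n)
  /\
  (forall n : nat,
     (NM 1 8 n)%:Z - (NM 3 8 n)%:Z =
     sadd (sadd (ssub (sconst (-1)) (qg 2 2 16)) (qg 5 6 16))
          (sdiv (smul (Jbar 2 4) (J 6 16)) (Jm 4)) n).
Proof. by split=> n; have [] := rank_classes n. Qed.
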